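(* Let $a:\mathbf{T}\to\mathbb{C}$ be piecewise continuous and suppose that the curve $a^\sharp$ does not contain the origin and has winding number zero about the origin. Let $m_0\ge 1$, let $E_{11},E_{12},E_{21},E_{22}$ be fixed complex $m_0\times m_0$ matrices, and for $n\ge 2m_0$ let $E_n$ be the $n\times n$ matrix with these blocks in its four corners and zeros elsewhere. Let $S_{11}$ be the upper-left $m_0\times m_0$ block of $T^{-1}(a)$. Then $$\lim_{n\to\infty}\frac{\det(T_n(a)+E_n)}{\det T_n(a)}=\det\left[\begin{pmatrix} I&0\\ 0&I\end{pmatrix}+\begin{pmatrix}S_{11}&0\\ 0&\widetilde{S}_{11}^{\top}\end{pmatrix}\begin{pmatrix}E_{11}&E_{12}\\ E_{21}&E_{22}\end{pmatrix}\right].$$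
   Context: $\mathbf{T}$ is the complex unit circle. For $a\in L^1(\mathbf{T})$ the Fourier coefficients are $a_k=\frac1{2\pi}\int_{-\pi}^{\pi}a(e^{i\theta})e^{-ik\theta}\,d\theta$, $k\in\mathbf{Z}$; $T(a)=(a_{j-k})_{j,k=1}^\infty$ is the infinite Toeplitz matrix and $T_n(a)=(a_{j-k})_{j,k=1}^n$ its $n\times n$ truncation. A function $a$ on $\mathbf{T}$ is piecewise continuous if the one-sided limits $a(t-0),a(t+0)$ exist at every $t\in\mathbf{T}$. The curve $a^\sharp$ is the continuous closed, naturally oriented curve in the plane obtained from the range of $a$ by filling in the line segment $[a(t-0),a(t+0)]$ for each $t$ at which $a$ has a jump. Under the hypotheses on $a^\sharp$, by a known theorem of Gohberg, $T(a)$ is a bounded invertible operator on $\ell^2$ and $T_n(a)$ is invertible for all sufficiently large $n$. The inverse operator $T^{-1}(a):=[T(a)]^{-1}$ is given by an infinite matrix $(c_{jk})_{j,k=1}^\infty$, and $S_{11}=(c_{jk})_{j,k=1}^{m_0}$. The matrix $E_n$ is $$E_n=\begin{pmatrix}E_{11}&0&E_{12}\\ 0&0&0\\ E_{21}&0&E_{22}\end{pmatrix}.$$ $W_m$ denotes the $m\times m$ counter-identity matrix (ones on the counter-diagonal, zeros elsewhere). For an $m\times m$ matrix $B$, $\widetilde{B}:=W_mBW_m$; $B^\top$ is the transpose (without conjugation), and $\widetilde{S}_{11}^{\top}=(\widetilde{S}_{11})^\top$. $I$ is the $m_0\times m_0$ identity matrix. *)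

(* Defs.v *)
From HB Require Import structures.
From mathcomp Require Import all_boot all_order all_algebra.
From mathcomp Require Import all_classical all_reals all_analysis.
From mathcomp Require Import complex.

Set Implicit Arguments.
Unset Strict Implicit.
Unset Printing Implicit Defensive.

Import Order.TTheory GRing.Theory Num.Theory.
Import numFieldNormedType.Exports.

Local Open Scope classical_set_scope.
Local Open Scope ring_scope.
Local Open Scope complex_scope.

(* The topology on the complex numbers is the one given by the modulus; in the
   library it is carried by the alias [R[i]^o] of [R[i]]. *)

Definition expi (R : realType) (t : R) : R[i] := cos t +i* sin t.

Definition circle (R : realType) : Type := {z : R[i] | `|z| == 1}.

Lemma norm_expi (R : realType) (t : R) : `|expi t| == 1.
Proof. by rewrite normc_def /= cos2Dsin2 sqrtr1. Qed.

Definition cis (R : realType) (t : R) : circle R := exist _ (expi t) (norm_expi t).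

Section Symbol.
Context (R : realType).
Implicit Types a : circle R -> R[i].

Definition onangle a (t : R) : R[i]^o := a (cis t).

Definition piecewise_continuous a : Prop :=
  forall t : R, cvg (onangle a s @[s --> t^'-]) /\
                cvg (onangle a s @[s --> t^'+]).

Definition llimit a (t : R) : R[i] := lim (onangle a s @[s --> t^'-]).
Definition rlimit a (t : R) : R[i] := lim (onangle a s @[s --> t^'+]).

Definition cintegral (D : set R) (g : R -> R[i]) : R[i] :=
  (\int[lebesgue_measure]_(x in D) complex.Re (g x))%R +i*
  (\int[lebesgue_measure]_(x in D) complex.Im (g x))%R.

Definition fourier a (k : int) : R[i] :=
  ((2 * pi)^-1)%:C *
  cintegral `[- pi, pi] (fun t => a (cis t) * expi (- (k%:~R * t))).

(* The point of parameter l of the segment from a(t-0) to a(t+0), where t is an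
   angle.  Where a has no jump the segment is reduced to the common one-sided
   limit.  The value of a at t itself plays no role: a is an element of L^1, and
   the union of these segments is the closed curve, free of the (at most
   countably many) stray points where a(t) lies off its segment. *)
Definition jump_point a (t l : R) : R[i] :=
  (1 - l)%:C * llimit a t + l%:C * rlimit a t.

Definition sharp a : set R[i] :=
  [set z | exists t l : R, 0 <= l <= 1 /\ z = jump_point a t l].

(* [g] on [0, 1] is a continuous closed parametrization of a# with its natural
   orientation: the angle [phi] runs once through a full turn without going
   back, and at each angle at which [phi] stays constant the segment of the jump
   is run through from a(t-0) to a(t+0).  Continuity of [g] forces every segment
   to be covered entirely, and a base point inside a segment is allowed. *)
Definition sharp_curve a (g : R -> R[i]^o) : Prop :=
  [/\ {within `[0, 1], continuous g}, g 0 = g 1 &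
    exists phi l : R -> R,
    [/\ {within `[0, 1], continuous phi},
        {in `[0, 1] &, {homo phi : s s' / s <= s'}},
        phi 1 = phi 0 + 2 * pi,
        {in `[0, 1], forall s, 0 <= l s <= 1 /\
                               g s = jump_point a (phi s) (l s)} &
        {in `[0, 1] &, forall s s', s <= s' -> phi s = phi s' -> l s <= l s'}]].

(* [g] does not meet [z] on [0, 1], and [n] is the total increment of a
   continuous argument [w] of [g - z], counted in turns. *)
Definition winding_number (g : R -> R[i]^o) (z : R[i]) (n : int) : Prop :=
  exists r w : R -> R,
  [/\ {within `[0, 1], continuous w},
      {in `[0, 1], forall s, 0 < r s /\ g s - z = (r s)%:C * expi (w s)} &
      w 1 - w 0 = 2 * pi * n%:~R].

Definition sharp_winding_number a (z : R[i]) (n : int) : Prop :=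
  exists2 g, sharp_curve a g & winding_number g z n.

End Symbol.

Section Operators.
Context (R : realType).
Implicit Types (x y : nat -> R[i]) (A : nat -> nat -> R[i]).
Implicit Types T B : (nat -> R[i]) -> (nat -> R[i]).

Definition l2norm x : \bar R :=
  Lnorm counting 2%:E (fun k : nat => (Normc.normc (x k))%:E).

Definition l2 : set (nat -> R[i]) := [set x | (l2norm x < +oo)%E].

(* The operators are maps on all sequences, but only their action on l2
   matters. *)
(* Linear, and mapping l2 boundedly into l2. *)
Definition bounded_op T : Prop :=
  (forall (c : R[i]) x y, l2 x -> l2 y ->
     T (fun k => c * x k + y k) = (fun k => c * T x k + T y k)) /\
  exists M : R, forall x, l2 x -> (l2norm (T x) <= M%:E * l2norm x)%E.

Definition inverse_op T B : Prop :=
  [/\ bounded_op T, bounded_op B &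
      forall x, l2 x -> T (B x) = x /\ B (T x) = x].

(* 0 if [T] is not a bounded invertible operator; otherwise its action on l2 is
   uniquely determined. *)
Definition inv_op T : (nat -> R[i]) -> (nat -> R[i]) :=
  xget (fun _ _ => 0) [set B | inverse_op T B].

Definition op_of_matrix A : (nat -> R[i]) -> (nat -> R[i]) :=
  fun x j => limn (series (fun k => A j k * x k : R[i]^o)).

Definition matrix_of_op T : nat -> nat -> R[i] :=
  fun j k => T (fun i => (i == k)%:R) j.

End Operators.

Section Toeplitz.
Context (R : realType).
Implicit Types a : circle R -> R[i].

Definition toeplitz_entry a (j k : nat) : R[i] := fourier a (j%:Z - k%:Z).

Definition toeplitz_op a : (nat -> R[i]) -> (nat -> R[i]) :=
  op_of_matrix (toeplitz_entry a).

Definition toeplitz_mx a (n : nat) : 'M[R[i]]_n :=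
  \matrix_(j < n, k < n) toeplitz_entry a j k.

Definition S11 a (m : nat) : 'M[R[i]]_m :=
  \matrix_(j < m, k < m) matrix_of_op (inv_op (toeplitz_op a)) j k.

(* For n >= 2m the two sizes in [conform_mx] agree and the block matrix is
   returned; for n < 2m the matrix is not defined in the source and is 0 here. *)
Definition corner_mx (m : nat) (E11 E12 E21 E22 : 'M[R[i]]_m) (n : nat) :
    'M[R[i]]_n :=
  let p := (n - 2 * m)%N in
  conform_mx (0 : 'M[R[i]]_n)
    (block_mx E11 (row_mx 0 E12)
              (col_mx 0 E21) (block_mx (0 : 'M[R[i]]_p) 0 0 E22)
     : 'M[R[i]]_(m + (p + m))).

Definition counter_id (m : nat) : 'M[R[i]]_m :=
  \matrix_(i < m, j < m) (j == rev_ord i)%:R.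

Definition flip_mx (m : nat) (B : 'M[R[i]]_m) : 'M[R[i]]_m :=
  counter_id m *m B *m counter_id m.

End Toeplitz.

(* Main.v *)
(** Write log a = log|a| + i arg a along the closed curve: winding number zero makes the
    argument single-valued and, as no segment of the curve meets the origin, all its
    values over one angle span less than pi.  Averaging local midpoints of these
    values against a Fejer kernel gives an analytic polynomial f with |arg a - Re f|
    bounded away from pi/2; hence a = s q, where q = (1 + i f / m)^m is a polynomial
    close to exp(i f), invertible on the circle up to a polynomial factor r, and Re s
    is bounded below.  Thus T_n(s) and T_n(q) are uniformly invertible, and T(a) =
    T(s) T(q) is injective; since T_n(q) T_n(s) and T_n(a) differ only in deg q rows,
    a weak compactness argument shows that T_n(a) is uniformly invertible for large n.
    Then T_n(a)^-1 e_k tends to T(a)^-1 e_k in l2, which governs the corners of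
    T_n(a)^-1 once T_n(a) is transposed and reversed; the ratio of determinants is
    det(1 + C_n E) with C_n the matrix formed by these four corners. *)

Require Import Defs.
From mathcomp Require Import all_boot all_order all_algebra.
From mathcomp Require Import all_classical all_reals all_analysis.
From mathcomp Require Import complex measurable_realfun.
From mathcomp Require Import ring lra zify.
Import Order.TTheory GRing.Theory Num.Theory.
Import numFieldNormedType.Exports.
Set Implicit Arguments.
Unset Strict Implicit.
Unset Printing Implicit Defensive.
Local Open Scope classical_set_scope.
Local Open Scope ring_scope.
Local Open Scope complex_scope.

(** * Finite sections of two-sided sequences *)

Section SquaredModulus.
Context (R : realType).
Implicit Types (x y z : R[i]).

(** Since [a] may jump, it need not have a continuous logarithm on the circle; only the curve, which
    runs along the jump segments, carries a continuous argument. What survives is a half-plane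
    condition: over one angle the arguments stay less than [pi] apart, for otherwise an intermediate
    value would give two points of one segment in opposite directions. Compactness extends this to
    nearby angles with a margin, and the margin pays for all later approximations. The analytic
    factor is a polynomial rather than [exp (i f)] so that the sections of [T(q) T(s)] and [T(a)]
    disagree in a bounded number of rows, where weak convergence is as good as strong convergence.
    Uniform invertibility of [T_n(q)] fails for a general polynomial without zeros on the circle;
    here it comes from the companion [r = (1 - i f / m)^m], because lower triangular sections
    multiply exactly. Finally, the corners need the columns of the inverse sections to converge in
    norm: coordinatewise convergence says nothing about their last entries. *)

Definition sqn z : R := complex.Re z ^+ 2 + complex.Im z ^+ 2.

Lemma ReD x y : complex.Re (x + y) = complex.Re x + complex.Re y.
Proof. by case: x y => ? ? [? ?]. Qed.

Lemma ImD x y : complex.Im (x + y) = complex.Im x + complex.Im y.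
Proof. by case: x y => ? ? [? ?]. Qed.

Lemma ReN x : complex.Re (- x) = - complex.Re x.
Proof. by case: x. Qed.

Lemma ImN x : complex.Im (- x) = - complex.Im x.
Proof. by case: x. Qed.

Lemma ReM x y :
  complex.Re (x * y) = complex.Re x * complex.Re y - complex.Im x * complex.Im y.
Proof. by case: x y => ? ? [? ?]. Qed.

Lemma ImM x y :
  complex.Im (x * y) = complex.Re x * complex.Im y + complex.Im x * complex.Re y.
Proof. by case: x y => ? ? [? ?]. Qed.

Lemma Re_sum (I : Type) (r : seq I) (P : pred I) (F : I -> R[i]) :
  complex.Re (\sum_(i <- r | P i) F i) = \sum_(i <- r | P i) complex.Re (F i).
Proof. by apply: (big_morph _ ReD). Qed.

Lemma Im_sum (I : Type) (r : seq I) (P : pred I) (F : I -> R[i]) :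
  complex.Im (\sum_(i <- r | P i) F i) = \sum_(i <- r | P i) complex.Im (F i).
Proof. by apply: (big_morph _ ImD). Qed.

Lemma sqn_ge0 z : 0 <= sqn z.
Proof. by rewrite addr_ge0 ?sqr_ge0. Qed.

Lemma sqn0 : sqn 0 = 0.
Proof. by rewrite /sqn /= expr0n /= addr0. Qed.

Lemma sqn1 : sqn 1 = 1.
Proof. by rewrite /sqn /= expr1n expr0n /= addr0. Qed.

Lemma sqn_eq0 z : (sqn z == 0) = (z == 0).
Proof.
by case: z => a b; rewrite /sqn /= paddr_eq0 ?sqr_ge0 // !sqrf_eq0 eq_complex.
Qed.

Lemma sqnN z : sqn (- z) = sqn z.
Proof. by rewrite /sqn ReN ImN !sqrrN. Qed.

Lemma sqnM x y : sqn (x * y) = sqn x * sqn y.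
Proof. rewrite /sqn ReM ImM; ring. Qed.

Lemma sqnX x n : sqn (x ^+ n) = sqn x ^+ n.
Proof. by elim: n => [|n IH]; rewrite ?sqn1 // !exprS sqnM IH. Qed.

Lemma sqnV z : sqn z^-1 = (sqn z)^-1.
Proof.
have [->|z0] := eqVneq z 0; first by rewrite invr0 sqn0 invr0.
have sz : sqn z != 0 by rewrite sqn_eq0.
by apply: (mulfI sz); rewrite -sqnM mulfV // sqn1 mulfV.
Qed.

Lemma sqnJ z : sqn (conjc z) = sqn z.
Proof. by case: z => a b; rewrite /sqn /= sqrrN. Qed.

Lemma sqnR (c : R) : sqn c%:C = c ^+ 2.
Proof. by rewrite /sqn /= expr0n /= addr0. Qed.

Lemma sqn_normc z : Normc.normc z ^+ 2 = sqn z.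
Proof. by case: z => a b; rewrite /= sqr_sqrtr // addr_ge0 ?sqr_ge0. Qed.

Lemma mulcJ z : z * conjc z = (sqn z)%:C.
Proof. by case: z => a b; rewrite /sqn /=; simpc; congr (_ +i* _); ring. Qed.

Lemma sqnD_le x y : sqn (x + y) <= 2 * sqn x + 2 * sqn y.
Proof.
rewrite /sqn ReD ImD; set a := complex.Re x; set b := complex.Im x.
set c := complex.Re y; set d := complex.Im y.
rewrite -subr_ge0.
have -> : 2 * (a ^+ 2 + b ^+ 2) + 2 * (c ^+ 2 + d ^+ 2) -
  ((a + c) ^+ 2 + (b + d) ^+ 2) = (a - c) ^+ 2 + (b - d) ^+ 2 by ring.
by rewrite addr_ge0 ?sqr_ge0.
Qed.

Lemma sqr_Re_le z : complex.Re z ^+ 2 <= sqn z.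
Proof. by rewrite lerDl sqr_ge0. Qed.

Lemma sqr_Im_le z : complex.Im z ^+ 2 <= sqn z.
Proof. by rewrite lerDr sqr_ge0. Qed.

Lemma ReJM_le x y : 2 * complex.Re (conjc x * y) <= sqn x + sqn y.
Proof.
case: x y => a b [c d]; rewrite /sqn /= -subr_ge0.
have -> : a ^+ 2 + b ^+ 2 + (c ^+ 2 + d ^+ 2) - 2 * (a * c - - b * d) =
  (a - c) ^+ 2 + (b - d) ^+ 2 by ring.
by rewrite addr_ge0 ?sqr_ge0.
Qed.

(** Induction step of Cauchy-Schwarz without square roots: twice the scalar product of [x] and [y]
    is at most [2 sqrt (p q r s)], hence at most [p s + r q] by the arithmetic-geometric mean
    inequality. *)
Lemma cauchy_schwarz_step (x y : R[i]) (p q r s : R) :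
  0 <= p -> 0 <= q -> 0 <= r -> 0 <= s ->
  sqn x <= p * q -> sqn y <= r * s -> sqn (x + y) <= (p + r) * (q + s).
Proof.
move=> p0 q0 r0 s0 hx hy.
have cross : (complex.Re x * complex.Re y + complex.Im x * complex.Im y) ^+ 2 <=
    (p * q) * (r * s).
  apply: le_trans (ler_pM (sqn_ge0 _) (sqn_ge0 _) hx hy); rewrite -subr_ge0.
  have -> : sqn x * sqn y -
    (complex.Re x * complex.Re y + complex.Im x * complex.Im y) ^+ 2 =
    (complex.Re x * complex.Im y - complex.Im x * complex.Re y) ^+ 2.
    by rewrite /sqn; ring.
  exact: sqr_ge0.
have amgm : 2 * (complex.Re x * complex.Re y + complex.Im x * complex.Im y) <=
    p * s + r * q.
  have ps : 0 <= p * s by rewrite mulr_ge0.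
  have rq : 0 <= r * q by rewrite mulr_ge0.
  rewrite real_leNgt ?num_real //; apply/negP => h.
  have : (p * s + r * q) ^+ 2 <
    (2 * (complex.Re x * complex.Re y + complex.Im x * complex.Im y)) ^+ 2.
    by rewrite ltr_pXn2r // nnegrE ?addr_ge0 // ltW // (le_lt_trans _ h) // addr_ge0.
  have : 0 <= (p * s - r * q) ^+ 2 by exact: sqr_ge0.
  set X := (_ + _ : R) in cross h *; nra.
move: hx hy; rewrite /sqn ReD ImD => hx hy; nra.
Qed.

Lemma cauchy_schwarz (I : Type) (r : seq I) (P : pred I) (u x : I -> R[i]) :
  sqn (\sum_(i <- r | P i) u i * x i) <=
  (\sum_(i <- r | P i) sqn (u i)) * (\sum_(i <- r | P i) sqn (x i)).
Proof.
elim: r => [|i r IH]; first by rewrite !big_nil sqn0 mulr0.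
rewrite !big_cons; case: ifP => // _.
apply: cauchy_schwarz_step; rewrite ?sqn_ge0 ?sumr_ge0 ?sqnM //.
all: by move=> *; exact: sqn_ge0.
Qed.

End SquaredModulus.

Lemma eq_ler (R : numDomainType) (x y : R) : x = y -> x <= y.
Proof. by move=> ->. Qed.

Section FiniteSections.
Context (R : realType).
Implicit Types (x y : nat -> R[i]) (t : int -> R[i]).

Definition sqsum n x : R := \sum_(0 <= k < n) sqn (x k).

(** Only the first [n] entries of [x] enter, but the row [j] is free, so sections of different sizes
    can be compared and composed without casts. *)
Definition tsec t n x : nat -> R[i] :=
  fun j => \sum_(0 <= k < n) t (j%:Z - k%:Z) * x k.

Lemma sqsum_ge0 n x : 0 <= sqsum n x.
Proof. by apply: sumr_ge0 => *; exact: sqn_ge0. Qed.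

Lemma eq_sqsum n x y : (forall k, (k < n)%N -> x k = y k) -> sqsum n x = sqsum n y.
Proof. by move=> e; apply: eq_big_nat => k /andP[_ kn]; rewrite e. Qed.

Lemma sqsumD_le n x y :
  sqsum n (fun k => x k + y k) <= 2 * sqsum n x + 2 * sqsum n y.
Proof.
rewrite /sqsum !mulr_sumr -big_split /=; apply: ler_sum => k _; exact: sqnD_le.
Qed.

Lemma sqsumN n x : sqsum n (fun k => - x k) = sqsum n x.
Proof. by apply: eq_bigr => k _; rewrite sqnN. Qed.

Lemma sqsumZ n c x : sqsum n (fun k => c * x k) = sqn c * sqsum n x.
Proof. by rewrite /sqsum mulr_sumr; apply: eq_bigr => k _; rewrite sqnM. Qed.

Lemma le_sqsum m n x : (m <= n)%N -> sqsum m x <= sqsum n x.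
Proof.
move=> mn; rewrite /sqsum (big_cat_nat (leq0n m) mn) /=.
by rewrite lerDl; apply: sumr_ge0 => *; exact: sqn_ge0.
Qed.

Lemma sqn_le_sqsum n x k : (k < n)%N -> sqn (x k) <= sqsum n x.
Proof.
move=> kn; apply: le_trans (le_sqsum x kn).
by rewrite /sqsum big_nat_recr //= lerDr; exact: sqsum_ge0.
Qed.

Lemma sqsum_eq0 n x k : sqsum n x <= 0 -> (k < n)%N -> x k = 0.
Proof.
move=> s0 kn; apply/eqP; rewrite -sqn_eq0 eq_le sqn_ge0 andbT.
exact: le_trans (sqn_le_sqsum x kn) s0.
Qed.

Lemma eq_tsec t n x y j : (forall k, (k < n)%N -> x k = y k) ->
  tsec t n x j = tsec t n y j.
Proof. by move=> e; apply: eq_big_nat => k /andP[_ kn]; rewrite e. Qed.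

Lemma tsecD t n x y j :
  tsec t n (fun k => x k + y k) j = tsec t n x j + tsec t n y j.
Proof. by rewrite /tsec -big_split; apply: eq_bigr => k _; rewrite mulrDr. Qed.

Lemma tsecN t n x j : tsec t n (fun k => - x k) j = - tsec t n x j.
Proof. by rewrite /tsec -sumrN; apply: eq_bigr => k _; rewrite mulrN. Qed.

Lemma tsecZ t n c x j : tsec t n (fun k => c * x k) j = c * tsec t n x j.
Proof. by rewrite /tsec mulr_sumr; apply: eq_bigr => k _; rewrite mulrCA. Qed.

(** Here and in [section_stable] the constants bound squared norms. *)
Definition section_bounded t (M : R) :=
  forall n x, sqsum n (tsec t n x) <= M * sqsum n x.

Definition section_stable t (K : R) n :=
  forall x, sqsum n x <= K * sqsum n (tsec t n x).

Lemma sqsum_rev n x : sqsum n (fun k => x (n - k.+1)%N) = sqsum n x.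
Proof. by rewrite /sqsum [RHS]big_nat_rev /= add0n. Qed.

(** Reversing the order of the coordinates turns a Toeplitz section into its transpose, which is the
    section of [t \o -%R]. Bounds and stability therefore pass to the transpose. *)
Lemma tsec_opp t n x j : (j < n)%N ->
  tsec (t \o -%R) n x j = tsec t n (fun k => x (n - k.+1)%N) (n - j.+1)%N.
Proof.
move=> jn; rewrite /tsec big_nat_rev /= add0n; apply: eq_big_nat => k /andP[_ kn].
by congr (t _ * _); lia.
Qed.

Lemma section_bounded_opp t M : section_bounded t M -> section_bounded (t \o -%R) M.
Proof.
move=> b n x; rewrite -(sqsum_rev n x); apply: le_trans (b n _).
rewrite -(sqsum_rev n (tsec t n _)) le_eqVlt; apply/orP; left; apply/eqP.
by apply: eq_sqsum => j jn; rewrite tsec_opp.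
Qed.

Lemma section_stable_opp t K n : section_stable t K n -> section_stable (t \o -%R) K n.
Proof.
move=> b x; rewrite -(sqsum_rev n x); apply: le_trans (b _) _.
rewrite -(sqsum_rev n (tsec t n _)) le_eqVlt; apply/orP; left; apply/eqP.
by congr (_ * _); apply: eq_sqsum => j jn; rewrite tsec_opp.
Qed.

End FiniteSections.

(** * Complex limits and square summable sequences *)

Section ComplexLimits.
Context (R : realType).

(** The modulus of [R[i]] takes its values in [R[i]]; this links it to the real-valued [sqn], in
    which the estimates are carried out. *)
Lemma normC_sqn (z : R[i]^o) : `|z| = (Num.sqrt (sqn z))%:C.
Proof. exact: normc_def. Qed.

Section Filtered.
Context {T : Type} {F : set_system T} {FF : Filter F}.
Implicit Types (u v : T -> R[i]) (z : R[i]).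

Lemma cvgC_sqn u z :
  ((fun i => u i : R[i]^o) @ F --> (z : R[i]^o)) <->
  ((fun i => sqn (u i - z)) @ F --> (0 : R)).
Proof.
split=> [/cvgrPdist_lt h|/cvgrPdist_lt h]; apply/cvgrPdist_lt => e e0.
  have e1 : 0 < (Num.sqrt e)%:C by rewrite ltcR sqrtr_gt0.
  near=> i.
  have : `|z - u i| < (Num.sqrt e)%:C by near: i; exact: h.
  rewrite normC_sqn ltcR ltr_sqrt // -sqnN opprB => hi.
  by rewrite sub0r normrN ger0_norm ?sqn_ge0.
have [e1 e2] : 0 < complex.Re e /\ e = (complex.Re e)%:C.
  by case: e e0 => a b; rewrite ltcE /= => /andP[/eqP -> ].
near=> i.
have : `|0 - sqn (u i - z)| < complex.Re e ^+ 2.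
  by near: i; apply: h; rewrite exprn_gt0.
rewrite sub0r normrN ger0_norm ?sqn_ge0 // => hi.
rewrite normC_sqn e2 ltcR -[ltRHS]ger0_norm ?(ltW e1) // -sqrtr_sqr ltr_sqrt ?exprn_gt0 //.
by rewrite -sqnN opprB.
Unshelve. all: by end_near. Qed.

Lemma cvgC_ReIm u z :
  (fun i => complex.Re (u i)) @ F --> complex.Re z ->
  (fun i => complex.Im (u i)) @ F --> complex.Im z ->
  (fun i => u i : R[i]^o) @ F --> (z : R[i]^o).
Proof.
move=> hr hi; apply/cvgC_sqn.
have -> : (0 : R) = (complex.Re z - complex.Re z) * (complex.Re z - complex.Re z)
   + (complex.Im z - complex.Im z) * (complex.Im z - complex.Im z).
  by rewrite !subrr mulr0 addr0.
have -> : (fun i => sqn (u i - z)) = (fun i =>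
  (complex.Re (u i) - complex.Re z) * (complex.Re (u i) - complex.Re z) +
  (complex.Im (u i) - complex.Im z) * (complex.Im (u i) - complex.Im z)).
  by apply/funext => i; rewrite /sqn ReD ImD ReN ImN !expr2.
by apply: cvgD; apply: cvgM; (apply: cvgB; [by []|exact: cvg_cst]).
Qed.

Lemma sqr_cvg0 (f : T -> R) : (fun i => f i ^+ 2) @ F --> (0 : R) -> f @ F --> (0 : R).
Proof.
move=> /cvgrPdist_lt h; apply/cvgrPdist_lt => e e0.
near=> i.
have : `|0 - f i ^+ 2| < e ^+ 2 by near: i; apply: h; rewrite exprn_gt0.
rewrite !sub0r !normrN normrX ltr_pXn2r // nnegrE; exact: ltW.
Unshelve. all: by end_near. Qed.

Lemma squeeze0 (f g : T -> R) : (forall i, 0 <= f i <= g i) ->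
  g @ F --> (0 : R) -> f @ F --> (0 : R).
Proof.
move=> fg g0; apply: (squeeze_cvgr _ (cvg_cst (0 : R)) g0).
by near=> i; exact: fg.
Unshelve. all: by end_near. Qed.

Lemma cvg_const_le {FP : ProperFilter F} (f : T -> R) (l K : R) :
  f @ F --> l -> (\forall i \near F, f i <= K) -> l <= K.
Proof. by move=> fl fK; have := @closed_cvg _ _ F FP f _ (@closed_le _ K) fK _ fl. Qed.

Lemma cvgC_Re u z : (fun i => u i : R[i]^o) @ F --> (z : R[i]^o) ->
  (fun i => complex.Re (u i)) @ F --> complex.Re z.
Proof.
move=> /cvgC_sqn h; apply/subr_cvg0/sqr_cvg0; apply: squeeze0 h => i.
by rewrite sqr_ge0 /= -ReN -ReD sqr_Re_le.
Qed.

Lemma cvgC_Im u z : (fun i => u i : R[i]^o) @ F --> (z : R[i]^o) ->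
  (fun i => complex.Im (u i)) @ F --> complex.Im z.
Proof.
move=> /cvgC_sqn h; apply/subr_cvg0/sqr_cvg0; apply: squeeze0 h => i.
by rewrite sqr_ge0 /= -ImN -ImD sqr_Im_le.
Qed.

Lemma cvg_sqn u z : (fun i => u i : R[i]^o) @ F --> (z : R[i]^o) ->
  (fun i => sqn (u i)) @ F --> sqn z.
Proof.
by move=> h; apply: cvgD; rewrite expr2; apply: cvgM;
  solve [exact: cvgC_Re|exact: cvgC_Im].
Qed.

Lemma cvgC_sum (I : Type) (r : seq I) (f : T -> I -> R[i]) (g : I -> R[i]) :
  (forall k, (fun i => f i k : R[i]^o) @ F --> (g k : R[i]^o)) ->
  (fun i => \sum_(k <- r) f i k : R[i]^o) @ F --> (\sum_(k <- r) g k : R[i]^o).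
Proof.
move=> h; elim: r => [|k r IH].
  rewrite big_nil; under eq_fun do rewrite big_nil; exact: cvg_cst.
rewrite big_cons; under eq_fun do rewrite big_cons.
exact: cvgD (h k) IH.
Qed.

Lemma cvg_sqsum n (xi : T -> nat -> R[i]) x :
  (forall k, (fun i => xi i k : R[i]^o) @ F --> (x k : R[i]^o)) ->
  (fun i => sqsum n (xi i)) @ F --> sqsum n x.
Proof.
move=> h; rewrite /sqsum.
elim: n => [|n IH].
  rewrite big_geq //; under eq_fun do rewrite big_geq //; exact: cvg_cst.
rewrite big_nat_recr //=; under eq_fun do rewrite big_nat_recr //=.
by apply: cvgD => //; exact: cvg_sqn.
Qed.

End Filtered.

Lemma cvgC_uniq {T : Type} {F : set_system T} {FF : ProperFilter F} (u : T -> R[i])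
    (z w : R[i]) :
  (fun i => u i : R[i]^o) @ F --> (z : R[i]^o) ->
  (fun i => u i : R[i]^o) @ F --> (w : R[i]^o) -> z = w.
Proof. by move=> h1 h2; apply: (cvg_unique _ h1 h2). Qed.

End ComplexLimits.

Section SquareSummable.
Context (R : realType).
Implicit Types (u v x y : nat -> R[i]).

(** Membership in l2 with an explicit bound on the squared norm; the extended-real norm only
    reappears when operators on l2 are treated. *)
Definition sqbdd x (K : R) := forall n, sqsum n x <= K.

(** The squared norm of the part of [x] from index [m] on, provided that [x] is square summable;
    otherwise the limit has no meaning. *)
Definition tail x m : R := limn (fun n => sqsum n x) - sqsum m x.

Lemma sqbdd_cvg x K : sqbdd x K -> cvgn (fun n => sqsum n x).
Proof.
move=> xK; apply: nondecreasing_is_cvgn.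
  by move=> m n; exact: le_sqsum.
by exists K => _ [n _ <-].
Qed.

Lemma tail_ge x K m n : sqbdd x K -> (m <= n)%N ->
  \sum_(m <= k < n) sqn (x k) <= tail x m.
Proof.
move=> xK mn; rewrite lerBrDl.
have -> : sqsum m x + \sum_(m <= k < n) sqn (x k) = sqsum n x.
  by rewrite /sqsum [RHS](big_cat_nat (leq0n m) mn).
apply: nondecreasing_cvgn_le; last exact: sqbdd_cvg xK.
by move=> ? ?; exact: le_sqsum.
Qed.

Lemma tail_ge0 x K m : sqbdd x K -> 0 <= tail x m.
Proof. by move=> xK; apply: le_trans (tail_ge xK (leqnn m)); rewrite big_geq. Qed.

Lemma tail_cvg0 x K : sqbdd x K -> tail x @ \oo --> (0 : R).
Proof.
move=> xK; rewrite -(subrr (limn (fun n => sqsum n x))).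
by apply: cvgB; [exact: cvg_cst|exact: sqbdd_cvg xK].
Qed.

Definition pair u x : R[i] := limn (series (fun k => u k * x k : R[i]^o)).

Lemma sum_sqn_cvg u x K L : sqbdd u K -> sqbdd x L ->
  cvgn (series (fun k => sqn (u k) + sqn (x k))).
Proof.
move=> uK xL; have -> : series (fun k => sqn (u k) + sqn (x k)) =
   (fun n => sqsum n u + sqsum n x).
  by apply/funext => n; rewrite /series /= big_split.
by apply: is_cvgD; [exact: sqbdd_cvg uK|exact: sqbdd_cvg xL].
Qed.

(** Absolute convergence, by comparison of [|u k x k|] with [|u k|^2 + |x k|^2]. *)
Lemma pair_cvg u x K L : sqbdd u K -> sqbdd x L ->
  (fun n => \sum_(0 <= k < n) u k * x k : R[i]^o) @ \oo --> (pair u x : R[i]^o).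
Proof.
move=> uK xL.
suff [z hz] : exists z : R[i],
  (fun n => \sum_(0 <= k < n) u k * x k : R[i]^o) @ \oo --> (z : R[i]^o).
  by rewrite /pair; have -> := cvg_lim (@norm_hausdorff _ _) hz.
have b : forall k, sqn (u k * x k) <= (sqn (u k) + sqn (x k)) ^+ 2.
  move=> k; rewrite sqnM; have := sqn_ge0 (u k); have := sqn_ge0 (x k); nra.
have ser_cvg (f : nat -> R) : (forall k, f k ^+ 2 <= sqn (u k * x k)) ->
    cvgn (series f).
  move=> hf; apply: normed_cvg.
  have g0 k : 0 <= sqn (u k) + sqn (x k) by rewrite addr_ge0 ?sqn_ge0.
  have fg k : `|f k| <= sqn (u k) + sqn (x k).
    rewrite -(@ler_pXn2r _ 2) ?nnegrE // -normrX ger0_norm ?sqr_ge0 //.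
    exact: le_trans (hf k) (b k).
  exact: (@series_le_cvg R (fun k => `|f k|) _ (fun k => normr_ge0 _) g0 fg
    (sum_sqn_cvg uK xL)).
have hr := ser_cvg _ (fun k => sqr_Re_le (u k * x k)).
have hi := ser_cvg _ (fun k => sqr_Im_le (u k * x k)).
exists (limn (series (fun k => complex.Re (u k * x k))) +i*
  limn (series (fun k => complex.Im (u k * x k)))).
apply: cvgC_ReIm => /=.
  by under eq_fun do rewrite Re_sum; exact: hr.
by under eq_fun do rewrite Im_sum; exact: hi.
Qed.

Lemma pair_lim u x z :
  (fun n => \sum_(0 <= k < n) u k * x k : R[i]^o) @ \oo --> (z : R[i]^o) ->
  pair u x = z.
Proof. by move=> h; rewrite /pair; have -> := cvg_lim (@norm_hausdorff _ _) h. Qed.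

Lemma pair_tail u x K L m : sqbdd u K -> sqbdd x L ->
  sqn (pair u x - \sum_(0 <= k < m) u k * x k) <= tail u m * tail x m.
Proof.
move=> uK xL.
have h : (fun n => sqn (\sum_(0 <= k < n) u k * x k - \sum_(0 <= k < m) u k * x k)) @ \oo -->
   sqn (pair u x - \sum_(0 <= k < m) u k * x k).
  by apply: cvg_sqn; apply: cvgB; [exact: pair_cvg uK xL|exact: cvg_cst].
apply: (cvg_const_le h).
near=> n; have mn : (m <= n)%N by near: n; exact: nbhs_infty_ge.
rewrite (big_cat_nat (leq0n m) mn) /= addrAC subrr add0r.
apply: le_trans (cauchy_schwarz _ _ _ _) _.
apply: ler_pM; rewrite ?sumr_ge0 //; try by move=> *; exact: sqn_ge0.
all: by apply: tail_ge; eauto.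
Unshelve. all: by end_near. Qed.

(** Lower semicontinuity of the norm under coordinatewise convergence. The lengths [N i] may vary,
    as long as they eventually exceed every [m]. *)
Lemma sqbdd_lim {I : Type} {F : set_system I} {FF : ProperFilter F} (N : I -> nat)
    (xi : I -> nat -> R[i]) x (K : R) :
  (forall m, \forall i \near F, (m <= N i)%N) ->
  (forall i, sqsum (N i) (xi i) <= K) ->
  (forall k, (fun i => xi i k : R[i]^o) @ F --> (x k : R[i]^o)) -> sqbdd x K.
Proof.
move=> NF xiK xix m.
apply: (cvg_const_le (F := F) (f := fun i => sqsum m (xi i))); first exact: cvg_sqsum.
near=> i; apply: le_trans (xiK i); apply: le_sqsum.
by near: i; exact: NF.
Unshelve. all: by end_near. Qed.

(* Bounded coordinatewise convergence is weak convergence in l2. *)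
Lemma weak_lim {I : Type} {F : set_system I} {FF : ProperFilter F} (N : I -> nat)
    (xi : I -> nat -> R[i]) x u (K L : R) :
  (forall m, \forall i \near F, (m <= N i)%N) ->
  (forall i, sqsum (N i) (xi i) <= K) ->
  (forall k, (fun i => xi i k : R[i]^o) @ F --> (x k : R[i]^o)) -> sqbdd u L ->
  (fun i => \sum_(0 <= k < N i) u k * xi i k : R[i]^o) @ F --> (pair u x : R[i]^o).
Proof.
move=> NF xiK xix uL.
have xK : sqbdd x K by exact: sqbdd_lim NF xiK xix.
have K0 : 0 <= K by apply: le_trans (xK 0%N); exact: sqsum_ge0.
have txK m : tail x m <= K.
  rewrite lerBlDr; apply: ler_wpDr; first exact: sqsum_ge0.
  apply: limr_le; first exact: sqbdd_cvg xK.
  by near=> n; exact: xK.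
apply/cvgC_sqn; apply/cvgrPdist_lt => e e0.
(* The head contributes less than [2 (e / 4)] and the two tails at most [2 * 4 * (tail u m * K)],
   which is at most [e / 2] for this choice. [K + 1] avoids a division by 0. *)
have K1 : 0 < 16 * (K + 1) by rewrite mulr_gt0 // ltr_wpDl.
have [m hm] : exists m, tail u m < e / (16 * (K + 1)).
  have /cvgrPdist_lt /(_ _ (divr_gt0 e0 K1)) := tail_cvg0 uL.
  move=> [m _ /(_ m (leqnn m))]; rewrite sub0r normrN ger0_norm ?(tail_ge0 _ uL) // => h.
  by exists m.
have hA : (fun i => sqn (\sum_(0 <= k < m) u k * (xi i k - x k))) @ F --> (0 : R).
  have -> : (0 : R) = sqn (\sum_(0 <= k < m) u k * (x k - x k)).
    by rewrite big1 ?sqn0 // => k _; rewrite subrr mulr0.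
  apply: cvg_sqn.
  apply: cvgC_sum => k.
  by apply: (@cvgMl_tmp R[i]^o); apply: cvgB; [exact: xix|exact: cvg_cst].
have e4 : 0 < e / 4 by rewrite divr_gt0.
move/cvgrPdist_lt: hA => /(_ _ e4) hA.
near=> i.
rewrite sub0r normrN ger0_norm ?sqn_ge0 //.
have mN : (m <= N i)%N by near: i; exact: NF.
have A4 : sqn (\sum_(0 <= k < m) u k * (xi i k - x k)) < e / 4.
  have : `|0 - sqn (\sum_(0 <= k < m) u k * (xi i k - x k))| < e / 4.
    by near: i; exact: hA.
  by rewrite sub0r normrN ger0_norm ?sqn_ge0.
have B : sqn (\sum_(m <= k < N i) u k * xi i k) <= tail u m * K.
  apply: le_trans (cauchy_schwarz _ _ _ _) _.
  apply: ler_pM; rewrite ?sumr_ge0 //; try by move=> *; exact: sqn_ge0.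
    exact: tail_ge uL mN.
  apply: le_trans (xiK i).
  rewrite /sqsum (big_cat_nat (leq0n m) mN) /= lerDr sumr_ge0 // => *.
  exact: sqn_ge0.
have D : sqn (pair u x - \sum_(0 <= k < m) u k * x k) <= tail u m * K.
  apply: le_trans (pair_tail m uL xK) _.
  by apply: ler_wpM2l => //; exact: tail_ge0 uL.
have -> : \sum_(0 <= k < N i) u k * xi i k - pair u x =
   \sum_(0 <= k < m) u k * (xi i k - x k) +
   (\sum_(m <= k < N i) u k * xi i k - (pair u x - \sum_(0 <= k < m) u k * x k)).
  under [X in _ = X + _]eq_bigr do rewrite mulrBr.
  rewrite (big_cat_nat (leq0n m) mN) /= sumrB; ring.
apply: le_lt_trans (sqnD_le _ _) _.
have : sqn (\sum_(m <= k < N i) u k * xi i k - (pair u x - \sum_(0 <= k < m) u k * x k))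
  <= 4 * (tail u m * K).
  apply: le_trans (sqnD_le _ _) _; rewrite sqnN.
  set P := tail u m * K in B D *; lra.
have : tail u m * K <= e / 16.
  have t0 := tail_ge0 m uL.
  have : tail u m * (K + 1) <= e / 16.
    have -> : e / 16 = e / (16 * (K + 1)) * (K + 1).
      by field; rewrite lt0r_neq0 // ltr_wpDl.
    apply: ler_wpM2r; [by rewrite addr_ge0|exact: ltW].
  nra.
set P := tail u m * K in B D *; lra.
Unshelve. all: by end_near. Qed.

End SquareSummable.

(** * Operators with stable finite sections *)

Lemma big_nat_eq0 (V : nmodType) (m n : nat) (F : nat -> V) :
  (forall k, (m <= k)%N -> (k < n)%N -> F k = 0) -> \sum_(m <= k < n) F k = 0.
Proof. by move=> h; rewrite big_nat big1 // => k /andP[]; exact: h. Qed.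

Section Ultralimits.
Context (R : realType) (I : Type) (U : set_system I) (UU : UltraFilter U).

Lemma ultra_cvg (f : I -> R) (K : R) : (forall i, `|f i| <= K) ->
  exists l : R, f @ U --> l.
Proof.
move=> fK; have c : compact (`[- K, K] : set R) by exact: segment_compact.
have Uf : UltraFilter (f @ U).
  split=> [|G GF fG]; first exact: fmap_proper_filter.
  apply/seteqP; split=> // B GB.
  have [//|nB] := in_ultra_setVsetC (f @^-1` B) UU.
  have GnB : G (~` B) by exact: fG.
  by have /filter_ex [? []] : G (B `&` (~` B)) by exact: filterI.
rewrite compact_ultra in c; have [|l [_ fl]] := c _ Uf; last by exists l.
have h i : (f @^-1` [set` `[- K, K]]) i by rewrite /= in_itv /= -ler_norml.
exact: (filterE _ h).
Qed.

Lemma ultra_cvgC (f : I -> R[i]) (K : R) : (forall i, sqn (f i) <= K) ->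
  exists l : R[i], (fun i => f i : R[i]^o) @ U --> (l : R[i]^o).
Proof.
move=> fK.
have b (g : I -> R) : (forall i, g i ^+ 2 <= sqn (f i)) -> exists l : R, g @ U --> l.
  move=> gf; apply: (@ultra_cvg _ (Num.sqrt K)) => i.
  by rewrite -sqrtr_sqr; apply: ler_wsqrtr; exact: le_trans (gf i) (fK i).
have [r hr] := b _ (fun i => sqr_Re_le (f i)).
have [s hs] := b _ (fun i => sqr_Im_le (f i)).
by exists (r +i* s); apply: cvgC_ReIm.
Qed.

(** One ultrafilter serves all coordinates at once, so there is no diagonal extraction of
    subsequences. *)
Lemma ultra_cvg_seq (xi : I -> nat -> R[i]) (K : R) :
  (forall i k, sqn (xi i k) <= K) ->
  exists x : nat -> R[i], forall k,
    (fun i => xi i k : R[i]^o) @ U --> (x k : R[i]^o).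
Proof.
move=> xiK; have h k := ultra_cvgC (fun i => xiK i k).
by exists (fun k => projT1 (cid (h k))) => k; case: (cid _).
Qed.

End Ultralimits.

Lemma ultra_infty : exists U : set_system nat,
  UltraFilter U /\ forall m, \forall i \near U, (m <= i)%N.
Proof.
have [U [UU sub]] := @ultraFilterLemma nat \oo _.
by exists U; split => // m; apply: sub; exact: nbhs_infty_ge.
Qed.

Section ToeplitzMatrices.
Context (R : realType).
Implicit Types (x y : nat -> R[i]) (t : int -> R[i]).

Definition tmx t n : 'M[R[i]]_n := \matrix_(j < n, k < n) t (j%:Z - k%:Z).

Definition cfun n (v : 'cV[R[i]]_n) : nat -> R[i] :=
  fun k => oapp (fun i => v i 0) 0 (insub k).

Lemma cfunE n (v : 'cV[R[i]]_n) (i : 'I_n) : cfun v i = v i 0.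
Proof. by rewrite /cfun valK. Qed.

Lemma tmx_mulE t n (v : 'cV[R[i]]_n) (j : 'I_n) :
  (tmx t n *m v) j 0 = tsec t n (cfun v) j.
Proof.
by rewrite mxE /tsec big_mkord; apply: eq_bigr => k _; rewrite mxE cfunE.
Qed.

Lemma tmx_unit t K n : section_stable t K n -> tmx t n \in unitmx.
Proof.
move=> st; rewrite -unitmx_tr -row_free_unit; apply: inj_row_free => v.
move=> /(congr1 trmx); rewrite trmx_mul trmxK trmx0 => v0.
apply/rowP => i; rewrite mxE -[v]trmxK mxE -cfunE.
apply: (@sqsum_eq0 _ n) => //; apply: le_trans (st _) _.
suff -> : sqsum n (tsec t n (cfun v^T)) = 0 by rewrite mulr0.
rewrite /sqsum big_mkord big1 // => j _; by rewrite -tmx_mulE v0 mxE sqn0.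
Qed.

Lemma tsec_solve t K n y : section_stable t K n ->
  let z := cfun (invmx (tmx t n) *m \col_i y i) in
  (forall j, (j < n)%N -> tsec t n z j = y j) /\ sqsum n z <= K * sqsum n y.
Proof.
move=> st z; have zy j : (j < n)%N -> tsec t n z j = y j.
  move=> jn; rewrite -[j]/(val (Ordinal jn)) -tmx_mulE mulKVmx ?mxE //.
  exact: tmx_unit st.
by split=> //; apply: le_trans (st z) _; rewrite (eq_sqsum (y := y)).
Qed.

End ToeplitzMatrices.

Section ToeplitzOperator.
Context (R : realType) (t : int -> R[i]) (M : R) (tM : section_bounded t M).
Implicit Types (x y : nat -> R[i]).

(** For [t = fourier a] this unfolds to [toeplitz_op a], so results on [tfull] apply as they are to
    the operator of the statement. *)
Definition tfull x : nat -> R[i] := fun j => pair (fun k => t (j%:Z - k%:Z)) x.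

Lemma section_bound_ge0 : 0 <= M.
Proof.
have := le_trans (sqsum_ge0 1 _) (tM 1 (fun=> 1)).
by rewrite /sqsum big_nat1 sqn1 mulr1.
Qed.

(** Apply a section containing row [j] to the conjugate of that row: entry [j] of the result is the
    squared norm [S] of the row, so [S^2 <= M S]. *)
Lemma row_sqbdd j : sqbdd (fun k => t (j%:Z - k%:Z)) M.
Proof.
move=> n; apply: le_trans (le_sqsum _ (leq_maxl n j.+1)) _.
set m := maxn _ _; set S := sqsum _ _.
have := tM m (fun k => conjc (t (j%:Z - k%:Z))); set x := fun k => _ => h.
have Sx : sqsum m x = S by apply: eq_bigr => k _; rewrite sqnJ.
have e : tsec t m x j = S%:C.
  rewrite /tsec /S /sqsum (big_morph _ (rmorphD (real_complex R)) (erefl _)).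
  by apply: eq_bigr => k _; rewrite mulcJ.
have := le_trans (sqn_le_sqsum (tsec t m x) (leq_maxr n j.+1 : j < m)%N) h.
rewrite e sqnR Sx expr2 => S2.
have := sqsum_ge0 m (fun k => t (j%:Z - k%:Z)); rewrite -/S => S0.
have [S00|Sp] := eqVneq S 0; first by rewrite S00; exact: section_bound_ge0.
have {}Sp : 0 < S by rewrite lt_def Sp.
by rewrite -(ler_pM2r Sp).
Qed.

Lemma tsec_cvg x L j : sqbdd x L ->
  (fun n => tsec t n x j : R[i]^o) @ \oo --> (tfull x j : R[i]^o).
Proof. by move=> xL; apply: pair_cvg xL; exact: row_sqbdd. Qed.

Lemma tfull_sqbdd x L : sqbdd x L -> sqbdd (tfull x) (M * L).
Proof.
move=> xL m.
have h : (fun n => sqsum m (tsec t n x)) @ \oo --> sqsum m (tfull x).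
  by apply: cvg_sqsum => j; exact: tsec_cvg xL.
apply: (cvg_const_le h); near=> n.
have mn : (m <= n)%N by near: n; exact: nbhs_infty_ge.
apply: le_trans (le_sqsum _ mn) _; apply: le_trans (tM _ _) _.
by apply: ler_wpM2l; [exact: section_bound_ge0|exact: xL].
Unshelve. all: by end_near. Qed.

(** Passing from the section of size [n] to a larger one only adds the entries of [x] from [n] on;
    the bound [M] applies to [x] with its first [n] entries replaced by 0. *)
Lemma tfull_tail x L n : sqbdd x L ->
  sqsum n (fun j => tfull x j - tsec t n x j) <= M * tail x n.
Proof.
move=> xL.
have h : (fun p => sqsum n (fun j => tsec t p x j - tsec t n x j)) @ \oo -->
    sqsum n (fun j => tfull x j - tsec t n x j).
  apply: cvg_sqsum => j; apply: cvgB; [exact: tsec_cvg xL|exact: cvg_cst].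
apply: (cvg_const_le h); near=> p.
have np : (n <= p)%N by near: p; exact: nbhs_infty_ge.
pose x' k := if (k < n)%N then 0 else x k.
have e1 j : tsec t p x j - tsec t n x j = tsec t p x' j.
  rewrite /tsec !(big_cat_nat (leq0n n) np) /= addrAC subrr add0r.
  rewrite (big_nat_eq0 (m := 0) (n := n) (F := fun k => _ * x' k)) ?add0r => [|k _ kn].
    by apply: eq_big_nat => k /andP[nk _]; rewrite /x' ltnNge nk.
  by rewrite /x' kn mulr0.
rewrite (eq_sqsum (fun j _ => e1 j)).
apply: le_trans (le_sqsum _ np) _; apply: le_trans (tM _ _) _.
apply: ler_wpM2l; first exact: section_bound_ge0.
apply: le_trans (tail_ge xL np); rewrite /sqsum (big_cat_nat (leq0n n) np) /=.
rewrite (big_nat_eq0 (m := 0) (n := n)) ?add0r => [|k _ kn]; last first.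
  by rewrite /x' kn sqn0.
apply: eq_ler.
by apply: eq_big_nat => k /andP[nk _]; rewrite /x' ltnNge nk.
Unshelve. all: by end_near. Qed.

(** Stability and consistency give convergence: the section maps [z - x] to the truncation error of
    [x], which is controlled by its tail. *)
Lemma section_approx K n x z L : 0 <= K -> section_stable t K n -> sqbdd x L ->
  (forall j, (j < n)%N -> tsec t n z j = tfull x j) ->
  sqsum n (fun k => z k - x k) <= K * (M * tail x n).
Proof.
move=> K0 st xL zx; apply: le_trans (st _) _; apply: ler_wpM2l => //.
apply: le_trans (tfull_tail n xL); apply: eq_ler.
by apply: eq_sqsum => j jn; rewrite tsecD tsecN zx.
Qed.

Section Stable.
Context (K : R) (N : nat).
Context (K0 : 0 <= K) (tK : forall n, (N <= n)%N -> section_stable t K n).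

(** The zero vector solves every section with right-hand side [tfull x = 0], so [section_approx]
    bounds the head of [x] by its tail. *)
Lemma tfull_inj x L : sqbdd x L -> (forall j, tfull x j = 0) -> forall k, x k = 0.
Proof.
move=> xL x0 k.
have h : (fun n => K * (M * tail x n)) @ \oo --> (0 : R).
  rewrite -(mulr0 K) -(mulr0 M); apply: cvgMl_tmp; apply: cvgMl_tmp.
  exact: tail_cvg0 xL.
suff : sqn (x k) <= 0 by rewrite le_eqVlt ltNge sqn_ge0 orbF sqn_eq0 => /eqP.
have h2 : (fun n => sqn (x k) - K * (M * tail x n)) @ \oo --> sqn (x k) - 0.
  by apply: cvgB => //; exact: cvg_cst.
rewrite subr0 in h2; apply: (cvg_const_le h2); near=> n.
rewrite subr_le0.
have Nn : (N <= n)%N by near: n; exact: nbhs_infty_ge.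
have kn : (k < n)%N by near: n; exact: nbhs_infty_ge.
have := @section_approx K n x (fun=> 0) L K0 (tK Nn) xL.
have -> : sqsum n (fun k => 0 - x k) = sqsum n x.
  by rewrite -[RHS]sqsumN; apply: eq_sqsum => *; rewrite sub0r.
move=> /(_ _)/(le_trans (sqn_le_sqsum _ kn)); apply=> j _.
by rewrite x0 /tsec big1 // => *; rewrite mulr0.
Unshelve. all: by end_near. Qed.

(* The solution is the weak limit, along an ultrafilter, of the solutions of
   the finite sections. *)
Lemma tfull_surj y L : sqbdd y L ->
  exists x, sqbdd x (K * L) /\ forall j, tfull x j = y j.
Proof.
move=> yL; have [U [UU Uoo]] := ultra_infty.
(* Starting at size [N] makes every member of the family stable; [weak_lim] asks for a bound valid
   at all indices. *)
pose z n := cfun (invmx (tmx t (N + n)) *m \col_i y i).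
have zK n : sqsum (N + n) (z n) <= K * L.
  have [_ h] := tsec_solve y (tK (leq_addr n N)); apply: le_trans h _.
  by apply: ler_wpM2l => //; exact: yL.
have [x zx] : exists x : nat -> R[i], forall k,
    (fun i => z i k : R[i]^o) @ U --> (x k : R[i]^o).
  apply: (ultra_cvg_seq UU (K := K * L)) => i k.
  have [ki|ki] := ltnP k (N + i); first exact: le_trans (sqn_le_sqsum _ ki) (zK i).
  rewrite /z /cfun insubN -?leqNgt //= sqn0.
  by apply: mulr_ge0 => //; apply: le_trans (yL 0%N); exact: sqsum_ge0.
have NU m : \forall i \near U, (m <= N + i)%N.
  by apply: filterS (Uoo m) => i mi; rewrite (leq_trans mi) ?leq_addl.
exists x; split; first exact: sqbdd_lim NU zK zx.
move=> j.
have h1 : (fun i => \sum_(0 <= k < N + i) t (j%:Z - k%:Z) * z i k : R[i]^o) @ U -->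
    (tfull x j : R[i]^o) by exact: weak_lim NU zK zx (row_sqbdd j).
have h2 : (fun i => \sum_(0 <= k < N + i) t (j%:Z - k%:Z) * z i k : R[i]^o) @ U -->
    (y j : R[i]^o).
  apply: cvg_near_cst; near=> i; apply: (tsec_solve y (tK (leq_addr i N))).1.
  by near: i; exact: NU.
exact: cvgC_uniq h1 h2.
Unshelve. all: by end_near. Qed.

End Stable.

End ToeplitzOperator.

(** * Stability for a symbol with an analytic polynomial factor *)

Section Factorization.
Context (R : realType) (a s q : int -> R[i]) (d : nat).
Context (q_neg : forall k, q (Negz k) = 0) (q_ge : forall k : nat, (d <= k)%N -> q k = 0).
Context (a_qs : forall m : int, a m = \sum_(0 <= l < d) q l * s (m - l%:Z)).
Implicit Types (x y : nat -> R[i]).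

Lemma q_lt0 (m : int) : m < 0 -> q m = 0.
Proof. by case: m. Qed.

Lemma sum_q_shift (F : nat -> R[i]) (k p : nat) : (k + d <= p)%N ->
  \sum_(0 <= m < p) q (m%:Z - k%:Z) * F m = \sum_(0 <= l < d) q l * F (k + l)%N.
Proof.
move=> kp; have k_p : (k <= p)%N by lia.
rewrite (big_cat_nat (leq0n k) k_p) /= big_nat_eq0 ?add0r => [|m _ mk]; last first.
  by rewrite q_lt0 ?mul0r //; lia.
rewrite -[X in \sum_(X <= _ < _) _]add0n big_addn.
have dp : (d <= p - k)%N by lia.
rewrite (big_cat_nat (leq0n d) dp) /= [X in _ + X]big_nat_eq0 ?addr0 => [|m dm _].
  by apply: eq_bigr => l _; rewrite [(l + k)%N]addnC; congr (q _ * _); lia.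
by have -> : (m + k)%N%:Z - k%:Z = m%:Z :> int; [lia|rewrite q_ge ?mul0r].
Qed.

Lemma sum_q_rev (F : int -> R[i]) (j p : nat) : (d <= j)%N -> (j < p)%N ->
  \sum_(0 <= m < p) q (j%:Z - m%:Z) * F m = \sum_(0 <= l < d) q l * F (j%:Z - l%:Z).
Proof.
move=> dj jp.
rewrite (big_cat_nat (leq0n j.+1) jp) /= [X in _ + X]big_nat_eq0 ?addr0 => [|m jm _]; last first.
  by rewrite q_lt0 ?mul0r //; lia.
rewrite big_nat_rev /= add0n.
have dj1 : (d <= j.+1)%N by lia.
rewrite (big_cat_nat (leq0n d) dj1) /= [X in _ + X]big_nat_eq0 ?addr0 => [|m dm mj].
  apply: eq_big_nat => l /andP[_ ld].
  have -> : (j.+1 - l.+1)%N%:Z = j%:Z - l%:Z by lia.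
  by congr (q _ * _); lia.
have -> : j%:Z - (j.+1 - m.+1)%N%:Z = m%:Z by lia.
by rewrite q_ge ?mul0r.
Qed.

(** Column [k] of [T(q)] lives in the rows [k] to [k + d - 1], so [n + d] intermediate rows lose
    nothing and the factorization [T(a) = T(s) T(q)] is exact. *)
Lemma tsec_factor_right n x j :
  tsec a n x j = tsec s (n + d) (tsec q n x) j.
Proof.
rewrite /tsec; under [RHS]eq_bigr do rewrite mulr_sumr.
rewrite exchange_big /=; apply: eq_big_nat => k /andP[_ kn].
have /(sum_q_shift (fun m => s (j%:Z - m%:Z))) h : (k + d <= n + d)%N by lia.
under eq_bigr do rewrite mulrCA mulrA.
rewrite -mulr_suml [X in _ = X * _](eq_bigr _ (fun m _ => mulrC _ _)).
under [X in _ = X * _]eq_bigr do rewrite mulrC.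
rewrite h a_qs; congr (_ * _); apply: eq_bigr => l _; congr (_ * s _); lia.
Qed.

(** In this order row [j] of [T(q)] looks back [d - 1] places; the product agrees with [T(a)] only
    where these stay inside the section. *)
Lemma tsec_factor_left n x j : (d <= j)%N -> (j < n)%N ->
  tsec q n (tsec s n x) j = tsec a n x j.
Proof.
move=> dj jn; rewrite /tsec; under eq_bigr do rewrite mulr_sumr.
rewrite exchange_big /=; apply: eq_bigr => k _.
under eq_bigr do rewrite mulrA; rewrite -mulr_suml.
rewrite (sum_q_rev (fun m => s (m - k%:Z)) dj jn) a_qs; congr (_ * _).
by apply: eq_bigr => l _; congr (_ * s _); lia.
Qed.

(** [T(q)] is lower triangular, so the size of the section does not affect a row inside it. *)
Lemma tsec_q_head n y j : (j < n)%N -> tsec q n y j = tsec q j.+1 y j.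
Proof.
move=> jn; rewrite /tsec (big_cat_nat (leq0n j.+1) jn) /=.
by rewrite [X in _ + X]big_nat_eq0 ?addr0 // => k jk _; rewrite q_lt0 ?mul0r //; lia.
Qed.

Context (Ma Ms Mq Ks Kq : R).
Context (aM : section_bounded a Ma) (sM : section_bounded s Ms) (qM : section_bounded q Mq).
Context (Ks0 : 0 <= Ks) (Kq0 : 0 <= Kq).
Context (sK : forall n, section_stable s Ks n) (qK : forall n, section_stable q Kq n).

(** With [z = T(q) x] one has [T(s) z = T(a) x = 0]; stability of [s] gives [z = 0], and stability
    of [q] gives [x = 0]. *)
Lemma factor_inj x L : sqbdd x L -> (forall j, tfull a x j = 0) -> forall k, x k = 0.
Proof.
move=> xL x0.
have L0 : 0 <= L by apply: le_trans (xL 0%N); exact: sqsum_ge0.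
pose z k := tsec q k.+1 x k.
have zE n k : (k < n)%N -> tsec q n x k = z k by exact: tsec_q_head.
have zL : sqbdd z (Mq * L).
  move=> n; rewrite -(eq_sqsum (zE n)); apply: le_trans (qM _ _) _.
  by apply: ler_wpM2l; [exact: section_bound_ge0 qM|exact: xL].
have z0 : forall k, z k = 0.
  apply: (tfull_inj sM (N := 0) Ks0 (fun n _ => sK n) zL) => j.
  (* In the rows [n] to [n + d - 1] the vector [tsec q n x] may differ from [z]; boundedness and
     coordinatewise convergence are enough for [weak_lim]. *)
  have h1 : (fun n => \sum_(0 <= k < n + d) s (j%:Z - k%:Z) * tsec q n x k : R[i]^o) @ \oo -->
      (tfull s z j : R[i]^o).
    apply: (weak_lim (K := Mq * L)) (row_sqbdd sM j) => [m|n|k].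
    - by near=> n; apply: (@leq_trans n); rewrite ?leq_addr //; near: n; exact: nbhs_infty_ge.
    - pose x' k := if (k < n)%N then x k else 0.
      have e k : tsec q n x k = tsec q (n + d) x' k.
        rewrite /tsec (big_cat_nat (leq0n n) (leq_addr d n)) /=.
        rewrite [X in _ = _ + X]big_nat_eq0 ?addr0 => [|i ni _]; last first.
          by rewrite /x' ltnNge ni mulr0.
        by apply: eq_big_nat => i /andP[_ ni]; rewrite /x' ni.
      rewrite (eq_sqsum (fun k _ => e k)); apply: le_trans (qM _ _) _.
      apply: ler_wpM2l; first exact: section_bound_ge0 qM.
      apply: le_trans (xL n).
      rewrite /sqsum (big_cat_nat (leq0n n) (leq_addr d n)) /=.
      rewrite [X in _ + X]big_nat_eq0 ?addr0 => [|i ni _]; last first.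
        by rewrite /x' ltnNge ni sqn0.
      by apply: eq_ler; apply: eq_big_nat => i /andP[_ ni]; rewrite /x' ni.
    - apply: cvg_near_cst; near=> n; apply: zE.
      by near: n; exact: nbhs_infty_ge.
  have h2 : (fun n => tsec a n x j : R[i]^o) @ \oo --> (0 : R[i]^o).
    by rewrite -(x0 j); exact: tsec_cvg xL.
  move: h2; under eq_fun do rewrite tsec_factor_right.
  by move=> h2; exact: cvgC_uniq h1 h2.
move=> k; apply: (@sqsum_eq0 _ k.+1) => //; apply: le_trans (qK _ _) _.
rewrite (eq_sqsum (y := fun=> 0)) => [|i ik]; last by rewrite zE.
by rewrite /sqsum big1 ?mulr0 // => *; exact: sqn0.
Unshelve. all: by end_near. Qed.

(* Compactness: on a sequence of almost-kernel vectors the weak limit is killed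
   by the infinite matrix, hence 0; [tsec a] and [tsec q \o tsec s] differ in d
   rows only, so the vectors would tend to 0 strongly. *)
Theorem factor_stable : exists K N, 0 <= K /\
  forall n, (N <= n)%N -> section_stable a K n.
Proof.
apply: contrapT => nst.
(* Failure of the claim for [K = N = i], normalized: a unit vector, cut off at the size of its
   section, for which [i] times the squared norm of the image is at most 1. *)
have ex i : exists nx : nat * (nat -> R[i]), [/\ (i <= nx.1)%N,
    sqsum nx.1 nx.2 = 1, (forall k, (nx.1 <= k)%N -> nx.2 k = 0) &
    i%:R * sqsum nx.1 (tsec a nx.1 nx.2) <= 1].
  have [n [x [ni hx]]] : exists n x, (i <= n)%N /\
      i%:R * sqsum n (tsec a n x) < sqsum n x.
    apply: contrapT => h; apply: nst; exists i%:R, i; split => // n ni x.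
    by rewrite leNgt; apply/negP => hx; apply: h; exists n, x.
  have S0 : 0 < sqsum n x by apply: le_lt_trans hx; rewrite mulr_ge0 // sqsum_ge0.
  pose c : R[i] := ((Num.sqrt (sqsum n x))^-1)%:C.
  have cS : sqn c * sqsum n x = 1.
    by rewrite sqnR exprVn sqr_sqrtr ?mulVf ?lt0r_neq0 // ltW.
  pose x' k := if (k < n)%N then c * x k else 0.
  have x'E k : (k < n)%N -> x' k = c * x k by rewrite /x' => ->.
  exists (n, x'); split => //=.
  - by rewrite (eq_sqsum x'E) sqsumZ.
  - by move=> k nk; rewrite /x' ltnNge nk.
  - have e j : tsec a n x' j = c * tsec a n x j by rewrite (eq_tsec _ _ x'E) tsecZ.
    rewrite (eq_sqsum (fun j _ => e j)) sqsumZ mulrCA.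
    by rewrite -[leRHS]cS ler_wpM2l ?sqn_ge0 ?(ltW hx).
have [nx hnx] : exists nx : nat -> nat * (nat -> R[i]), forall i, [/\ (i <= (nx i).1)%N,
    sqsum (nx i).1 (nx i).2 = 1, (forall k, ((nx i).1 <= k)%N -> (nx i).2 k = 0) &
    i%:R * sqsum (nx i).1 (tsec a (nx i).1 (nx i).2) <= 1].
  by exists (fun i => projT1 (cid (ex i))) => i; case: (cid (ex i)).
have [U [UU Uoo]] := ultra_infty.
pose N i := (nx i).1; pose xi i := (nx i).2.
have NU m : \forall i \near U, (m <= N i)%N.
  by apply: filterS (Uoo m) => i mi; apply: leq_trans mi _; case: (hnx i).
have xi1 i : sqsum (N i) (xi i) <= 1 by have [_ -> ] := hnx i.
have [x xix] : exists x : nat -> R[i], forall k,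
    (fun i => xi i k : R[i]^o) @ U --> (x k : R[i]^o).
  apply: (ultra_cvg_seq UU (K := 1)) => i k.
  have [ki|ki] := ltnP k (N i); first exact: le_trans (sqn_le_sqsum _ ki) (xi1 i).
  by have [_ _ h _] := hnx i; rewrite /xi h // sqn0.
have x1 : sqbdd x 1 by exact: sqbdd_lim NU xi1 xix.
have eta0 : (fun i => sqsum (N i) (tsec a (N i) (xi i))) @ U --> (0 : R).
  apply/cvgrPdist_lt => e e0; near=> i.
  have [_ _ _ hi] := hnx i.
  have ie : e^-1 < i%:R.
    apply: lt_le_trans (truncnS_gt _) _; rewrite ler_nat.
    by near: i; exact: Uoo.
  rewrite sub0r normrN ger0_norm ?sqsum_ge0 //.
  have i0 : 0 < i%:R :> R by apply: lt_trans ie; rewrite invr_gt0.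
  rewrite -(ltr_pM2l i0); apply: le_lt_trans hi _.
  by rewrite -ltr_pdivrMr // div1r.
have ax0 j : tfull a x j = 0.
  have h1 : (fun i => tsec a (N i) (xi i) j : R[i]^o) @ U --> (tfull a x j : R[i]^o).
    exact: weak_lim NU xi1 xix (row_sqbdd aM j).
  have h2 : (fun i => tsec a (N i) (xi i) j : R[i]^o) @ U --> (0 : R[i]^o).
    apply/cvgC_sqn; apply: (squeeze_cvgr _ (cvg_cst (0 : R)) eta0).
    near=> i; rewrite subr0 sqn_ge0 /=; apply: sqn_le_sqsum.
    by near: i; exact: NU.
  exact: cvgC_uniq h1 h2.
have x0 := factor_inj x1 ax0.
have sx0 j : tfull s x j = 0.
  rewrite /tfull; apply: pair_lim; apply: cvg_near_cst; near=> n.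
  by rewrite big1 // => k _; rewrite x0 mulr0.
pose v i := tsec s (N i) (xi i).
have v0 j : (fun i => v i j : R[i]^o) @ U --> (0 : R[i]^o).
  by rewrite -(sx0 j); exact: weak_lim NU xi1 xix (row_sqbdd sM j).
(* By triangularity the first [d] rows of [T(q) v] involve only the first [d] entries of [v], each
   of which tends to 0. *)
have w0 : (fun i => sqsum d (fun j => tsec q j.+1 (v i) j)) @ U --> (0 : R).
  have -> : (0 : R) = sqsum d (fun j => \sum_(0 <= k < j.+1) q (j%:Z - k%:Z) * 0).
    by rewrite /sqsum big1 // => j _; rewrite big1 ?sqn0 // => k _; rewrite mulr0.
  apply: cvg_sqsum => j; apply: cvgC_sum => k.
  by apply: (@cvgMl_tmp R[i]^o).
(* Stability of [s] and then of [q] bounds the squared norm 1 of [xi i] by this quantity: its first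
   summand collects the rows below [d], its second dominates the others, which are rows of
   [T(a) xi]. *)
have tot : (fun i => Ks * (Kq * (sqsum d (fun j => tsec q j.+1 (v i) j) +
    sqsum (N i) (tsec a (N i) (xi i))))) @ U --> (0 : R).
  rewrite -(mulr0 Ks) -(mulr0 Kq) -[X in Kq * X](addr0 0).
  by apply: cvgMl_tmp; apply: cvgMl_tmp; apply: cvgD.
suff : (1 : R) <= 0 by rewrite ler10.
rewrite -subr_le0 subr0.
have tot' : (fun i => 1 - Ks * (Kq * (sqsum d (fun j => tsec q j.+1 (v i) j) +
    sqsum (N i) (tsec a (N i) (xi i))))) @ U --> (1 - 0 : R).
  by apply: cvgB => //; exact: cvg_cst.
rewrite -[leLHS]subr0; apply: (cvg_const_le tot'); near=> i.
have dN : (d <= N i)%N by near: i; exact: NU.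
rewrite subr_le0; have [_ <- _ _] := hnx i.
apply: le_trans (sK _ _) _; apply: ler_wpM2l => //.
apply: le_trans (qK _ _) _; apply: ler_wpM2l => //.
rewrite /sqsum (big_cat_nat (leq0n d) dN) /= lerD //.
  apply: eq_ler; apply: eq_big_nat => j /andP[_ jd].
  by rewrite tsec_q_head //; exact: leq_trans jd dN.
rewrite [leRHS](big_cat_nat (leq0n d) dN) /=.
rewrite ler_wpDl ?sumr_ge0 // => [j _|]; first exact: sqn_ge0.
apply: eq_ler; apply: eq_big_nat => j /andP[dj jN].
by rewrite tsec_factor_left.
Unshelve. all: by end_near. Qed.

End Factorization.

(** * Fourier coefficients and Toeplitz forms *)

Section Expi.
Context (R : realType).

Lemma expi0 : expi (0 : R) = 1.
Proof. by rewrite /expi cos0 sin0. Qed.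

Lemma expiD (s t : R) : expi (s + t) = expi s * expi t.
Proof. by rewrite /expi cosD sinD; simpc; congr (_ +i* _); rewrite addrC. Qed.

Lemma expiJ (t : R) : conjc (expi t) = expi (- t).
Proof. by rewrite /expi cosN sinN. Qed.

Lemma sqn_expi (t : R) : sqn (expi t) = 1.
Proof. exact: cos2Dsin2. Qed.

Lemma expiMn (t : R) n : expi t ^+ n = expi (n%:R * t).
Proof.
elim: n => [|n IH]; first by rewrite mul0r expi0.
by rewrite exprS IH -expiD -natr1 mulrDl mul1r addrC.
Qed.

Lemma sin_intrpi (k : int) : sin (k%:~R * pi : R) = 0.
Proof.
have h (n : nat) : sin (n%:R * pi : R) = 0.
  have : complex.Im (expi (pi : R) ^+ n) = 0.
    have -> : expi (pi : R) = (-1)%:C by rewrite /expi cospi sinpi.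
    by rewrite -rmorphXn.
  by rewrite expiMn.
case: k => n; first exact: h.
by rewrite NegzE mulrNz mulNr sinN h oppr0.
Qed.

End Expi.

Section ComplexIntegral.
Context (R : realType).
Implicit Types (h g : R -> R[i]).

Let D : set R := `[- pi, pi].
Let mu := @lebesgue_measure R.

(** Bounded and measurable, rather than merely integrable, so that the class is closed under
    products. *)
Definition tame h := [/\ measurable_fun D (fun t => complex.Re (h t)),
  measurable_fun D (fun t => complex.Im (h t)) &
  exists B : R, forall t, D t -> sqn (h t) <= B].

Let mD : measurable (D : set (measurableTypeR R)). Proof. exact: measurable_itv. Qed.

Let bounded_int (f : R -> R) (B : R) : measurable_fun D f ->
  (forall t, D t -> f t ^+ 2 <= B) -> mu.-integrable D (EFin \o f).
Proof.
move=> mf fB; apply: measurable_bounded_integrable => //.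
  rewrite [X in (X < _)%E](lebesgue_measure_itv `[- pi, pi]) /=; case: ifP => _; last exact: ltry.
  by rewrite -EFinD ltry.
exists (Num.sqrt B); split; first exact: num_real.
move=> x Bx t Dt /=; apply: le_trans (ltW Bx).
by rewrite -sqrtr_sqr ler_wsqrtr // fB.
Qed.

Lemma tame_Re h : tame h -> mu.-integrable D (EFin \o (fun t => complex.Re (h t))).
Proof.
case=> m _ [B hB]; apply: (@bounded_int _ B) => // t Dt.
exact: le_trans (sqr_Re_le _) (hB t Dt).
Qed.

Lemma tame_Im h : tame h -> mu.-integrable D (EFin \o (fun t => complex.Im (h t))).
Proof.
case=> _ m [B hB]; apply: (@bounded_int _ B) => // t Dt.
exact: le_trans (sqr_Im_le _) (hB t Dt).
Qed.

Lemma tame_cst (c : R[i]) : tame (fun=> c).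
Proof.
split; [exact: measurable_cst|exact: measurable_cst|].
by exists (sqn c).
Qed.

Lemma tameD h g : tame h -> tame g -> tame (fun t => h t + g t).
Proof.
move=> [m1 n1 [B hB]] [m2 n2 [C gC]]; split.
- by under eq_fun do rewrite ReD; exact: measurable_funD.
- by under eq_fun do rewrite ImD; exact: measurable_funD.
- exists (2 * B + 2 * C) => t Dt; apply: le_trans (sqnD_le _ _) _.
  by rewrite lerD // ler_pM2l //; [exact: hB|exact: gC].
Qed.

Lemma tameM h g : tame h -> tame g -> tame (fun t => h t * g t).
Proof.
move=> [m1 n1 [B hB]] [m2 n2 [C gC]]; split.
- under eq_fun do rewrite ReM.
  by apply: measurable_funB; exact: measurable_funM.
- under eq_fun do rewrite ImM.
  by apply: measurable_funD; exact: measurable_funM.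
- exists (B * C) => t Dt; rewrite sqnM ler_pM ?sqn_ge0 //; [exact: hB|exact: gC].
Qed.

Lemma tameJ h : tame h -> tame (fun t => conjc (h t)).
Proof.
move=> [m1 n1 [B hB]]; split.
- have -> : (fun t => complex.Re (conjc (h t))) = (fun t => complex.Re (h t)) => //.
  by apply/funext => t; case: (h t).
- have -> : (fun t => complex.Im (conjc (h t))) = (fun t => - complex.Im (h t)).
    by apply/funext => t; case: (h t).
  by apply: measurableT_comp.
- by exists B => t Dt; rewrite sqnJ hB.
Qed.

Lemma tame_expi (c : R) : tame (fun t => expi (c * t)).
Proof.
have m : continuous (fun t : R => c * t).
  by move=> t; apply: cvgMl_tmp; exact: cvg_id.
split.
- apply: measurable_funTS; apply: continuous_measurable_fun => t.
  apply: (@continuous_comp _ _ _ (fun t : R => c * t) (@cos R)); first exact: m.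
  exact: continuous_cos.
- apply: measurable_funTS; apply: continuous_measurable_fun => t.
  apply: (@continuous_comp _ _ _ (fun t : R => c * t) (@sin R)); first exact: m.
  exact: continuous_sin.
- by exists 1 => t _; rewrite sqn_expi.
Qed.

Lemma tame_sum (I : Type) (r : seq I) (F : I -> R -> R[i]) :
  (forall i, tame (F i)) -> tame (fun t => \sum_(i <- r) F i t).
Proof.
move=> tF; elim: r => [|i r IH].
  by under eq_fun do rewrite big_nil; exact: tame_cst.
by under eq_fun do rewrite big_cons; exact: tameD.
Qed.

Notation CI := (@cintegral R D).

Lemma eq_cintegral h g : (forall t, h t = g t) -> CI h = CI g.
Proof. by move=> e; rewrite (_ : h = g) //; apply/funext. Qed.

Lemma cintegralD h g : tame h -> tame g -> CI (fun t => h t + g t) = CI h + CI g.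
Proof.
move=> th tg; rewrite /cintegral.
under eq_Rintegral do rewrite ReD.
rewrite RintegralD //; [|exact: tame_Re|exact: tame_Re].
under [X in _ +i* X = _]eq_Rintegral do rewrite ImD.
by rewrite RintegralD //; [exact: tame_Im|exact: tame_Im].
Qed.

Lemma cintegralZ (c : R[i]) h : tame h -> CI (fun t => c * h t) = c * CI h.
Proof.
move=> th; have iR := tame_Re th; have iI := tame_Im th.
have z (r : R) f : mu.-integrable D (EFin \o f) ->
    mu.-integrable D (EFin \o (fun t => r * f t)).
  move=> fi; have := integrableZl mD r fi; exact: eq_integrable.
case: c => a b; rewrite /cintegral.
under eq_Rintegral do rewrite ReM /=.
rewrite RintegralB //; [|exact: z|exact: z].
rewrite !RintegralZl //.
under [X in _ +i* X = _]eq_Rintegral do rewrite ImM /=.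
rewrite RintegralD //; [|exact: z|exact: z].
by rewrite !RintegralZl //; simpc.
Qed.

Lemma cintegral_sum (I : Type) (r : seq I) (F : I -> R -> R[i]) :
  (forall i, tame (F i)) ->
  CI (fun t => \sum_(i <- r) F i t) = \sum_(i <- r) CI (F i).
Proof.
move=> tF; elim: r => [|i r IH].
  rewrite big_nil; under eq_cintegral do rewrite big_nil.
  by rewrite /cintegral /= !Rintegral_cst //= !mul0r.
rewrite big_cons; under eq_cintegral do rewrite big_cons.
by rewrite cintegralD //; [rewrite IH|exact: tame_sum].
Qed.

(** The finite set [E] has measure 0. It will receive the angles at which the value of the symbol
    may be far from its one-sided limits. *)
Lemma le_Re_cintegral (E : seq R) h g : tame h -> tame g ->
  (forall t, D t -> t \notin E -> complex.Re (h t) <= complex.Re (g t)) ->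
  complex.Re (CI h) <= complex.Re (CI g).
Proof.
move=> th tg hg; rewrite /cintegral /= /Rintegral.
have cE : countable [set` E] by apply: finite_set_countable; exact: finite_seq.
have mE : measurable ([set` E] : set (measurableTypeR R)) by exact: countable_measurable.
have mu0 : mu [set` E] = 0%E by exact: countable_lebesgue_measure0.
have iD (f : R -> R[i]) : tame f ->
    mu.-integrable (D `\` [set` E]) (EFin \o (fun t => complex.Re (f t))).
  by move=> tf; apply: (integrableS mD _ _ (tame_Re tf)); [exact: measurableD|move=> x []].
rewrite (negligible_integral mE mD (tame_Re th) mu0).
rewrite (negligible_integral mE mD (tame_Re tg) mu0).
have mDE : measurable (D `\` [set` E] : set (measurableTypeR R)) by exact: measurableD.
apply: (le_Rintegral mDE (iD h th) (iD g tg)) => t [Dt nE].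
by apply: hg => //; apply/negP.
Qed.

Lemma cintegral_expi (k : int) :
  CI (fun t => expi (k%:~R * t)) = if k == 0 then (2 * pi)%:C else 0.
Proof.
have pi0 : - pi < pi :> R by rewrite -subr_gt0 opprK addr_gt0 ?pi_gt0.
case: eqVneq => [->|k0].
  under eq_cintegral do rewrite mul0r expi0.
  rewrite /cintegral /= !Rintegral_cst //.
  rewrite [X in fine X](lebesgue_measure_itv `[- pi, pi]) /= lte_fin pi0 /=.
  by rewrite mul0r; congr (_ +i* _); ring.
have kR : (k%:~R : R) != 0 by rewrite intr_eq0.
have dlin (x : R) : is_derive x (1 : R) (fun t => k%:~R * t) (k%:~R : R).
  have := @is_deriveZ R R R id k%:~R x 1 1 (is_derive_id _ _).
  by rewrite /GRing.scale /= mulr1.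
have FTC (f F : R -> R) : (forall x : R, is_derive x (1 : R) F (f x)) -> continuous f ->
    F pi = F (- pi) -> \int[mu]_(x in D) f x = 0.
  move=> dF cf e; rewrite /Rintegral.
  rewrite (@continuous_FTC2 _ f F) //.
  - by rewrite e subee.
  - exact: continuous_subspaceT.
  - have cF x : {for x, continuous F}.
      by apply: differentiable_continuous; apply/derivable1_diffP; case: (dF x).
    split=> [x _||]; first by case: (dF x).
    + by apply: cvg_at_right_filter; exact: cF.
    + by apply: cvg_at_left_filter; exact: cF.
  - by move=> x _; rewrite derive1E; case: (dF x).
rewrite /cintegral /=; congr (_ +i* _).
- apply: (FTC _ (fun t => (k%:~R)^-1 * sin (k%:~R * t))).
  + move=> x.
    have h := is_derive1_comp (is_derive_sin (k%:~R * x)) (dlin x).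
    have := @is_deriveZ R R R _ (k%:~R)^-1 x 1 _ h.
    rewrite /GRing.scale /=; congr (is_derive _ _ _ _).
    by rewrite mulrCA mulVf // mulr1.
  + move=> x; apply: (@continuous_comp _ _ _ (fun t : R => k%:~R * t) (@cos R)).
      by apply: cvgMl_tmp; exact: cvg_id.
    exact: continuous_cos.
  + by rewrite mulrN sinN sin_intrpi oppr0.
- apply: (FTC _ (fun t => - (k%:~R)^-1 * cos (k%:~R * t))).
  + move=> x.
    have h := is_derive1_comp (is_derive_cos (k%:~R * x)) (dlin x).
    have := @is_deriveZ R R R _ (- (k%:~R)^-1) x 1 _ h.
    rewrite /GRing.scale /=; congr (is_derive _ _ _ _).
    by rewrite mulNr mulNr mulrN opprK mulrCA mulVf // mulr1.
  + move=> x; apply: (@continuous_comp _ _ _ (fun t : R => k%:~R * t) (@sin R)).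
      by apply: cvgMl_tmp; exact: cvg_id.
    exact: continuous_sin.
  + by rewrite mulrN cosN.
Qed.

End ComplexIntegral.

(** * Quadratic forms of finite sections as integrals of the symbol *)

Section ToeplitzForms.
Context (R : realType).
Implicit Types (b : circle R -> R[i]) (x y : nat -> R[i]).

Notation CI := (@cintegral R `[- pi, pi]).

Definition tpoly n x (t : R) : R[i] := \sum_(0 <= k < n) x k * expi (k%:R * t).

Lemma tame_tpoly n x : tame (tpoly n x).
Proof.
by apply: tame_sum => k; apply: tameM; [exact: tame_cst|exact: tame_expi].
Qed.

Lemma toeplitz_form b n x y : tame (fun t => b (cis t)) ->
  \sum_(0 <= j < n) conjc (y j) * tsec (fourier b) n x j =
  ((2 * pi)^-1)%:C * CI (fun t => b (cis t) * (tpoly n x t * conjc (tpoly n y t))).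
Proof.
move=> tb.
have e t : b (cis t) * (tpoly n x t * conjc (tpoly n y t)) =
    \sum_(0 <= j < n) \sum_(0 <= k < n)
      (conjc (y j) * x k) * (b (cis t) * expi (- ((j%:Z - k%:Z)%:~R * t))).
  rewrite /tpoly rmorph_sum mulr_sumr mulr_sumr; apply: eq_bigr => j _.
  rewrite rmorphM mulr_suml mulr_sumr; apply: eq_bigr => k _.
  rewrite [X in _ * (_ * (_ * X))]expiJ.
  have -> : - ((j%:Z - k%:Z)%:~R * t) = k%:R * t + - (j%:R * t) :> R.
    by rewrite intrB; ring.
  by rewrite expiD; ring.
have tF j k : tame (fun t : R =>
    (conjc (y j) * x k) * (b (cis t) * expi (- ((j%:Z - k%:Z)%:~R * t)))).
  apply: tameM; first exact: tame_cst.
  apply: tameM => //; have := tame_expi (- (j%:Z - k%:Z)%:~R : R).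
  by under eq_fun do rewrite mulNr.
rewrite (eq_cintegral e) cintegral_sum => [|j]; last exact: tame_sum.
rewrite mulr_sumr; apply: eq_bigr => j _.
rewrite cintegral_sum // mulr_sumr /tsec mulr_sumr; apply: eq_bigr => k _.
rewrite cintegralZ; last first.
  apply: tameM => //; have := tame_expi (- (j%:Z - k%:Z)%:~R : R).
  by under eq_fun do rewrite mulNr.
by rewrite /fourier; ring.
Qed.

Lemma fourier1 (k : int) : fourier (fun=> 1 : R[i]) k = (k == 0)%:R :> R[i].
Proof.
have e (t : R) : 1 * expi (- (k%:~R * t)) = expi ((- k)%:~R * t).
  by rewrite mul1r mulrNz mulNr.
rewrite /fourier (eq_cintegral e) cintegral_expi oppr_eq0.
case: eqP => _; last by rewrite mulr0.
by rewrite -rmorphM /= mulVf // mulf_neq0 // lt0r_neq0 ?pi_gt0.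
Qed.

Lemma parseval n x :
  ((2 * pi)^-1)%:C * CI (fun t => tpoly n x t * conjc (tpoly n x t)) =
  (sqsum n x)%:C.
Proof.
have := @toeplitz_form (fun=> 1) n x x (tame_cst 1).
under [X in _ = _ * X -> _]eq_cintegral do rewrite mul1r.
move=> <-; rewrite /sqsum (big_morph _ (rmorphD (real_complex R)) (erefl _)).
apply: eq_big_nat => j /andP[_ jn].
rewrite /tsec big_mkord (bigD1 (Ordinal jn)) //= subrr fourier1 mul1r big1 => [|k kj].
  by rewrite addr0 mulrC mulcJ.
rewrite fourier1 subr_eq0 eqz_nat eq_sym -val_eqE /= in kj *.
by rewrite (negbTE kj) mul0r.
Qed.

Let c0 : 0 < (2 * pi)^-1 :> R.
Proof. by rewrite invr_gt0 mulr_gt0 ?pi_gt0. Qed.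

Let ReZ (c : R) (z : R[i]) : complex.Re (c%:C * z) = c * complex.Re z.
Proof. by rewrite ReM /= mul0r subr0. Qed.

Let conjZ (c : R) (z : R[i]) : conjc (c%:C * z) = c%:C * conjc z.
Proof. by case: z => a b; simpc. Qed.

Let tame_abs n x : tame (fun t => tpoly n x t * conjc (tpoly n x t)).
Proof. by apply: tameM; [|apply: tameJ]; exact: tame_tpoly. Qed.

Lemma form_lower b (e : R) (E : seq R) n x : tame (fun t => b (cis t)) ->
  (forall t, t \in `[- pi, pi] -> t \notin E -> e <= complex.Re (b (cis t))) ->
  e * sqsum n x <= complex.Re (\sum_(0 <= j < n) conjc (x j) * tsec (fourier b) n x j).
Proof.
move=> tb be; rewrite toeplitz_form // ReZ.
have <- : complex.Re (sqsum n x)%:C = sqsum n x by [].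
rewrite -parseval ReZ mulrCA; apply: ler_wpM2l; first exact: ltW.
rewrite -ReZ -cintegralZ //.
apply: (@le_Re_cintegral _ E); [|exact: tameM| ].
  by apply: tameM => //; exact: tame_cst.
move=> t Dt tE; rewrite mulcJ ReZ [X in _ <= X]ReM /= mulr0 subr0.
by apply: ler_wpM2r; [exact: sqn_ge0|exact: be].
Qed.

(** Combine [e |x|^2 <= Re <x, T x>] from [form_lower] with
    [2 e Re <x, T x> <= e^2 |x|^2 + |T x|^2]. *)
Lemma coercive_stable b (e : R) (E : seq R) n : 0 < e -> tame (fun t => b (cis t)) ->
  (forall t, t \in `[- pi, pi] -> t \notin E -> e <= complex.Re (b (cis t))) ->
  section_stable (fourier b) (e ^- 2) n.
Proof.
move=> e0 tb be x; have h := form_lower n x tb be.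
rewrite mulrC ler_pdivlMr ?exprn_gt0 //.
have : 2 * (e * complex.Re (\sum_(0 <= j < n) conjc (x j) * tsec (fourier b) n x j)) <=
    e ^+ 2 * sqsum n x + sqsum n (tsec (fourier b) n x).
  rewrite Re_sum /sqsum !mulr_sumr -big_split /=; apply: ler_sum => j _.
  have := ReJM_le (e%:C * x j) (tsec (fourier b) n x j).
  by rewrite sqnM sqnR conjZ -mulrA ReZ.
nra.
Qed.

(** Duality: test [v = T x] against itself and use [2 Re (b p_x conj p_v) <= |b|^2 |p_x|^2 +
    |p_v|^2] under the integral, where [p_x] and [p_v] are the trigonometric polynomials of [x] and
    [v]. *)
Lemma bounded_section b (B : R) : 0 < B -> tame (fun t => b (cis t)) ->
  (forall t, t \in `[- pi, pi] -> sqn (b (cis t)) <= B) ->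
  section_bounded (fourier b) B.
Proof.
move=> B0 tb bB n x; set v := tsec _ _ _.
have e : sqsum n v = complex.Re (\sum_(0 <= j < n) conjc (v j) * v j).
  by rewrite Re_sum; apply: eq_bigr => j _; rewrite mulrC mulcJ.
suff : 2 * sqsum n v <= B * sqsum n x + sqsum n v by lra.
rewrite {1}e toeplitz_form // ReZ.
have pR (z : nat -> R[i]) : sqsum n z = complex.Re (sqsum n z)%:C by [].
rewrite (pR x) (pR v) -!parseval !ReZ.
rewrite [X in X <= _]mulrCA [X in _ <= X + _]mulrCA -mulrDr.
apply: ler_wpM2l; first exact: ltW.
rewrite -[X in _ <= X + _]ReZ -cintegralZ // -ReD -cintegralD //; last first.
  by apply: tameM => //; exact: tame_cst.
have two : 2 = (2%:C : R[i]) by rewrite rmorph_nat.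
rewrite -ReZ -cintegralZ; last first.
  by apply: tameM => //; apply: tameM; [|apply: tameJ]; exact: tame_tpoly.
apply: (@le_Re_cintegral _ [::]).
- apply: tameM; first exact: tame_cst.
  by apply: tameM => //; apply: tameM; [|apply: tameJ]; exact: tame_tpoly.
- by apply: tameD => //; apply: tameM => //; exact: tame_cst.
move=> t Dt _; rewrite !mulcJ ReZ ReD ReZ /=.
have := ReJM_le (tpoly n v t) (b (cis t) * tpoly n x t).
rewrite sqnM mulrC [conjc _ * _]mulrC mulrA => h.
rewrite mulrC; apply: le_trans h _; rewrite addrC lerD2r.
by apply: ler_wpM2r; [exact: sqn_ge0|exact: bB].
Qed.

(** Multiplication by an analytic polynomial is a finite convolution of coefficients, which is the
    form of the hypothesis [a_qs] in the factorization. *)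
Lemma fourier_polyM b (p : {poly R[i]}) (m : int) : tame (fun t => b (cis t)) ->
  fourier (fun z => p.[sval z] * b z) m =
  \sum_(0 <= l < size p) p`_l * fourier b (m - l%:Z).
Proof.
move=> tb; rewrite /fourier.
have e t : p.[sval (cis t)] * b (cis t) * expi (- (m%:~R * t)) =
    \sum_(0 <= l < size p) p`_l * (b (cis t) * expi (- ((m - l%:Z)%:~R * t))).
  rewrite horner_coef !mulr_suml big_mkord; apply: eq_bigr => l _.
  have -> : - ((m - l%:Z)%:~R * t) = l%:R * t + - (m%:~R * t) :> R.
    by rewrite intrB; ring.
  by rewrite expiD [sval _]/= expiMn; ring.
have tF l : tame (fun t : R => b (cis t) * expi (- ((m - l%:Z)%:~R * t))).
  apply: tameM => //; have := tame_expi (- (m - l%:Z)%:~R : R).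
  by under eq_fun do rewrite mulNr.
rewrite (eq_cintegral e) cintegral_sum => [|l]; last first.
  by apply: tameM => //; exact: tame_cst.
rewrite mulr_sumr; apply: eq_bigr => l _; rewrite cintegralZ //; ring.
Qed.

Lemma tame_poly (p : {poly R[i]}) : tame (fun t : R => p.[expi t]).
Proof.
have e (t : R) : p.[expi t] = tpoly (size p) (fun k => p`_k) t.
  by rewrite horner_coef /tpoly big_mkord; apply: eq_bigr => k _; rewrite expiMn.
by under eq_fun do rewrite e; exact: tame_tpoly.
Qed.

Lemma fourier_poly (p : {poly R[i]}) (m : int) :
  fourier (fun z => p.[sval z]) m = if m is Posz k then p`_k else 0.
Proof.
have e z : p.[sval z] = p.[sval z] * (fun=> 1) z :> R[i] by rewrite mulr1.
have -> : fourier (fun z : circle R => p.[sval z]) m =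
    fourier (fun z => p.[sval z] * (fun=> 1 : R[i]) z) m.
  by rewrite /fourier; congr (_ * _); apply: eq_cintegral => t; rewrite -e.
rewrite fourier_polyM; last exact: tame_cst.
under eq_bigr do rewrite fourier1 subr_eq0.
case: m => k; last by rewrite big1 // => l _; rewrite mulr0.
have [kp|kp] := ltnP k (size p).
  rewrite big_mkord (bigD1 (Ordinal kp)) //= eqxx mulr1 big1 ?addr0 // => l lk.
  by rewrite eqz_nat eq_sym -val_eqE /= in lk *; rewrite (negbTE lk) mulr0.
rewrite [RHS]nth_default // big_nat big1 // => l /andP[_ lp].
by rewrite eqz_nat gtn_eqF ?mulr0 // (leq_trans lp).
Qed.

End ToeplitzForms.

(** * Piecewise continuous symbols *)

Section Regulated.
Context (R : realType).

(** If [Q] failed on the segment, the sets [A] for which [Q] holds of the segment minus [A] would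
    form a proper filter; a neighbourhood of one of its cluster points contradicts the local
    hypothesis. *)
Lemma compact_local (Q : set R -> Prop) (a b : R) :
  Q set0 -> (forall A B, A `<=` B -> Q B -> Q A) ->
  (forall A B, Q A -> Q B -> Q (A `|` B)) ->
  (forall t : R, exists2 U, nbhs t U & Q U) -> Q `[a, b]%classic.
Proof.
move=> Q0 QS QU Qloc; apply: contrapT => nQ.
pose F : set_system R := [set A | Q (`[a, b]%classic `\` A)].
have FF : ProperFilter F.
  split; first by rewrite /F /= setD0.
  split.
  - by rewrite /F /= setDT.
  - by move=> A B FA FB; rewrite /F /= setDIr; exact: QU.
  - by move=> A B AB; apply: QS; exact: setDS.
have Fab : F `[a, b]%classic by rewrite /F /= setDv.
have [p [_ clp]] := @segment_compact R a b F FF Fab.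
have [U pU QU'] := Qloc p.
have FnU : F (~` U) by rewrite /F /= setDE setCK; apply: QS QU'; exact: subIsetr.
by have [x []] := clp _ _ FnU pU.
Qed.

Context (a : circle R -> R[i]) (a_pc : piecewise_continuous a).

Lemma llimitP t : (onangle a s @[s --> t^'-]) --> (llimit a t : R[i]^o).
Proof. exact: (a_pc t).1. Qed.

Lemma rlimitP t : (onangle a s @[s --> t^'+]) --> (rlimit a t : R[i]^o).
Proof. exact: (a_pc t).2. Qed.

Lemma onesided_near (e : R) t : 0 < e -> \forall s \near t,
  (s < t -> sqn (a (cis s) - llimit a t) < e) /\
  (t < s -> sqn (a (cis s) - rlimit a t) < e).
Proof.
move=> e0; apply: filterI.
  have /cvgC_sqn /cvgrPdist_lt /(_ _ e0) := (@llimitP t).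
  rewrite near_withinE; apply: filterS => s h st.
  by move: (h st); rewrite sub0r normrN ger0_norm ?sqn_ge0.
have /cvgC_sqn /cvgrPdist_lt /(_ _ e0) := (@rlimitP t).
rewrite near_withinE; apply: filterS => s h st.
by move: (h st); rewrite sub0r normrN ger0_norm ?sqn_ge0.
Qed.

Lemma sqn_dist_cvg_le {F : set_system R} {FF : ProperFilter F} (z l : R[i]) (e : R) :
  ((onangle a s @[s --> F]) --> (l : R[i]^o)) ->
  (\forall s \near F, sqn (a (cis s) - z) <= e) -> sqn (l - z) <= e.
Proof.
move=> al; apply: cvg_const_le; apply: cvg_sqn.
by apply: cvgB; [exact: al|exact: cvg_cst].
Qed.

(** Near [t], but on one side of it, all values are close to a single one-sided limit at [t], hence
    close to each other and to their own one-sided limits. Only [t] itself can be bad, and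
    compactness leaves finitely many such angles. *)
Lemma pc_good (e : R) : 0 < e -> exists E : seq R, forall t, t \in `[- pi, pi] ->
  t \notin E ->
  sqn (a (cis t) - llimit a t) <= e /\ sqn (a (cis t) - rlimit a t) <= e.
Proof.
move=> e0.
pose good t := sqn (a (cis t) - llimit a t) <= e /\ sqn (a (cis t) - rlimit a t) <= e.
have [E hE] : exists E : seq R, `[- pi, pi] `&` [set t | ~ good t] `<=` [set` E].
  apply: (@compact_local (fun A => exists E : seq R, A `&` [set t | ~ good t] `<=` [set` E])).
  - by exists [::]; rewrite set0I.
  - by move=> A B AB [E hE]; exists E => t [/AB Bt nt]; apply: hE.
  - move=> A B [E hE] [E' hE']; exists (E ++ E') => t [[At|Bt] nt] /=.
      by rewrite mem_cat (hE t).
    by rewrite mem_cat (hE' t) ?orbT.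
  move=> t; have e4 : 0 < e / 4 by rewrite divr_gt0.
  (* The nested neighbourhood allows the one-sided limits at [s], and not only the value there, to
     be compared with those at [t]. *)
  exists [set s | \forall s' \near s,
    (s' < t -> sqn (a (cis s') - llimit a t) < e / 4) /\
    (t < s' -> sqn (a (cis s') - rlimit a t) < e / 4)].
    by apply: nbhs_interior; exact: onesided_near.
  exists [:: t] => s [hs ns] /=; rewrite inE; apply/eqP; apply: contrapT => st.
  apply: ns.
  have key z : (\forall s' \near s, sqn (a (cis s') - z) <= e / 4) -> good s.
    move=> hz.
    have h0 : sqn (a (cis s) - z) <= e / 4 by exact: nbhs_singleton hz.
    have hl : sqn (llimit a s - z) <= e / 4.
      by apply: (sqn_dist_cvg_le (@llimitP s)); exact: cvg_at_left_filter hz.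
    have hr : sqn (rlimit a s - z) <= e / 4.
      by apply: (sqn_dist_cvg_le (@rlimitP s)); exact: cvg_at_right_filter hz.
    have tri u : sqn (u - z) <= e / 4 -> sqn (a (cis s) - u) <= e.
      move=> hu; have -> : a (cis s) - u = (a (cis s) - z) - (u - z) by ring.
      by apply: le_trans (sqnD_le _ _) _; rewrite sqnN; lra.
    by split; apply: tri.
  have [st'|ts|//] := ltgtP s t.
    apply: (key (llimit a t)); near=> s'.
    have [h _] : (s' < t -> sqn (a (cis s') - llimit a t) < e / 4) /\
      (t < s' -> sqn (a (cis s') - rlimit a t) < e / 4) by near: s'; exact: hs.
    by apply: ltW; apply: h; near: s'; exact: lt_nbhsl.
  apply: (key (rlimit a t)); near=> s'.
  have [_ h] : (s' < t -> sqn (a (cis s') - llimit a t) < e / 4) /\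
    (t < s' -> sqn (a (cis s') - rlimit a t) < e / 4) by near: s'; exact: hs.
  by apply: ltW; apply: h; near: s'; exact: lt_nbhsr.
exists E => t tpi tE; apply: contrapT => ng.
by move/negP: tE; apply; apply: (hE t).
Unshelve. all: by end_near. Qed.

Lemma pc_bounded : exists B : R, forall t, t \in `[- pi, pi] -> sqn (a (cis t)) <= B.
Proof.
have [B hB] : exists B : R, forall t, `[- pi, pi]%classic t -> sqn (a (cis t)) <= B.
  apply: (@compact_local (fun A => exists B : R, forall t, A t -> sqn (a (cis t)) <= B)).
  - by exists 0.
  - by move=> A A' AA' [B hB]; exists B => t /AA'; exact: hB.
  - move=> A A' [B hB] [B' hB']; exists (Num.max B B') => t [/hB|/hB'] h.
      by rewrite le_max h.
    by rewrite le_max h orbT.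
  move=> t; exists [set s | (s < t -> sqn (a (cis s) - llimit a t) < 1) /\
    (t < s -> sqn (a (cis s) - rlimit a t) < 1)]; first exact: onesided_near.
  exists (2 + 2 * sqn (llimit a t) + 2 * sqn (rlimit a t) + sqn (a (cis t))) => s [hl hr].
  have := sqn_ge0 (llimit a t); have := sqn_ge0 (rlimit a t).
  have := sqn_ge0 (a (cis t)).
  have [st|ts|->] := ltgtP s t; last lra.
  - have := hl st; have := sqnD_le (a (cis s) - llimit a t) (llimit a t).
    rewrite subrK; lra.
  - have := hr ts; have := sqnD_le (a (cis s) - rlimit a t) (rlimit a t).
    rewrite subrK; lra.
by exists B => t tpi; exact: hB.
Qed.

(** The function is a uniform limit of measurable ones, glued by [compact_local] from functions that
    are constant on either side of a point and keep the value of [f] at the point. *)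
Lemma regulated_measurable (f : R -> R) (u v : R) :
  (forall (e : R) t, 0 < e -> exists l r : R, \forall s \near t,
    (s < t -> `|f s - l| <= e) /\ (t < s -> `|f s - r| <= e)) ->
  measurable_fun `[u, v] f.
Proof.
move=> hf.
have step (e : R) : 0 < e -> exists g : R -> R,
    measurable_fun setT g /\ forall t, `[u, v]%classic t -> `|f t - g t| <= e.
  move=> e0.
  have [g [B [mg mB sB hB]]] : exists (g : R -> R) (B : set R),
    [/\ measurable_fun setT g, measurable B, `[u, v] `<=` B &
      forall t, B t -> `|f t - g t| <= e].
    apply: (@compact_local (fun A => exists (g : R -> R) (B : set R),
      [/\ measurable_fun setT g, measurable B, A `<=` B &
      forall t, B t -> `|f t - g t| <= e])).
    - exists (fun=> 0), set0; split=> //; exact: measurable_cst.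
    - by move=> A A' AA' [g [B [? ? sB ?]]]; exists g, B; split=> // t /AA' /sB.
    - move=> A A' [g [B [mg mB sB hB]]] [g' [B' [mg' mB' sB' hB']]].
      exists (fun t => if t \in B then g t else g' t), (B `|` B'); split.
      + apply: measurable_fun_ifT => //.
        by apply: (measurable_fun_bool true); rewrite setTI preimage_mem_true.
      + exact: measurableU.
      + exact: setUSS.
      + move=> t BB; case: ifPn => [/set_mem|/negP tB]; first exact: hB.
        by apply: hB'; case: BB => // /mem_set.
    move=> t; have [l [r]] := hf e t e0.
    move=> /nbhs_ballP [d /= d0 hd].
    exists (ball t d); first exact: nbhsx_ballx.
    exists (fun s => if s < t then l else if t < s then r else f t), (ball t d).
    split => //.
    + apply: measurable_fun_ifT => //; first by apply: measurable_fun_ltr.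
      by apply: measurable_fun_ifT => //; apply: measurable_fun_ltr.
    + exact: measurable_ball.
    + move=> s /hd [hl hr]; have [st|ts|->] := ltgtP s t; [exact: hl|exact: hr|].
      by rewrite subrr normr0 ltW.
  by exists g; split => // t /sB; exact: hB.
have [G hG] : exists G : nat -> R -> R, forall n,
    measurable_fun setT (G n) /\ forall t, `[u, v]%classic t -> `|f t - G n t| <= n.+1%:R^-1.
  have h n := step n.+1%:R^-1 ltac:(by rewrite invr_gt0 ltr0Sn).
  by exists (fun n => projT1 (cid (h n))) => n; case: (cid (h n)).
apply: (@measurable_fun_cvg _ _ _ _ G) => [n|t tuv].
- by apply: measurable_funTS; case: (hG n).
- apply/cvgrPdist_le => e e0; near=> n.
  apply: le_trans ((hG n).2 t tuv) _.
  by apply: ltW; near: n; exact: near_infty_natSinv_lt (PosNum e0).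
Unshelve. all: by end_near. Qed.

Lemma pc_tame : tame (fun t => a (cis t)).
Proof.
split.
- apply: regulated_measurable => e t e0.
  exists (complex.Re (llimit a t)), (complex.Re (rlimit a t)).
  have : \forall s \near t, (s < t -> sqn (a (cis s) - llimit a t) < e ^+ 2) /\
     (t < s -> sqn (a (cis s) - rlimit a t) < e ^+ 2).
    by apply: onesided_near; rewrite exprn_gt0.
  apply: filterS => s [hl hr].
  by split=> [/hl|/hr] h; rewrite -ReN -ReD -(@ler_pXn2r _ 2) ?nnegrE ?(ltW e0) //
    -normrX ger0_norm ?sqr_ge0 // (le_trans (sqr_Re_le _)) // ltW.
- apply: regulated_measurable => e t e0.
  exists (complex.Im (llimit a t)), (complex.Im (rlimit a t)).
  have : \forall s \near t, (s < t -> sqn (a (cis s) - llimit a t) < e ^+ 2) /\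
     (t < s -> sqn (a (cis s) - rlimit a t) < e ^+ 2).
    by apply: onesided_near; rewrite exprn_gt0.
  apply: filterS => s [hl hr].
  by split=> [/hl|/hr] h; rewrite -ImN -ImD -(@ler_pXn2r _ 2) ?nnegrE ?(ltW e0) //
    -normrX ger0_norm ?sqr_ge0 // (le_trans (sqr_Im_le _)) // ltW.
- exact: pc_bounded.
Qed.

End Regulated.

(** * The argument along the curve *)

Section Periodicity.
Context (R : realType).

Lemma expi_inj (s t : R) : s <= t <= s + 2 * pi -> expi s = expi t ->
  t = s \/ t = s + 2 * pi.
Proof.
move=> /andP[st ts] e.
have c1 : cos (t - s) = 1.
  have : expi (t - s) = 1 by rewrite expiD -e -expiD subrr expi0.
  by case.
have [->|ns] := eqVneq t s; first by left.
have [->|nt] := eqVneq t (s + 2 * pi); first by right.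
have lt1 : 0 < t - s by rewrite subr_gt0 lt_def ns.
have lt2 : t < s + 2 * pi by rewrite lt_def eq_sym nt.
have /sin_gt0_pi p : 0 < (t - s) / 2 < pi by apply/andP; split; lra.
have : cos (t - s) = 1 - 2 * sin ((t - s) / 2) ^+ 2.
  have {1}-> : t - s = (t - s) / 2 + (t - s) / 2 by field.
  by rewrite cosD -!expr2; have := cos2Dsin2 ((t - s) / 2); lra.
rewrite c1 => h.
have : 0 < sin ((t - s) / 2) ^+ 2 by rewrite exprn_gt0.
lra.
Qed.

Lemma expi_floor (s t : R) : exists2 u, s <= u <= s + 2 * pi & expi u = expi t.
Proof.
have p0 : 0 < 2 * pi :> R by rewrite mulr_gt0 ?pi_gt0.
pose k := Num.floor ((t - s) / (2 * pi)).
exists (t - 2 * pi * k%:~R).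
  have := floor_itv ((t - s) / (2 * pi)); rewrite -/k.
  rewrite ler_pdivlMr // ltr_pdivrMr // intrD => /andP[h1 h2].
  by apply/andP; split; lra.
have e2 : expi (2 * pi : R) = 1.
  by rewrite mulr_natl /expi cos2pi sin2pi.
have ek (n : nat) : expi (2 * pi * n%:R : R) = 1.
  by rewrite mulrC -expiMn e2 expr1n.
rewrite expiD; case: k => n; first by rewrite -expiJ ek conjc1 mulr1.
by rewrite NegzE mulrNz mulrN opprK ek mulr1.
Qed.

Lemma cis_expi (s t : R) : expi s = expi t -> cis s = cis t.
Proof.
rewrite /cis; move: (norm_expi s) (norm_expi t) => p q e.
by move: p q; rewrite e => p q; congr exist; exact: bool_irrelevance.
Qed.

Context (a : circle R -> R[i]).

Lemma jump_point_expi (s t l : R) : expi s = expi t -> jump_point a s l = jump_point a t l.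
Proof.
move=> e; pose c := s - t.
have ec : expi c = 1 by rewrite expiD e -expiD subrr expi0.
have sh u : onangle a (u + c) = onangle a u.
  by rewrite /onangle; congr (a _); apply: cis_expi; rewrite expiD ec mulr1.
have L : llimit a s = llimit a t.
  suff e2 : (onangle a u @[u --> s^'-]) = (onangle a u @[u --> t^'-]).
    by rewrite /llimit e2.
  apply/seteqP; split=> A hA.
    suff : \forall u \near t^'-, A (onangle a u) by [].
    have : \forall u \near s^'-, A (onangle a u) by [].
    rewrite !near_withinE => /nbhs_ballP[d /= d0 h]; apply/nbhs_ballP; exists d => // u tu ut.
    rewrite /= -sh; apply: h; last by rewrite /c; lra.
    by move: tu; rewrite /ball /= /c; congr (`|_| < _); ring.
  suff : \forall u \near s^'-, A (onangle a u) by [].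
  have : \forall u \near t^'-, A (onangle a u) by [].
  rewrite !near_withinE => /nbhs_ballP[d /= d0 h]; apply/nbhs_ballP; exists d => // u tu ut.
  have -> : u = (u - c) + c by ring.
  rewrite /= sh; apply: h; last by rewrite /c; lra.
  by move: tu; rewrite /ball /= /c; congr (`|_| < _); ring.
have Rr : rlimit a s = rlimit a t.
  suff e2 : (onangle a u @[u --> s^'+]) = (onangle a u @[u --> t^'+]).
    by rewrite /rlimit e2.
  apply/seteqP; split=> A hA.
    suff : \forall u \near t^'+, A (onangle a u) by [].
    have : \forall u \near s^'+, A (onangle a u) by [].
    rewrite !near_withinE => /nbhs_ballP[d /= d0 h]; apply/nbhs_ballP; exists d => // u tu ut.
    rewrite /= -sh; apply: h; last by rewrite /c; lra.
    by move: tu; rewrite /ball /= /c; congr (`|_| < _); ring.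
  suff : \forall u \near s^'+, A (onangle a u) by [].
  have : \forall u \near t^'+, A (onangle a u) by [].
  rewrite !near_withinE => /nbhs_ballP[d /= d0 h]; apply/nbhs_ballP; exists d => // u tu ut.
  have -> : u = (u - c) + c by ring.
  rewrite /= sh; apply: h; last by rewrite /c; lra.
  by move: tu; rewrite /ball /= /c; congr (`|_| < _); ring.
by rewrite /jump_point L Rr.
Qed.

End Periodicity.

Section SharpCurve.
Context (R : realType) (a : circle R -> R[i]) (a_nz : ~ sharp a 0).
Context (g : R -> R[i]^o) (phi l r w : R -> R).
Context (phi_cont : {within `[0, 1], continuous phi}).
Context (phi_homo : {in `[0, 1] &, {homo phi : s s' / s <= s'}}).
Context (phi1 : phi 1 = phi 0 + 2 * pi).
Context (g_jump : {in `[0, 1], forall s, 0 <= l s <= 1 /\ g s = jump_point a (phi s) (l s)}).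
Context (w_cont : {within `[0, 1], continuous w}).
Context (g_polar : {in `[0, 1], forall s, 0 < r s /\ g s = (r s)%:C * expi (w s)}).
Context (w01 : w 1 = w 0).

Let I01 (s : R) : (s \in `[0, 1]) = (0 <= s <= 1).
Proof. by rewrite in_itv. Qed.

(** Two points of one jump segment with opposite arguments have the origin between them, and the
    segment is convex. *)
Lemma no_antipode s s' : s \in `[0, 1] -> s' \in `[0, 1] ->
  expi (phi s) = expi (phi s') -> w s' <> w s + pi.
Proof.
move=> sI s'I e ww; apply: a_nz.
have [r0 gr] := g_polar sI; have [r0' gr'] := g_polar s'I.
have [ls gs] := g_jump sI; have [ls' gs'] := g_jump s'I.
(* The weight that balances the two moduli: [(1 - m) r s = m r s']. *)
pose m := r s / (r s + r s').
have rr : 0 < r s + r s' by rewrite addr_gt0.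
have m01 : 0 <= m <= 1.
  by rewrite /m divr_ge0 ?(ltW r0) ?(ltW rr) //= ler_pdivrMr // mul1r lerDl ltW.
exists (phi s), ((1 - m) * l s + m * l s'); split.
  move/andP: ls => [? ?]; move/andP: ls' => [? ?]; move/andP: m01 => [? ?].
  by apply/andP; split; nra.
have -> : jump_point a (phi s) ((1 - m) * l s + m * l s') =
    (1 - m)%:C * g s + m%:C * g s'.
  rewrite gs gs' (jump_point_expi _ _ (esym e)) /jump_point.
  rewrite !(rmorphB, rmorphD, rmorphM, rmorph1) /=; ring.
rewrite gr gr' ww expiD.
have -> : expi (pi : R) = -1 by rewrite /expi cospi sinpi; simpc.
have -> : (1 - m)%:C * ((r s)%:C * expi (w s)) + m%:C * ((r s')%:C * (expi (w s) * -1))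
   = ((1 - m) * r s - m * r s')%:C * expi (w s).
  rewrite !(rmorphB, rmorphD, rmorphM, rmorph1) /=; ring.
have -> : (1 - m) * r s - m * r s' = 0 by rewrite /m; field; rewrite lt0r_neq0.
by rewrite mul0r.
Qed.

Let IVT_w u v c : 0 <= u -> u <= v -> v <= 1 -> 
  (w u <= c <= w v \/ w v <= c <= w u) ->
  exists2 s, u <= s <= v & w s = c.
Proof.
move=> u0 uv v1 h.
have cw : {within `[u, v], continuous w}.
  apply: continuous_subspaceW w_cont => x /=; rewrite !in_itv /= => /andP[ux xv].
  by rewrite (le_trans u0 ux) (le_trans xv v1).
have [|s] := @IVT _ w u v c uv cw.
  by case: h => /andP[h1 h2]; rewrite ge_min le_max h1 h2 ?orbT.
by rewrite in_itv; exists s.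
Qed.

Let phi_range s : s \in `[0, 1] -> phi 0 <= phi s <= phi 0 + 2 * pi.
Proof.
rewrite I01 -phi1 => /andP[s0 s1].
by rewrite !phi_homo ?I01 ?lexx ?s0 ?s1 ?ler01.
Qed.

Let phi_cst u v s : 0 <= u -> v <= 1 -> phi u = phi v -> u <= s <= v -> phi s = phi u.
Proof.
move=> u0 v1 e /andP[us sv]; apply/eqP; rewrite eq_le.
have s0 := le_trans u0 us; have s1 := le_trans sv v1.
have v0 := le_trans s0 sv; have u1 := le_trans us s1.
by rewrite {1}e !phi_homo ?I01 ?u0 ?s0 ?s1 ?v0 ?v1 ?u1.
Qed.

(** Otherwise [w] takes the value [w s + pi] on the same fibre, against [no_antipode]. A fibre is an
    interval, [phi] being monotone, except over the base angle, where it consists of an initial and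
    a final interval; [w 1 = w 0], the vanishing of the winding number, joins these two. *)
Lemma fiber_half s s' : s \in `[0, 1] -> s' \in `[0, 1] ->
  expi (phi s) = expi (phi s') -> w s' < w s + pi.
Proof.
move=> sI s'I e; rewrite ltNge; apply/negP => ww.
set c := w s + pi in ww.
have wc : w s <= c by rewrite lerDl ltW ?pi_gt0.
suff [s2 [s2I e2 w2]] : exists s2, [/\ s2 \in `[0, 1], expi (phi s2) = expi (phi s) & w s2 = c].
  exact: (no_antipode sI s2I (esym e2) w2).
have [/andP[s0 s1] /andP[s0' s1']] : (0 <= s <= 1) /\ (0 <= s' <= 1) by rewrite -!I01.
have /andP[p0 p1] := phi_range sI; have /andP[p0' p1'] := phi_range s'I.
have same : phi s = phi s' ->
    exists s2, [/\ s2 \in `[0, 1], expi (phi s2) = expi (phi s) & w s2 = c].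
  move=> pp; have [ss|ss] := leP s s'.
    have [s2 h2 w2] := IVT_w s0 ss s1' (or_introl (introT andP (conj wc ww))).
    exists s2; split=> //; last by rewrite (phi_cst s0 s1' pp h2).
    by move/andP: h2 => [h h']; rewrite I01 (le_trans s0 h) (le_trans h' s1').
  have [s2 h2 w2] := IVT_w s0' (ltW ss) s1 (or_intror (introT andP (conj wc ww))).
  exists s2; split=> //; last by rewrite (phi_cst s0' s1 (esym pp) h2) pp.
  by move/andP: h2 => [h h']; rewrite I01 (le_trans s0' h) (le_trans h' s1).
have exp2 : expi (phi 0) = expi (phi 0 + 2 * pi).
  by rewrite expiD mulr_natl [X in _ * X]/expi cos2pi sin2pi mulr1.
have left u v : 0 <= u -> u <= 1 -> phi u = phi 0 -> (w 0 <= v <= w u \/ w u <= v <= w 0) ->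
    exists s2, [/\ s2 \in `[0, 1], expi (phi s2) = expi (phi 0) & w s2 = v].
  move=> u0 u1 pu h; have [s2 h2 w2] := IVT_w (lexx 0) u0 u1 h.
  exists s2; split=> //; last by rewrite (phi_cst (lexx 0) u1 (esym pu) h2).
  by move/andP: h2 => [h1 h']; rewrite I01 h1 (le_trans h' u1).
have right u v : 0 <= u -> u <= 1 -> phi u = phi 0 + 2 * pi ->
    (w u <= v <= w 0 \/ w 0 <= v <= w u) ->
    exists s2, [/\ s2 \in `[0, 1], expi (phi s2) = expi (phi 0) & w s2 = v].
  move=> u0 u1 pu; rewrite -w01 => h; have [s2 h2 w2] := IVT_w u0 u1 (lexx 1) h.
  exists s2; split=> //; last by rewrite (phi_cst u0 (lexx 1) _ h2) ?pu ?phi1 // exp2.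
  by move/andP: h2 => [h1 h']; rewrite I01 (le_trans u0 h1) h'.
(* The common value [w 0 = w 1] at the seam tells which piece crosses the level [c]: the one
   containing [s] if [c <= w 0], the one containing [s'] otherwise. *)
have [c0|c0] := leP c (w 0).
- have [pss|pss] := leP (phi s) (phi s').
    have [//|e1|e1] := expi_inj _ e; first by rewrite pss (le_trans p1') ?lerD2r.
      exact: same.
    have ps0 : phi s = phi 0 by lra.
    rewrite ps0; apply: (left s) => //; right; by rewrite wc.
  have [//|e1|e1] := expi_inj _ (esym e); first by rewrite (ltW pss) (le_trans p1) ?lerD2r.
    exact: same.
  have ps0 : phi s = phi 0 + 2 * pi by lra.
  by rewrite ps0 -exp2; apply: (right s) => //; left; rewrite wc.
- have [pss|pss] := leP (phi s) (phi s').
    have [//|e1|e1] := expi_inj _ e; first by rewrite pss (le_trans p1') ?lerD2r.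
      exact: same.
    have ps0 : phi s = phi 0 by lra.
    have ps0' : phi s' = phi 0 + 2 * pi by lra.
    rewrite ps0; apply: (right s') => //; right; by rewrite (ltW c0).
  have [//|e1|e1] := expi_inj _ (esym e); first by rewrite (ltW pss) (le_trans p1) ?lerD2r.
    exact: same.
  have ps0 : phi s = phi 0 + 2 * pi by lra.
  have ps0' : phi s' = phi 0 by lra.
  by rewrite ps0 -exp2; apply: (left s') => //; left; rewrite (ltW c0).
Qed.

Lemma fiber_surj t : exists2 s, s \in `[0, 1] & expi (phi s) = expi t.
Proof.
have [u hu <-] := expi_floor (phi 0) t.
have [|s sI <-] := @IVT _ phi 0 1 u ler01 phi_cont; last by exists s.
by move/andP: hu => [h1 h2]; rewrite ge_min le_max phi1 h1 h2 ?orbT.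
Qed.

End SharpCurve.

(** * Uniformity from compactness of the parameter interval *)

Section CompactParameters.
Context (R : realType).

Lemma within_cvg {V : topologicalType} {I : Type} {F : set_system I} {FF : Filter F}
    (f : R -> V) (A : set R) (u : I -> R) (s : R) :
  {within A, continuous f} -> (forall i, A (u i)) -> A s ->
  u @ F --> s -> (f \o u) @ F --> f s.
Proof.
move=> /subspace_continuousP cf uA As us B /(cf _ As) h.
have h' : nbhs s [set x | A x -> B (f x)] by exact: h.
have {}h : F (u @^-1` [set x | A x -> B (f x)]) by exact: us.
suff : F ((f \o u) @^-1` B) by [].
by apply: filterS h => i /= /(_ (uA i)).
Qed.

Lemma sqn_within_continuous (g : R -> R[i]^o) (A : set R) :
  {within A, continuous g} -> {within A, continuous (fun s => sqn (g s))}.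
Proof. by move=> cg x; apply: (@cvg_sqn _ _ (nbhs (x : subspace A))); exact: cg. Qed.

Lemma itv01_bounded (f : R -> R) : {within `[0, 1], continuous f} ->
  exists B : R, forall s, s \in `[0, 1] -> f s <= B.
Proof.
move=> cf; have [c _ hc] := @EVT_max R f 0 1 ler01 cf.
by exists (f c).
Qed.

Lemma itv01_lower (f : R -> R) : {within `[0, 1], continuous f} ->
  {in `[0, 1], forall s, 0 < f s} ->
  exists2 c : R, 0 < c & forall s, s \in `[0, 1] -> c <= f s.
Proof.
move=> cf f0; have [c cI hc] := @EVT_min R f 0 1 ler01 cf.
by exists (f c); [exact: f0|].
Qed.

Lemma ultra_itv01 (U : set_system nat) (UU : UltraFilter U) (u : nat -> R) :
  (forall n, u n \in `[0, 1]) -> exists2 s : R, s \in `[0, 1] & u @ U --> s.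
Proof.
move=> uI.
have h n : 0 <= u n <= 1 by have := uI n; rewrite in_itv.
have [s us] : exists s : R, u @ U --> s.
  apply: (ultra_cvg UU (K := 1)) => n; move/andP: (h n) => [h0 h1].
  by rewrite ger0_norm.
exists s => //; rewrite in_itv /=; apply/andP; split.
  rewrite -oppr_le0.
  have us' : (fun n => - u n) @ U --> - s by exact: cvgN.
  apply: (cvg_const_le us'); apply: nearW => n.
  by rewrite oppr_le0; have /andP[] := h n.
by apply: (cvg_const_le us); apply: nearW => n; have /andP[] := h n.
Qed.

(** Without a margin there would be pairs with angular distance and defect below [1 / (n + 1)];
    along an ultrafilter they converge to a pair on one fibre with [w s' >= w s + p]. *)
Lemma uniform_fiber (phi w : R -> R) (p : R) :
  {within `[0, 1], continuous phi} -> {within `[0, 1], continuous w} ->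
  (forall s s', s \in `[0, 1] -> s' \in `[0, 1] ->
     expi (phi s) = expi (phi s') -> w s' < w s + p) ->
  exists d e : R, [/\ 0 < d, 0 < e &
    forall s s', s \in `[0, 1] -> s' \in `[0, 1] ->
      sqn (expi (phi s) - expi (phi s')) <= d -> w s' <= w s + p - e].
Proof.
move=> cphi cw h; apply: contrapT => nh.
have ex n : exists ss : R * R, [/\ ss.1 \in `[0, 1], ss.2 \in `[0, 1],
    sqn (expi (phi ss.1) - expi (phi ss.2)) <= n.+1%:R^-1 &
    w ss.1 + p - n.+1%:R^-1 <= w ss.2].
  apply: contrapT => nex; apply: nh; exists n.+1%:R^-1, n.+1%:R^-1.
  split; rewrite ?invr_gt0 ?ltr0Sn // => s s' sI s'I hd.
  rewrite leNgt; apply/negP => hw; apply: nex; exists (s, s'); split=> //.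
  exact: ltW.
have [ss hss] : exists ss : nat -> R * R, forall n, [/\ (ss n).1 \in `[0, 1], (ss n).2 \in `[0, 1],
    sqn (expi (phi (ss n).1) - expi (phi (ss n).2)) <= n.+1%:R^-1 &
    w (ss n).1 + p - n.+1%:R^-1 <= w (ss n).2].
  by exists (fun n => projT1 (cid (ex n))) => n; case: (cid (ex n)).
have [U [UU Uoo]] := ultra_infty.
have i1 n : (ss n).1 \in `[0, 1] by case: (hss n).
have i2 n : (ss n).2 \in `[0, 1] by case: (hss n).
have [s sI us] := ultra_itv01 UU i1.
have [s' s'I us'] := ultra_itv01 UU i2.
have sA n : `[0, 1]%classic (ss n).1 by case: (hss n).
have sA' n : `[0, 1]%classic (ss n).2 by case: (hss n).
have ws : (fun n => w (ss n).1) @ U --> w s by exact: (within_cvg cw sA sI us).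
have ws' : (fun n => w (ss n).2) @ U --> w s' by exact: (within_cvg cw sA' s'I us').
have ps : (fun n => phi (ss n).1) @ U --> phi s by exact: (within_cvg cphi sA sI us).
have ps' : (fun n => phi (ss n).2) @ U --> phi s' by exact: (within_cvg cphi sA' s'I us').
have inv0 : (fun n : nat => n.+1%:R^-1 : R) @ U --> (0 : R).
  apply/cvgrPdist_lt => e e0.
  have := near_infty_natSinv_lt (PosNum e0) => -[N _ hN].
  apply: filterS (Uoo N) => n Nn; rewrite sub0r normrN ger0_norm ?invr_ge0 //.
  exact: hN.
have Ez : (fun n => expi (phi (ss n).1) - expi (phi (ss n).2) : R[i]^o) @ U -->
    (expi (phi s) - expi (phi s') : R[i]^o).
  apply: cvgB; apply: cvgC_ReIm => /=.
  - by apply: (cvg_comp _ _ ps); exact: continuous_cos.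
  - by apply: (cvg_comp _ _ ps); exact: continuous_sin.
  - by apply: (cvg_comp _ _ ps'); exact: continuous_cos.
  - by apply: (cvg_comp _ _ ps'); exact: continuous_sin.
have Z : expi (phi s) = expi (phi s').
  have h1 : (fun n => n.+1%:R^-1 - sqn (expi (phi (ss n).1) - expi (phi (ss n).2))) @ U -->
     0 - sqn (expi (phi s) - expi (phi s')).
    by apply: cvgB => //; exact: cvg_sqn.
  have : 0 <= 0 - sqn (expi (phi s) - expi (phi s')).
    rewrite -oppr_le0; apply: (cvg_const_le (cvgN h1)); apply: nearW => n /=.
    by rewrite oppr_le0 subr_ge0; case: (hss n).
  rewrite sub0r oppr_ge0 => z; apply/eqP; rewrite -subr_eq0 -sqn_eq0 eq_le z.
  exact: sqn_ge0.
have := h s s' sI s'I Z; rewrite ltNge => /negP; apply.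
rewrite -subr_le0.
have h1 : (fun n => w (ss n).1 + p - n.+1%:R^-1 - w (ss n).2) @ U --> w s + p - 0 - w s'.
  apply: cvgB => //; apply: cvgB => //; apply: cvgD => //; exact: cvg_cst.
rewrite subr0 in h1; apply: (cvg_const_le h1); apply: nearW => n.
by rewrite subr_le0; case: (hss n).
Qed.

End CompactParameters.

(** * Fejer averages *)

Section Fejer.
Context (R : realType).

(** One-sided sum: [sqn (dirichlet n s) / n] is the Fejer kernel. *)
Definition dirichlet (n : nat) (s : R) : R[i] := \sum_(0 <= k < n) expi (k%:R * s).

(** Averages run over equispaced nodes instead of an integral, because the function to be averaged
    is obtained by choice and nothing is known about its measurability. *)
Definition node (n j : nat) : R := 2 * pi * j%:R / n%:R.

Let expi2pi : expi (2 * pi : R) = 1.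
Proof. by rewrite mulr_natl /expi cos2pi sin2pi. Qed.

Lemma sqn_dirichletC n s :
  (sqn (dirichlet n s))%:C = \sum_(0 <= k < n) \sum_(0 <= l < n) expi ((k%:R - l%:R) * s).
Proof.
rewrite -mulcJ /dirichlet mulr_suml; apply: eq_bigr => k _.
rewrite rmorph_sum mulr_sumr; apply: eq_bigr => l _.
by rewrite [X in _ * X]expiJ -expiD mulrBl.
Qed.

Lemma sqn_dirichlet n s :
  sqn (dirichlet n s) = \sum_(0 <= k < n) \sum_(0 <= l < n) cos ((k%:R - l%:R) * s).
Proof.
rewrite -[LHS]/(complex.Re (sqn (dirichlet n s))%:C) sqn_dirichletC Re_sum.
by apply: eq_bigr => k _; rewrite Re_sum.
Qed.

(** Orthogonality of characters at the [n]-th roots of unity; [k, l < n] excludes aliasing. *)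
Lemma sum_node (n k l : nat) : (k < n)%N -> (l < n)%N ->
  \sum_(0 <= j < n) expi (- ((k%:R - l%:R) * node n j)) = (if k == l then n%:R else 0) :> R[i].
Proof.
move=> kn ln.
have n0 : (n%:R : R) != 0 by rewrite pnatr_eq0 -lt0n; lia.
case: eqP => [<-|/eqP kl].
  under eq_bigr do rewrite subrr mul0r oppr0 expi0.
  by rewrite sumr_const_nat subn0.
pose x : R := - ((k%:R - l%:R) * (2 * pi) / n%:R).
have e j : expi (- ((k%:R - l%:R) * node n j)) = expi x ^+ j.
  by rewrite expiMn; congr expi; rewrite /x /node; field.
under eq_bigr do rewrite e.
have x1 : expi x ^+ n = 1.
  rewrite expiMn.
  have -> : n%:R * x = l%:R * (2 * pi) + - (k%:R * (2 * pi)) by rewrite /x; field.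
  have ek (i : nat) : expi (i%:R * (2 * pi) : R) = 1 by rewrite -(expiMn (2 * pi)) expi2pi expr1n.
  by rewrite expiD -expiJ !ek conjc1 mulr1.
have x_neq1 : expi x - 1 != 0.
  rewrite subr_eq0; apply/eqP => ex.
  have p0 : 0 < 2 * pi :> R by rewrite mulr_gt0 ?pi_gt0.
  have xlt (i j : nat) : (i < j)%N -> (j < n)%N ->
      0 < (j%:R - i%:R) * (2 * pi) / n%:R :> R /\ (j%:R - i%:R) * (2 * pi) / n%:R < 2 * pi :> R.
    move=> ij jn; have n0' : 0 < n%:R :> R by rewrite ltr0n; lia.
    split; first by rewrite divr_gt0 // mulr_gt0 // subr_gt0 ltr_nat.
    rewrite ltr_pdivrMr // mulrC ltr_pM2l // ltrBlDr ltr_wpDr //.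
    by rewrite ltr_nat.
  have key (y : R) : 0 < y -> y < 2 * pi -> expi y <> 1.
    move=> y0 y2 ey; have [||h|h] := @expi_inj R 0 y; last by rewrite h add0r ltxx in y2.
    - by rewrite add0r !ltW.
    - by rewrite expi0 ey.
    - by rewrite h ltxx in y0.
  have [lk|kl'|/eqP] := ltngtP l k; last by rewrite eq_sym (negbTE kl).
    have [h1 h2] := xlt _ _ lk kn; apply: (key _ h1 h2).
    by rewrite -[(_ / _)]opprK -/x -expiJ ex conjc1.
  have [h1 h2] := xlt _ _ kl' ln; apply: (key _ h1 h2).
  by rewrite -ex; congr expi; rewrite /x; ring.
apply: (mulfI x_neq1); rewrite mulr0 big_mkord.
by rewrite -subrX1 x1 subrr.
Qed.

(** The frequencies of the kernel are below [n] in absolute value, so summation over the nodes keeps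
    exactly its constant term. Divided by [n^2], the terms become weights of total mass 1. *)
Lemma sum_fejer n t : (0 < n)%N ->
  \sum_(0 <= j < n) sqn (dirichlet n (t - node n j)) = n%:R ^+ 2.
Proof.
move=> n0; apply: complexI.
rewrite (rmorph_sum (real_complex R)) /=.
under eq_bigr do rewrite sqn_dirichletC.
rewrite exchange_big /=.
have -> : (n%:R ^+ 2)%:C = \sum_(0 <= k < n) (n%:R : R[i]).
  rewrite sumr_const_nat subn0 -[RHS]mulr_natr -expr2.
  by rewrite -(rmorph_nat (real_complex R)) (rmorphXn (real_complex R)).
apply: eq_big_nat => k /andP[_ kn]; rewrite exchange_big /=.
transitivity (\sum_(0 <= l < n) expi ((k%:R - l%:R) * t) * (if k == l then n%:R else 0) : R[i]).
  apply: eq_big_nat => l /andP[_ ln]; rewrite -(sum_node kn ln) mulr_sumr.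
  by apply: eq_bigr => j _; rewrite -expiD mulrBr.
rewrite big_mkord (bigD1 (Ordinal kn)) //= eqxx subrr mul0r expi0 mul1r big1 ?addr0 // => l lk.
by rewrite eq_sym -val_eqE /= in lk *; rewrite (negbTE lk) mulr0.
Qed.

(** Closed form of a geometric sum, whose numerator has squared modulus at most 4. *)
Lemma dirichlet_far n (t th d : R) : 0 < d -> d <= sqn (expi t - expi th) ->
  sqn (dirichlet n (t - th)) <= 4 / d.
Proof.
move=> d0 far; rewrite ler_pdivlMr //.
have e : (expi (t - th) - 1) * dirichlet n (t - th) = expi (t - th) ^+ n - 1.
  rewrite subrX1 /dirichlet big_mkord; congr (_ * _).
  by apply: eq_bigr => i _; rewrite expiMn.
have f : sqn (expi t - expi th) = sqn (expi (t - th) - 1).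
  have -> : expi t - expi th = (expi (t - th) - 1) * expi th.
    by rewrite mulrBl mul1r -expiD subrK.
  by rewrite sqnM sqn_expi mulr1.
apply: (@le_trans _ _ (sqn (dirichlet n (t - th)) * sqn (expi (t - th) - 1))).
  by apply: ler_wpM2l; rewrite ?sqn_ge0 // -f.
rewrite mulrC -sqnM e; apply: le_trans (sqnD_le _ _) _.
by rewrite sqnN sqn1 sqnX sqn_expi expr1n; lra.
Qed.

(** In truncated subtraction [k - l + (l - k)] is [|k - l|]: for real weights the real part does not
    see the sign of a frequency, so the Fejer average is the real part of an analytic polynomial. *)
Definition fejer_poly n (m : nat -> R) : {poly R[i]} :=
  \sum_(0 <= j < n) \sum_(0 <= k < n) \sum_(0 <= l < n)
    ((m j / n%:R ^+ 2)%:C * expi (- ((k - l + (l - k))%N%:R * node n j))) *: 'X^(k - l + (l - k)).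

Lemma Re_fejer_poly n m (t : R) :
  complex.Re (fejer_poly n m).[expi t] =
  \sum_(0 <= j < n) m j / n%:R ^+ 2 * sqn (dirichlet n (t - node n j)).
Proof.
rewrite /fejer_poly horner_sum Re_sum; apply: eq_bigr => j _.
rewrite sqn_dirichlet horner_sum Re_sum mulr_sumr; apply: eq_bigr => k _.
rewrite horner_sum Re_sum mulr_sumr; apply: eq_bigr => l _.
rewrite hornerZ hornerXn expiMn -[X in complex.Re X]mulrA -expiD.
set N := (k - l + (l - k))%N.
have -> : - (N%:R * node n j) + N%:R * t = N%:R * (t - node n j) by ring.
rewrite ReM /= mul0r subr0; congr (_ * _).
have [kl|lk] := leqP k l.
  have -> : N%:R = l%:R - k%:R :> R by rewrite -natrB //; congr (_%:R); rewrite /N; lia.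
  by rewrite -cosN; congr cos; ring.
have -> : N%:R = k%:R - l%:R :> R; last by [].
by rewrite -natrB ?(ltnW lk) //; congr (_%:R); rewrite /N; lia.
Qed.

(* P t x: x is a value, at the angle t, of a multivalued function whose values
   over close angles lie within p - e of one another; the polynomial averages
   local midpoints of its range against the Fejer kernel. *)
Lemma fejer_selection (P : R -> R -> Prop) (W d e p : R) : 0 < d -> 0 < e ->
  (forall t x, P t x -> `|x| <= W) ->
  (forall t x t' x', P t x -> P t' x' -> sqn (expi t - expi t') <= d -> x' <= x + p - e) ->
  exists f : {poly R[i]}, forall t x, P t x ->
    `|x - complex.Re f.[expi t]| <= p / 2 - e / 4.
Proof.
move=> d0 e0 PW Pd.
(* [m th] is the midpoint of an interval of length [p - e] containing all values over angles close
   to [th]. The bound [d / 4] makes any two such angles [d]-close, by [sqnD_le]. *)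
have [m hm] : exists m : R -> R, forall th, `|m th| <= `|W| + `|p - e| / 2 /\
    forall t x, P t x -> sqn (expi t - expi th) <= d / 4 -> `|x - m th| <= (p - e) / 2.
  suff h th : exists c : R, `|c| <= `|W| + `|p - e| / 2 /\
    forall t x, P t x -> sqn (expi t - expi th) <= d / 4 -> `|x - c| <= (p - e) / 2.
    by exists (fun th => projT1 (cid (h th))) => th; case: (cid (h th)).
  pose S : set R := [set x | exists2 t, P t x & sqn (expi t - expi th) <= d / 4].
  have [[x0 Sx0]|S0] := pselect (S !=set0); last first.
    exists 0; split; first by rewrite normr0 addr_ge0 // divr_ge0.
    by move=> t x Ptx near; case: S0; exists x, t.
  have Sub x y : S x -> S y -> y <= x + p - e.
    move=> [t Pt ht] [t' Pt' ht']; apply: (Pd t x t' y) => //.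
    have -> : expi t - expi t' = (expi t - expi th) - (expi t' - expi th) by ring.
    by apply: le_trans (sqnD_le _ _) _; rewrite sqnN; lra.
  have hs : has_sup S.
    by split; [exists x0|exists (x0 + p - e) => y Sy; exact: Sub].
  have ubS y : S y -> y <= sup S by move=> Sy; apply: sup_upper_bound.
  have lbS y : S y -> sup S <= y + p - e.
    by move=> Sy; apply: ge_sup => [|z Sz]; [exists x0|exact: Sub].
  have SW : `|sup S| <= `|W|.
    have [t Pt _] := Sx0.
    have W0 : 0 <= W by apply: le_trans (PW t x0 Pt); exact: normr_ge0.
    rewrite (ger0_norm W0) ler_norml; apply/andP; split.
      apply: le_trans (ubS _ Sx0); have := PW t x0 Pt.
      by rewrite ler_norml => /andP[].
    apply: ge_sup; first by exists x0.
    by move=> y [t' Pt' _]; apply: le_trans (PW t' y Pt'); exact: ler_norm.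
  exists (sup S - (p - e) / 2); split.
    apply: le_trans (ler_normB _ _) _; rewrite lerD // normrM [`|2^-1|]ger0_norm //.
  move=> t x Pt ht; have Sx : S x by exists t.
  have := ubS x Sx; have := lbS x Sx.
  by rewrite ler_norml => ? ?; apply/andP; split; lra.
pose W1 := `|W| + (`|W| + `|p - e| / 2).
have W1_ge0 : 0 <= W1 by rewrite /W1 !addr_ge0 // divr_ge0.
(* Each node far from [t] contributes at most [16 / d * W1 / n^2], by [dirichlet_far] with [d / 4];
   with this [n], the [n] nodes together lose at most [e / 4] of the available [e / 2]. *)
pose n := (Num.truncn (64 * W1 / (d * e))).+1.
have n0 : 0 < n%:R :> R by rewrite ltr0n.
have hn : 16 / d * W1 / n%:R <= e / 4.
  rewrite ler_pdivrMr //.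
  have : 64 * W1 / (d * e) < n%:R by exact: truncnS_gt.
  rewrite ltr_pdivrMr ?mulr_gt0 // => h.
  rewrite mulrAC ler_pdivrMr //; nra.
exists (fejer_poly n (fun j => m (node n j))) => t x Pt.
rewrite Re_fejer_poly.
pose ka j := sqn (dirichlet n (t - node n j)) / n%:R ^+ 2.
have ka0 j : 0 <= ka j by rewrite divr_ge0 ?sqn_ge0 ?exprn_ge0 ?ltW.
have ka1 : \sum_(0 <= j < n) ka j = 1.
  by rewrite -mulr_suml sum_fejer // mulfV // expf_neq0 // lt0r_neq0.
have -> : x - \sum_(0 <= j < n) m (node n j) / n%:R ^+ 2 * sqn (dirichlet n (t - node n j)) =
    \sum_(0 <= j < n) ka j * (x - m (node n j)).
  have xe : x = \sum_(0 <= j < n) ka j * x by rewrite -mulr_suml ka1 mul1r.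
  rewrite {1}xe -sumrB; apply: eq_bigr => j _.
  by rewrite /ka; set v := (_ ^+ 2)^-1; ring.
have pe0 : 0 <= p - e.
  have := Pd t x t x Pt Pt; rewrite subrr sqn0 (ltW d0) => /(_ isT); lra.
have bnd j : `|ka j * (x - m (node n j))| <= ka j * ((p - e) / 2) + 16 / d * W1 / n%:R ^+ 2.
  rewrite normrM ger0_norm //; have [mj near] := hm (node n j).
  have c0 : 0 <= 16 / d * W1 / n%:R ^+ 2.
    by rewrite divr_ge0 ?exprn_ge0 ?(ltW n0) // mulr_ge0 // divr_ge0 // ltW.
  have [h|h] := leP (sqn (expi t - expi (node n j))) (d / 4).
    by apply: ler_wpDr => //; apply: ler_wpM2l => //; exact: near h.
  apply: ler_wpDl; first by rewrite mulr_ge0 // divr_ge0.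
  have far := dirichlet_far n (_ : 0 < d / 4) (ltW h).
  rewrite /ka mulrAC; apply: ler_wpM2r; first by rewrite invr_ge0 exprn_ge0 ?ltW.
  apply: ler_pM; rewrite ?sqn_ge0 ?normr_ge0 //.
    apply: le_trans (far _) _; first by rewrite divr_gt0.
    by apply: eq_ler; field; rewrite lt0r_neq0.
  apply: le_trans (ler_normB _ _) _; rewrite lerD //.
  by apply: le_trans (PW t x Pt) (ler_norm _).
apply: le_trans (ler_norm_sum _ _ _) _.
apply: le_trans (ler_sum _ (fun j _ => bnd j)) _.
rewrite big_split /= -mulr_suml ka1 mul1r sumr_const_nat subn0.
have -> : 16 / d * W1 / n%:R ^+ 2 *+ n = 16 / d * W1 / n%:R.
  by rewrite -mulr_natr; field; rewrite !lt0r_neq0.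
lra.
Qed.

End Fejer.

(** * Polynomial approximation of the exponential *)

Section ComplexExponential.
Context (R : realType).
Implicit Types (x y z h : R[i]).

Notation nrm := (@Normc.normc R).

Lemma nrmE z : nrm z = Num.sqrt (sqn z).
Proof. by case: z. Qed.

Lemma nrm_ge0 z : 0 <= nrm z.
Proof. by rewrite nrmE sqrtr_ge0. Qed.

Lemma nrmM x y : nrm (x * y) = nrm x * nrm y.
Proof. by rewrite !nrmE sqnM sqrtrM ?sqn_ge0. Qed.

Lemma nrmD x y : nrm (x + y) <= nrm x + nrm y.
Proof. exact: le_normcD. Qed.

Lemma nrmN x : nrm (- x) = nrm x.
Proof. by rewrite !nrmE sqnN. Qed.

Lemma nrmX x n : nrm (x ^+ n) = nrm x ^+ n.
Proof.
elim: n => [|n IH]; first by rewrite nrmE sqn1 sqrtr1.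
by rewrite !exprS nrmM IH.
Qed.

Lemma norm_Re_nrm z : `|complex.Re z| <= nrm z.
Proof. by rewrite nrmE -sqrtr_sqr ler_wsqrtr // sqr_Re_le. Qed.

Lemma norm_Im_nrm z : `|complex.Im z| <= nrm z.
Proof. by rewrite nrmE -sqrtr_sqr ler_wsqrtr // sqr_Im_le. Qed.

Lemma nrm_ReIm z : nrm z <= `|complex.Re z| + `|complex.Im z|.
Proof.
rewrite nrmE -[leRHS]ger0_norm ?addr_ge0 // -sqrtr_sqr ler_wsqrtr //.
rewrite /sqn -(real_normK (num_real (complex.Re z))) -(real_normK (num_real (complex.Im z))).
have := normr_ge0 (complex.Re z); have := normr_ge0 (complex.Im z); nra.
Qed.

Lemma nrm_expi t : nrm (expi t) = 1.
Proof. by rewrite nrmE sqn_expi sqrtr1. Qed.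

Lemma nrmR (c : R) : nrm c%:C = `|c|.
Proof. by rewrite nrmE sqnR sqrtr_sqr. Qed.

Lemma nrm_exprB x y (B : R) n : nrm x <= B -> nrm y <= B -> 1 <= B ->
  nrm (x ^+ n - y ^+ n) <= n%:R * nrm (x - y) * B ^+ n.
Proof.
move=> xB yB B1; have B0 := le_trans ler01 B1.
elim: n => [|n IH]; first by rewrite subrr !mul0r nrmE sqn0 sqrtr0.
have -> : x ^+ n.+1 - y ^+ n.+1 = x * (x ^+ n - y ^+ n) + (x - y) * y ^+ n.
  by rewrite !exprS; ring.
apply: le_trans (nrmD _ _) _; rewrite !nrmM.
have h1 : nrm x * nrm (x ^+ n - y ^+ n) <= B * (n%:R * nrm (x - y) * B ^+ n).
  by apply: ler_pM; rewrite ?nrm_ge0.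
have h2 : nrm (x - y) * nrm (y ^+ n) <= nrm (x - y) * B ^+ n.+1.
  apply: ler_wpM2l; rewrite ?nrm_ge0 // nrmX exprS.
  have yn : nrm y ^+ n <= B ^+ n by apply: lerXn2r; rewrite ?nnegrE ?nrm_ge0.
  apply: le_trans yn _; rewrite ler_peMl // exprn_ge0 //.
apply: le_trans (lerD h1 h2) _; rewrite -natr1 exprS.
by apply: eq_ler; ring.
Qed.

Definition cexp h : R[i] := (expR (complex.Re h))%:C * expi (complex.Im h).

Lemma cexpMn h n : cexp (n%:R * h) = cexp h ^+ n.
Proof.
rewrite /cexp exprMn expiMn -rmorphXn /= -expRM_natl.
have -> : n%:R = (n%:R)%:C :> R[i] by rewrite rmorph_nat.
by rewrite ReM ImM /= !mul0r subr0 addr0.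
Qed.

Lemma nrm_cexp h : nrm (cexp h) = expR (complex.Re h).
Proof. by rewrite nrmM nrm_expi mulr1 nrmR ger0_norm ?expR_ge0. Qed.

Lemma derive_approx (f : R -> R) (c e : R) : is_derive (0 : R) (1 : R) f c -> 0 < e ->
  exists2 d : R, 0 < d & forall h : R, `|h| <= d -> `|f h - f 0 - c * h| <= e * `|h|.
Proof.
move=> [df <-] e0.
have /cvgrPdist_le /(_ _ e0) := df.
rewrite near_withinE => /nbhs_ballP[d /= d0 hd].
exists (d / 2) => [|h hd2]; first by rewrite divr_gt0.
have [->|h0] := eqVneq h 0; first by rewrite normr0 !mulr0 subrr subr0 normr0.
have := hd h; rewrite /ball /= sub0r normrN => /(_ _ h0).
have -> : `|h| < d by apply: le_lt_trans hd2 _; rewrite ltr_pdivrMr // ltr_pMr // ltr1n.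
move=> /(_ isT); rewrite addr0 /GRing.scale /= mulr1 => hh.
have -> : f h - f 0 - 'D_1 f 0 * h = - ('D_1 f 0 - h^-1 * (f h - f 0)) * h.
  by rewrite mulNr mulrBl [h^-1 * _]mulrC mulfVK //; ring.
by rewrite normrM normrN; apply: ler_wpM2r.
Qed.

Lemma cexp_approx (e : R) : 0 < e -> exists2 d : R, 0 < d &
  forall h, nrm h <= d -> nrm (cexp h - (1 + h)) <= e * nrm h.
Proof.
(* The real and imaginary parts cost 4 and 5 times [e1 * nrm h], hence the 9; the cap at 1 gives
   [expR A <= 3]. *)
move=> e0; pose e1 := Num.min (e / 9) 1.
have e10 : 0 < e1 by rewrite /e1 lt_min ltr01 andbT divr_gt0.
have e11 : e1 <= 1 by rewrite /e1 ge_min lexx orbT.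
have e1e : e1 <= e / 9 by rewrite /e1 ge_min lexx.
have [d1 d10 h1] := derive_approx (is_derive_expR (0 : R)) e10.
have [d2 d20 h2] := derive_approx (is_derive_cos (0 : R)) e10.
have [d3 d30 h3] := derive_approx (is_derive_sin (0 : R)) e10.
exists (Num.min (Num.min d1 d2) (Num.min d3 e1)) => [|h].
  by rewrite lt_min lt_min d10 d20 lt_min d30 e10.
rewrite !le_min => /andP[/andP[hd1 hd2] /andP[hd3 hde]].
have {}hde : nrm h <= e1 by rewrite /e1 le_min.
have hR := norm_Re_nrm h; have hI := norm_Im_nrm h.
have h0 := nrm_ge0 h.
have {}h1 := h1 _ (le_trans hR hd1).
have {}h2 := h2 _ (le_trans hI hd2).
have {}h3 := h3 _ (le_trans hI hd3).
move: h1 h2 h3; rewrite expR0 cos0 sin0 oppr0 mul0r !mul1r addr0 subr0.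
set A := complex.Re h in hR *; set B := complex.Im h in hI * => h1 h2 h3.
have E3 : expR A <= 3.
  have := h1; rewrite ler_norml => /andP[_ h1'].
  have := hR; rewrite ler_norml => /andP[_ hA].
  have A1 : `|A| <= 1 by apply: le_trans hR (le_trans hde e11).
  have : e1 * `|A| <= 1 * 1 by apply: ler_pM => //; exact: ltW.
  lra.
have E0 := expR_ge0 A.
have Em1 : `|expR A - 1| <= 2 * nrm h.
  have -> : expR A - 1 = (expR A - 1 - A) + A by ring.
  apply: le_trans (ler_normD _ _) _.
  have : e1 * `|A| <= 1 * nrm h by apply: ler_pM => //; exact: ltW.
  lra.
have eB : e1 * `|B| <= e1 * nrm h by apply: ler_wpM2l => //; exact: ltW.
have eA : e1 * `|A| <= e1 * nrm h by apply: ler_wpM2l => //; exact: ltW.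
apply: le_trans (nrm_ReIm _) _.
rewrite ReD ReN ImD ImN /cexp ReM ImM ReD ImD /= !mul0r subr0 addr0 add0r -/A -/B.
have b1 : `|expR A * cos B - (1 + A)| <= 4 * (e1 * nrm h).
  have -> : expR A * cos B - (1 + A) = expR A * (cos B - 1) + (expR A - 1 - A) by ring.
  apply: le_trans (ler_normD _ _) _; rewrite normrM (ger0_norm E0).
  have : expR A * `|cos B - 1| <= 3 * (e1 * `|B|) by apply: ler_pM.
  lra.
have b2 : `|expR A * sin B - B| <= 5 * (e1 * nrm h).
  have -> : expR A * sin B - B = expR A * (sin B - B) + (expR A - 1) * B by ring.
  apply: le_trans (ler_normD _ _) _; rewrite !normrM (ger0_norm E0).
  have : expR A * `|sin B - B| <= 3 * (e1 * `|B|) by apply: ler_pM.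
  have : `|expR A - 1| * `|B| <= (2 * nrm h) * nrm h by apply: ler_pM.
  have : nrm h * nrm h <= e1 * nrm h by apply: ler_wpM2r.
  lra.
have : e1 * nrm h <= e / 9 * nrm h by apply: ler_wpM2r.
lra.
Qed.

(** With [h = i f / m], take [q = (1 + h)^m] and [r = (1 - h)^m]. Then [r q = (1 - h^2)^m] is close
    to 1, since [m |h|^2] is of order [1 / m]; the factor [r] will certify that the sections of [q]
    are stable. *)
Lemma cexp_poly (f : {poly R[i]}) (M e : R) : 0 < e ->
  (forall t, nrm f.[expi t] <= M) ->
  exists q r : {poly R[i]}, forall t,
    nrm (q.[expi t] - cexp ((0 +i* 1) * f.[expi t])) <= e /\
    1 / 2 <= complex.Re (r * q).[expi t].
Proof.
move=> e0 fM.
have M0 : 0 <= M by apply: le_trans (fM 0); exact: nrm_ge0.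
(* Taking the power [m] multiplies the local error [e1 * (M / m)] by at most [m * expR M]; [M + 1]
   keeps the denominator positive. *)
pose e1 := e / ((M + 1) * expR M).
have c0 : 0 < (M + 1) * expR M by rewrite mulr_gt0 ?expR_gt0 // ltr_wpDl.
have e10 : 0 < e1 by rewrite divr_gt0.
have [d d0 hd] := cexp_approx e10.
(* The first summand brings [M / m] below [d], where [cexp_approx] applies; the second brings [r q]
   within [1 / 2] of 1. *)
pose X := M / d + 2 * (M ^+ 2 * expR (M ^+ 2)).
pose m := (Num.truncn X).+1.
have m0 : 0 < m%:R :> R by rewrite ltr0n.
have m1 : 1 <= m%:R :> R by rewrite ler1n.
have mX : X < m%:R by exact: truncnS_gt.
have md : M / m%:R <= d.
  rewrite ler_pdivrMr // -ler_pdivrMl // mulrC; apply: le_trans (ltW mX).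
  by rewrite lerDl !mulr_ge0 ?expR_ge0 ?exprn_ge0.
have mM : 2 * (M ^+ 2 * expR (M ^+ 2)) <= m%:R.
  by apply: le_trans (ltW mX); rewrite lerDr divr_ge0 // ltW.
pose c : R[i] := (m%:R^-1)%:C * (0 +i* 1).
exists ((1 + c%:P * f) ^+ m), ((1 - c%:P * f) ^+ m) => t.
have hf := fM t; set z := f.[expi t] in hf *.
pose h := c * z.
have hh : nrm h <= M / m%:R.
  rewrite nrmM nrmM nrmR ger0_norm ?invr_ge0 ?ler0n //.
  have -> : nrm (0 +i* 1) = 1 by rewrite nrmE /sqn /= expr0n expr1n add0r sqrtr1.
  by rewrite mulr1 mulrC; apply: ler_wpM2r => //; rewrite invr_ge0 ler0n.
have mh : (0 +i* 1) * z = m%:R * h.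
  rewrite /h /c !mulrA; congr (_ * _).
  have -> : m%:R = (m%:R)%:C :> R[i] by rewrite rmorph_nat.
  by rewrite -rmorphM /= mulfV ?lt0r_neq0 // mul1r.
split.
  rewrite mh cexpMn horner_exp hornerD hornerM !hornerC -/z -/h.
  have B1 : nrm (1 + h) <= expR (M / m%:R).
    apply: le_trans (expR_ge1Dx _); apply: le_trans (nrmD _ _) _.
    by rewrite nrmE sqn1 sqrtr1 lerD2l.
  have B2 : nrm (cexp h) <= expR (M / m%:R).
    rewrite nrm_cexp ler_expR; apply: le_trans hh; apply: le_trans (norm_Re_nrm _).
    exact: ler_norm.
  have B3 : 1 <= expR (M / m%:R) by rewrite -expR0 ler_expR divr_ge0 // ltW.
  apply: le_trans (nrm_exprB m B1 B2 B3) _.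
  have -> : expR (M / m%:R) ^+ m = expR M.
    by rewrite -expRM_natl mulrCA mulfV ?mulr1 // lt0r_neq0.
  have n1 : nrm (1 + h - cexp h) <= e1 * (M / m%:R).
    rewrite -nrmN opprB; apply: le_trans (hd h (le_trans hh md)) _.
    by apply: ler_wpM2l => //; exact: ltW.
  have n2 : m%:R * nrm (1 + h - cexp h) <= e1 * M.
    apply: le_trans (ler_wpM2l (ltW m0) n1) _.
    by rewrite mulrCA [m%:R * _]mulrCA mulfV ?mulr1 // lt0r_neq0.
  apply: le_trans (ler_wpM2r (expR_ge0 _) n2) _.
  have -> : e1 * M * expR M = e * (M * expR M) / ((M + 1) * expR M).
    by rewrite /e1; set ci := (_ * _)^-1; ring.
  rewrite ler_pdivrMr //.
  by apply: ler_wpM2l; [exact: ltW|apply: ler_wpM2r; [exact: expR_ge0|lra]].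
have -> : ((1 - c%:P * f) ^+ m * (1 + c%:P * f) ^+ m).[expi t] = (1 - h ^+ 2) ^+ m.
  rewrite -exprMn horner_exp; congr (_ ^+ _).
  by rewrite hornerM !hornerD !hornerN !hornerM !hornerC -/z /h; ring.
have B1 : nrm (1 - h ^+ 2) <= expR ((M / m%:R) ^+ 2).
  apply: le_trans (expR_ge1Dx _); apply: le_trans (nrmD _ _) _.
  rewrite nrmE sqn1 sqrtr1 lerD2l nrmN nrmX.
  by apply: lerXn2r; rewrite ?nnegrE ?nrm_ge0 // divr_ge0 // ltW.
have B3 : 1 <= expR ((M / m%:R) ^+ 2) by rewrite -expR0 ler_expR exprn_ge0 // divr_ge0 // ltW.
have B2 : nrm (1 : R[i]) <= expR ((M / m%:R) ^+ 2) by rewrite nrmE sqn1 sqrtr1.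
have := nrm_exprB m B1 B2 B3; rewrite expr1n.
have -> : 1 - h ^+ 2 - 1 = - h ^+ 2 by ring.
rewrite nrmN nrmX -expRM_natl.
have -> : m%:R * (M / m%:R) ^+ 2 = M ^+ 2 / m%:R :> R.
  by field; rewrite lt0r_neq0.
move=> b.
have k1 : m%:R * nrm h ^+ 2 <= M ^+ 2 / m%:R.
  have -> : M ^+ 2 / m%:R = m%:R * (M / m%:R) ^+ 2 by field; rewrite lt0r_neq0.
  apply: ler_wpM2l; first exact: ltW.
  by apply: lerXn2r; rewrite ?nnegrE ?nrm_ge0 // divr_ge0 // ltW.
have k2 : expR (M ^+ 2 / m%:R) <= expR (M ^+ 2).
  by rewrite ler_expR ler_pdivrMr // ler_peMr // exprn_ge0.
have k3 : m%:R * nrm h ^+ 2 * expR (M ^+ 2 / m%:R) <= 1 / 2.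
  apply: (@le_trans _ _ (M ^+ 2 / m%:R * expR (M ^+ 2))).
    apply: (ler_pM _ (expR_ge0 _) k1 k2).
    by rewrite mulr_ge0 ?exprn_ge0 ?nrm_ge0 ?ltW.
  rewrite mulrAC ler_pdivrMr //; lra.
have := norm_Re_nrm ((1 - h ^+ 2) ^+ m - 1).
rewrite ReD ReN ler_norml /= => /andP[k4 _].
have := le_trans b k3; lra.
Qed.

End ComplexExponential.

(** * Sectorial factorization of the symbol *)

Section SymbolFactor.
Context (R : realType).

Notation nrm := (@Normc.normc R).

Lemma poly_circle_bound (f : {poly R[i]}) : exists M : R, forall t, nrm f.[expi t] <= M.
Proof.
exists (\sum_(i < size f) nrm f`_i) => t; rewrite horner_coef.
elim/big_rec2: _ => [|i y x _ h]; first by rewrite nrmE sqn0 sqrtr0.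
apply: le_trans (nrmD _ _) _; apply: lerD => //.
by rewrite nrmM nrmX nrm_expi expr1n mulr1.
Qed.

Lemma invc_conj (z : R[i]) : z^-1 = ((sqn z)^-1)%:C * conjc z.
Proof.
have [->|z0] := eqVneq z 0; first by rewrite invr0 conjc0 mulr0.
apply: (mulfI z0); rewrite mulfV // mulrCA mulcJ -rmorphM /= mulVf //.
by rewrite sqn_eq0.
Qed.

Lemma cos_lower (x y : R) : 0 <= y <= pi -> `|x| <= y -> cos y <= cos x.
Proof.
move=> /andP[y0 ypi] xy; rewrite -(cos_norm x).
move: xy; rewrite le_eqVlt => /orP[/eqP -> //|xy]; apply: ltW.
rewrite ltr_cos // in_itv /= ?y0 ?ypi ?normr_ge0 //=.
exact: le_trans (ltW xy) ypi.
Qed.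

Context (a : circle R -> R[i]).

(** [Re (a / q)] has the sign of [Re (a conj q)], and [conj q] is close to [conj (exp (i f))], which
    rotates every point of the curve over the given angle into a sector strictly inside the right
    half-plane. *)
Lemma symbol_factor : piecewise_continuous a -> ~ sharp a 0 ->
  sharp_winding_number a 0 0 ->
  exists (q r : {poly R[i]}) (e : R) (E : seq R), [/\ 0 < e,
    forall t, 1 / 2 <= complex.Re (r * q).[expi t] &
    forall t, t \in `[- pi, pi] -> t \notin E ->
      e <= complex.Re (a (cis t) / q.[expi t])].
Proof.
move=> a_pc a_nz [g [g_cont _ [phi [l [phi_cont phi_homo phi1 g_jump _]]]]].
move=> [rho [w [w_cont g_polar']]]; rewrite mulr0 => /eqP; rewrite subr_eq0 => /eqP w01.
have g_polar : {in `[0, 1], forall s, 0 < rho s /\ g s = (rho s)%:C * expi (w s)}.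
  by move=> s sI; have [h1 h2] := g_polar' s sI; split=> //; rewrite -h2 subr0.
have fib := fiber_half a_nz phi_homo phi1 g_jump w_cont g_polar w01.
have surj := fiber_surj phi_cont phi1.
have [d [e0 [d0 e00 unif]]] := uniform_fiber phi_cont w_cont fib.
have [W hW] : exists W : R, forall s, s \in `[0, 1] -> `|w s| <= W.
  by apply: itv01_bounded => x; apply: cvg_norm; exact: w_cont.
have sg_cont := sqn_within_continuous g_cont.
have [G hG] := itv01_bounded sg_cont.
have rhoE s : s \in `[0, 1] -> sqn (g s) = rho s ^+ 2.
  by move=> sI; have [_ ->] := g_polar s sI; rewrite sqnM sqn_expi mulr1 sqnR.
have sg_gt0 : {in `[0, 1], forall s, 0 < sqn (g s)}.
  by move=> s sI; rewrite rhoE // exprn_gt0 //; case: (g_polar s sI).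
have [c c0 hc] := itv01_lower sg_cont sg_gt0.
(* The arguments of the curve over the angle [t]: a multivalued function, as a whole segment may lie
   over one angle. *)
pose P t x := exists2 s, s \in `[0, 1] & phi s = t /\ w s = x.
have [|t x t' x' [s sI [<- <-]] [s' s'I [<- <-]]|f hf] :=
    @fejer_selection R P W d e0 pi d0 e00.
- by move=> t x [s sI [_ <-]]; exact: hW.
- exact: unif.
have [M hM] := poly_circle_bound f.
have pi0 := pi_gt0 R.
have eta0 : 0 <= pi / 2 - e0 / 4.
  apply: le_trans (hf (phi 0) (w 0) _); first exact: normr_ge0.
  by exists 0; rewrite ?in_itv /= ?lexx ?ler01.
pose k0 := cos (pi / 2 - e0 / 4).
have k00 : 0 < k0.
  apply: cos_gt0_pihalf; apply/andP; split; lra.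
(* Lower bound for [Re (g s * conj (exp (i f)))]: the factors bound the modulus of [g s], that of
   the exponential, and the cosine of the angle between them. *)
pose ka := Num.sqrt c * expR (- M) * k0.
have ka0 : 0 < ka by rewrite !mulr_gt0 ?sqrtr_gt0 ?expR_gt0.
pose Gn := Num.sqrt G.
have Gn0 : 0 <= Gn by exact: sqrtr_ge0.
(* Replacing [exp (i f)] by [q], with error [e1], and the curve by [a], with error [e2], costs at
   most [ka / 4] each, so that [ka / 2] remains. *)
pose e1 := ka / (4 * (Gn + 1)).
have e10 : 0 < e1 by rewrite divr_gt0 // mulr_gt0 // ltr_wpDl.
have [q [r qr]] := cexp_poly e10 hM.
pose Q := expR M + e1.
have Q0 : 0 < Q by rewrite addr_gt0 ?expR_gt0.
pose e2 := ka / (4 * Q).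
have e20 : 0 < e2 by rewrite divr_gt0 // mulr_gt0.
have e22 : 0 < e2 ^+ 2 by rewrite exprn_gt0.
have [E hE] := pc_good a_pc e22.
exists q, r, (ka / 2 / Q ^+ 2), E.
split; first by rewrite divr_gt0 ?exprn_gt0 // divr_gt0.
  by move=> t; case: (qr t).
move=> t tpi tE.
have [hl hr] : sqn (a (cis t) - llimit a t) <= e2 ^+ 2 /\ sqn (a (cis t) - rlimit a t) <= e2 ^+ 2.
  exact: hE.
have [s sI st] := surj t.
have [/andP[l0 l1] gs] := g_jump s sI.
have nl z : sqn z <= e2 ^+ 2 -> nrm z <= e2.
  move=> h; rewrite nrmE -[leRHS]ger0_norm ?(ltW e20) // -sqrtr_sqr.
  exact: ler_wsqrtr.
(* Outside [E] both one-sided limits are within [e2] of [a], hence so is the whole segment,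
   whichever [s] over the angle was chosen. *)
have ag : nrm (a (cis t) - g s) <= e2.
  rewrite gs (jump_point_expi a (l s) st) /jump_point.
  have -> : a (cis t) - ((1 - l s)%:C * llimit a t + (l s)%:C * rlimit a t) =
     (1 - l s)%:C * (a (cis t) - llimit a t) + (l s)%:C * (a (cis t) - rlimit a t).
    by rewrite rmorphB rmorph1; ring.
  apply: le_trans (nrmD _ _) _; rewrite !nrmM !nrmR (ger0_norm l0) ger0_norm ?subr_ge0 //.
  have h1 : (1 - l s) * nrm (a (cis t) - llimit a t) <= (1 - l s) * e2.
    by apply: ler_wpM2l; [rewrite subr_ge0|exact: nl].
  have h2 : l s * nrm (a (cis t) - rlimit a t) <= l s * e2.
    by apply: ler_wpM2l => //; exact: nl.
  apply: le_trans (lerD h1 h2) _; lra.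
have [qE rq] := qr t.
set z := f.[expi t] in qE.
set Ez := cexp _ in qE.
have EzE : Ez = (expR (- complex.Im z))%:C * expi (complex.Re z).
  by rewrite /Ez /cexp ReM ImM /= !mul0r !mul1r sub0r add0r.
have zM : nrm z <= M by exact: hM.
have EzM : nrm Ez <= expR M.
  rewrite nrm_cexp ler_expR; apply: le_trans zM.
  apply: le_trans (norm_Im_nrm _); rewrite ReM /= mul0r mul1r sub0r.
  by rewrite -normrN ler_norm.
have qQ : nrm q.[expi t] <= Q.
  have -> : q.[expi t] = (q.[expi t] - Ez) + Ez by rewrite subrK.
  by apply: le_trans (nrmD _ _) _; rewrite /Q addrC lerD.
have main : ka <= complex.Re (g s * conjc Ez).
  have [rh0 ->] := g_polar s sI.
  have -> : (rho s)%:C * expi (w s) * conjc Ez =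
     (rho s * expR (- complex.Im z))%:C * expi (w s - complex.Re z).
    by rewrite EzE rmorphM [X in _ * (X * _)]conjc_real [X in _ * (_ * X)]expiJ expiD rmorphM; ring.
  rewrite ReM /= mul0r subr0 /ka.
  have h1 : Num.sqrt c <= rho s.
    rewrite -[leRHS]ger0_norm ?(ltW rh0) // -sqrtr_sqr ler_wsqrtr // -rhoE //.
    exact: hc.
  have h2 : expR (- M) <= expR (- complex.Im z).
    rewrite ler_expR lerN2; apply: le_trans zM; apply: le_trans (norm_Im_nrm _).
    exact: ler_norm.
  have h3 : k0 <= cos (w s - complex.Re z).
    apply: cos_lower; first by rewrite eta0 /=; lra.
    by rewrite /z -st; apply: hf; exists s.
  apply: ler_pM; rewrite ?mulr_ge0 ?sqrtr_ge0 ?expR_ge0 ?(ltW k00) //.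
  by apply: ler_pM; rewrite ?sqrtr_ge0 ?expR_ge0.
have nJ (x : R[i]) : nrm (conjc x) = nrm x by rewrite !nrmE sqnJ.
have lowRe (x : R[i]) : - nrm x <= complex.Re x.
  by have := norm_Re_nrm x; rewrite ler_norml => /andP[].
have gG : nrm (g s) <= Gn by rewrite nrmE ler_wsqrtr // hG.
have b1 : - (e2 * Q) <= complex.Re ((a (cis t) - g s) * conjc q.[expi t]).
  apply: le_trans (lowRe _); rewrite lerN2 nrmM nJ.
  by apply: ler_pM; rewrite ?nrm_ge0.
have b2 : - (Gn * e1) <= complex.Re (g s * conjc (q.[expi t] - Ez)).
  apply: le_trans (lowRe _); rewrite lerN2 nrmM nJ.
  by apply: ler_pM; rewrite ?nrm_ge0.
have tot : ka / 2 <= complex.Re (a (cis t) * conjc q.[expi t]).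
  have -> : a (cis t) * conjc q.[expi t] = (a (cis t) - g s) * conjc q.[expi t] +
     (g s * conjc (q.[expi t] - Ez) + g s * conjc Ez).
    by rewrite -mulrDr -rmorphD subrK -mulrDl subrK.
  rewrite ReD ReD.
  have k1 : e2 * Q = ka / 4 by rewrite /e2; field; rewrite lt0r_neq0.
  have k2 : Gn * e1 <= ka / 4.
    rewrite /e1 mulrA ler_pdivrMr ?mulr_gt0 ?ltr_wpDl //.
    by rewrite mulrC; nra.
  lra.
have q0 : 0 < sqn q.[expi t].
  rewrite lt_def sqn_ge0 andbT sqn_eq0; apply/eqP => q0.
  move: rq; rewrite hornerM q0 mulr0 /=; clear; lra.
have qQ2 : sqn q.[expi t] <= Q ^+ 2.
  rewrite -sqn_normc; apply: lerXn2r; rewrite ?nnegrE ?nrm_ge0 //.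
  exact: ltW.
rewrite invc_conj mulrCA ReM /= mul0r subr0.
have h1 : 0 <= ka / 2 by rewrite divr_ge0 // ltW.
have h2 : 0 <= (Q ^+ 2)^-1 by rewrite invr_ge0 exprn_ge0 // ltW.
have h3 : (Q ^+ 2)^-1 <= (sqn q.[expi t])^-1 by rewrite lef_pV2 ?posrE ?exprn_gt0.
rewrite [leRHS]mulrC; exact: ler_pM h1 h2 tot h3.
Qed.

End SymbolFactor.

(** * Uniform stability of the finite sections *)

Section ToeplitzStability.
Context (R : realType).

Notation nrm := (@Normc.normc R).

Lemma cvgC_mul {T : Type} {F : set_system T} {FF : Filter F} (u v : T -> R[i]) (z w : R[i]) :
  (fun i => u i : R[i]^o) @ F --> (z : R[i]^o) ->
  (fun i => v i : R[i]^o) @ F --> (w : R[i]^o) ->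
  (fun i => u i * v i : R[i]^o) @ F --> (z * w : R[i]^o).
Proof.
move=> uz vw.
have rz : (fun i => complex.Re (u i)) @ F --> complex.Re z by exact: cvgC_Re.
have iz : (fun i => complex.Im (u i)) @ F --> complex.Im z by exact: cvgC_Im.
have rw : (fun i => complex.Re (v i)) @ F --> complex.Re w by exact: cvgC_Re.
have iw : (fun i => complex.Im (v i)) @ F --> complex.Im w by exact: cvgC_Im.
apply: cvgC_ReIm.
  rewrite ReM; under eq_fun do rewrite ReM.
  by apply: cvgB; [exact: cvgM rz rw|exact: cvgM iz iw].
rewrite ImM; under eq_fun do rewrite ImM.
by apply: cvgD; [exact: cvgM rz iw|exact: cvgM iz rw].
Qed.

Lemma cvgC_inv {T : Type} {F : set_system T} {FF : Filter F} (u : T -> R[i]) (z : R[i]) :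
  z != 0 -> (fun i => u i : R[i]^o) @ F --> (z : R[i]^o) ->
  (fun i => (u i)^-1 : R[i]^o) @ F --> (z^-1 : R[i]^o).
Proof.
move=> z0 uz; have s : (fun i => (sqn (u i))^-1) @ F --> (sqn z)^-1.
  by apply: cvgV; [rewrite sqn_eq0|exact: cvg_sqn].
have RV (x : R[i]) : complex.Re x^-1 = (sqn x)^-1 * complex.Re x.
  by rewrite invc_conj; case: x => a b /=; rewrite mul0r subr0.
have IV (x : R[i]) : complex.Im x^-1 = (sqn x)^-1 * - complex.Im x.
  by rewrite invc_conj; case: x => a b /=; rewrite mul0r addr0.
apply: cvgC_ReIm.
  by rewrite RV; under eq_fun do rewrite RV; apply: cvgM => //; exact: cvgC_Re.
rewrite IV; under eq_fun do rewrite IV; apply: cvgM => //.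
by apply: cvgN; exact: cvgC_Im.
Qed.

Lemma fourier_circle (b c : circle R -> R[i]) (m : int) :
  (forall t, b (cis t) = c (cis t)) -> fourier b m = fourier c m.
Proof. by move=> e; rewrite /fourier; congr (_ * _); apply: eq_cintegral => t; rewrite e. Qed.

Lemma expi_continuous : continuous (fun t : R => expi t : R[i]^o).
Proof.
move=> t; apply: cvgC_ReIm; [exact: continuous_cos|exact: continuous_sin].
Qed.

Lemma poly_circle_continuous (p : {poly R[i]}) :
  continuous (fun t : R => p.[expi t] : R[i]^o).
Proof.
have -> : (fun t : R => p.[expi t] : R[i]^o) =
    (fun t => \sum_(i < size p) p`_i * expi t ^+ i : R[i]^o).
  by apply/funext => t; rewrite horner_coef.
move=> t; apply: cvgC_sum => i; apply: (@cvgMl_tmp R[i]^o).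
elim: (nat_of_ord i) => [|k IH]; first exact: cvg_cst.
rewrite exprS; under eq_fun do rewrite exprS.
exact: cvgC_mul (expi_continuous (x := t)) IH.
Qed.

(** [r] is bounded on the circle and [|r q| >= 1 / 2] there, which bounds [1 / q]. *)
Lemma tame_inv_poly (q r : {poly R[i]}) :
  (forall t, 1 / 2 <= complex.Re (r * q).[expi t]) ->
  tame (fun t : R => q.[expi t]^-1).
Proof.
move=> h.
have q0 t : q.[expi t] != 0.
  apply/eqP => q0; have := h t; rewrite hornerM q0 mulr0 /=; lra.
have c : continuous (fun t : R => q.[expi t]^-1 : R[i]^o).
  by move=> t; apply: cvgC_inv (poly_circle_continuous (p := q) (x := t)); exact: q0.
have [B hB] := poly_circle_bound r.
split.
- apply: measurable_funTS; apply: continuous_measurable_fun => t.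
  exact: cvgC_Re (c t).
- apply: measurable_funTS; apply: continuous_measurable_fun => t.
  exact: cvgC_Im (c t).
- exists (4 * B ^+ 2) => t _; rewrite sqnV.
  have sq : 0 < sqn q.[expi t] by rewrite lt_def sqn_ge0 sqn_eq0 q0.
  have B0 : 0 < B.
    apply: lt_le_trans (hB t); rewrite nrmE sqrtr_gt0 lt_def sqn_ge0 andbT sqn_eq0.
    by apply/eqP => r0; have := h t; rewrite hornerM r0 mul0r /=; lra.
  have B2 : 0 < B ^+ 2 by rewrite exprn_gt0.
  rewrite invf_ple ?posrE //; last by rewrite mulr_gt0.
  have sr : sqn r.[expi t] <= B ^+ 2.
    rewrite -sqn_normc; apply: lerXn2r; rewrite ?nnegrE ?nrm_ge0 //.
    by apply: le_trans (hB t); exact: nrm_ge0.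
  have : (1 / 2) ^+ 2 <= sqn r.[expi t] * sqn q.[expi t].
    rewrite -sqnM -hornerM; apply: le_trans (sqr_Re_le _).
    by apply: lerXn2r; rewrite ?nnegrE //; apply: le_trans (h t).
  move=> h2; have {h2} : (1 / 2) ^+ 2 <= B ^+ 2 * sqn q.[expi t].
    by apply: le_trans h2 _; apply: ler_wpM2r => //; exact: ltW.
  move=> h3; rewrite -[leLHS]mul1r ler_pdivrMr; last by rewrite mulr_gt0.
  move: h3; rewrite expr_div_n expr1n; lra.
Qed.

Lemma poly_section_bounded (p : {poly R[i]}) :
  exists2 B, 0 <= B & section_bounded (fourier (fun z : circle R => p.[sval z])) B.
Proof.
have [M hM] := poly_circle_bound p.
exists (M ^+ 2 + 1); first by rewrite addr_ge0 ?sqr_ge0.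
apply: bounded_section; first by rewrite ltr_wpDl ?sqr_ge0.
  exact: tame_poly.
move=> t _ /=; rewrite -sqn_normc; apply: ler_wpDr => //.
by apply: lerXn2r; rewrite ?nnegrE ?nrm_ge0 //; apply: le_trans (hM t); exact: nrm_ge0.
Qed.

(** Sections of analytic polynomials are lower triangular and multiply exactly:
    [T_n(r q) = T_n(r) T_n(q)]. The left side is coercive and [T_n(r)] is bounded, so [T_n(q)] is
    bounded below. *)
Lemma poly_section_stable (q r : {poly R[i]}) :
  (forall t, 1 / 2 <= complex.Re (r * q).[expi t]) ->
  exists2 K, 0 <= K & forall n, section_stable (fourier (fun z : circle R => q.[sval z])) K n.
Proof.
move=> h; have [B B0 rB] := poly_section_bounded r.
have pos : 0 < 1 / 2 :> R by lra.
exists ((1 / 2) ^- 2 * B) => [|n x]; first by rewrite mulr_ge0 // invr_ge0 sqr_ge0.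
have := @coercive_stable R (fun z => (r * q).[sval z]) (1 / 2) [::] n pos
  (tame_poly _) (fun t _ _ => h t) x.
move=> /le_trans; apply.
rewrite -mulrA; apply: ler_wpM2l; first by rewrite invr_ge0 sqr_ge0.
apply: le_trans (rB n _).
apply: eq_ler; apply: eq_sqsum => j jn.
have neg (p : {poly R[i]}) k : fourier (fun z : circle R => p.[sval z]) (Negz k) = 0.
  by rewrite fourier_poly.
rewrite (@tsec_factor_right R (fourier (fun z : circle R => (r * q).[sval z]))
  (fourier (fun z => r.[sval z])) (fourier (fun z => q.[sval z])) (size q)).
- by rewrite (tsec_q_head (neg r) _ (ltn_addr _ jn)) -(tsec_q_head (neg r) _ jn).
- exact: neg.
- by move=> k qk; rewrite fourier_poly nth_default.
- move=> m; under eq_bigr do rewrite [fourier (fun z => q.[sval z]) _]fourier_poly.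
  rewrite -fourier_polyM; last exact: tame_poly.
  by apply: fourier_circle => t; rewrite hornerM mulrC.
Qed.

Lemma toeplitz_stable (a : circle R -> R[i]) :
  piecewise_continuous a -> ~ sharp a 0 -> sharp_winding_number a 0 0 ->
  exists M K N, [/\ section_bounded (fourier a) M, 0 <= K &
    forall n, (N <= n)%N -> section_stable (fourier a) K n].
Proof.
move=> a_pc a_nz a_wind.
have [q [r [e [E [e0 rq aq]]]]] := symbol_factor a_pc a_nz a_wind.
have ta := pc_tame a_pc.
have bd (b : circle R -> R[i]) : tame (fun t => b (cis t)) ->
    exists M, section_bounded (fourier b) M.
  move=> tb; have [_ _ [B hB]] := tb; exists (`|B| + 1).
  have B1 : 0 < `|B| + 1 by rewrite ltr_wpDl.
  apply: (bounded_section B1 tb) => t tpi; apply: le_trans (hB t tpi) _.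
  by apply: le_trans (ler_norm _) _; rewrite lerDl.
have [M aM] := bd _ ta.
have ts : tame (fun t => a (cis t) / q.[expi t]).
  by apply: tameM => //; exact: tame_inv_poly rq.
have [Ms sM] := bd (fun z => a z / q.[sval z]) ts.
have [Mq _ qM] := poly_section_bounded q.
have [Kq Kq0 qK] := poly_section_stable rq.
have sK n := @coercive_stable R (fun z => a z / q.[sval z]) e E n e0 ts aq.
have Ks0 : 0 <= e ^- 2 by rewrite invr_ge0 sqr_ge0.
have a_qs (m : int) : fourier a m = \sum_(0 <= l < size q)
    fourier (fun z => q.[sval z]) l * fourier (fun z => a z / q.[sval z]) (m - l%:Z).
  under eq_bigr do rewrite [fourier (fun z => q.[sval z]) _]fourier_poly.
  rewrite -(@fourier_polyM R (fun z => a z / q.[sval z])) //.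
  apply: fourier_circle => t /=; rewrite mulrCA mulfV ?mulr1 //.
  by apply/eqP => q0; have := rq t; rewrite hornerM q0 mulr0 /=; lra.
have [|k qk|K [N [K0 st]]] := factor_stable _ _ a_qs aM sM qM Ks0 Kq0 sK qK.
- by move=> k; rewrite fourier_poly.
- by rewrite fourier_poly nth_default.
by exists M, K, N.
Qed.

End ToeplitzStability.

(** * The inverse operator on l2 *)

Section L2Norm.
Context (R : realType).
Implicit Types (x y : nat -> R[i]).

Lemma l2norm_series x :
  l2norm x = ((\sum_(0 <= k <oo) (sqn (x k))%:E) `^ 2^-1)%E.
Proof.
rewrite /l2norm Lnorm_counting //; congr (_ `^ _)%E.
apply: eq_eseriesr => k _.
rewrite abse_EFin ger0_norm; last by case: (x k) => ? ?; exact: sqrtr_ge0.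
by rewrite poweR_EFin -sqn_normc -powR_mulrn // ; case: (x k) => ? ?; exact: sqrtr_ge0.
Qed.

(** Dictionary between the extended-real norm and bounds on partial sums; [S] is the squared norm,
    the least such bound. *)
Lemma l2normP x :
  (exists S : R, [/\ 0 <= S, l2norm x = (Num.sqrt S)%:E, sqbdd x S &
     forall K, sqbdd x K -> S <= K]) \/
  (l2norm x = +oo%E /\ forall K, ~ sqbdd x K).
Proof.
have part n : (\sum_(0 <= k < n) (sqn (x k))%:E)%E = (sqsum n x)%:E.
  by rewrite sumEFin.
have ge n : ((sqsum n x)%:E <= \sum_(0 <= k <oo) (sqn (x k))%:E)%E.
  by rewrite -part; apply: nneseries_lim_ge => k _; rewrite lee_fin sqn_ge0.
have le K : sqbdd x K -> (\sum_(0 <= k <oo) (sqn (x k))%:E <= K%:E)%E.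
  move=> xK; apply: lime_le.
    by apply: is_cvg_nneseries => k _; rewrite lee_fin sqn_ge0.
  by apply: nearW => n; rewrite part lee_fin.
rewrite l2norm_series; move: ge le.
have : (0 <= \sum_(0 <= k <oo) (sqn (x k))%:E)%E.
  by apply: nneseries_ge0 => k _; rewrite lee_fin sqn_ge0.
case: (\sum_(0 <= k <oo) (sqn (x k))%:E)%E => [S| |] // S0 ge le.
  left; exists S; split.
  - by rewrite -lee_fin.
  - by rewrite poweR_EFin powR12_sqrt // -lee_fin.
  - by move=> n; rewrite -lee_fin.
  - by move=> K /le; rewrite lee_fin.
right; split; first by rewrite poweRyr.
by move=> K /le; rewrite leye_eq.
Qed.

Lemma l2_sqbdd x : l2 x -> exists S : R, [/\ 0 <= S, l2norm x = (Num.sqrt S)%:E & sqbdd x S].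
Proof.
rewrite /l2 /=; case: (l2normP x) => [[S [? ? ? _]] _|[-> _]]; last by rewrite ltxx.
by exists S.
Qed.

Lemma sqbdd_l2 x K : sqbdd x K -> l2 x /\ (l2norm x <= (Num.sqrt K)%:E)%E.
Proof.
move=> xK; case: (l2normP x) => [[S [S0 xS _ SK]]|[_ /(_ K)]]; last by [].
by rewrite /l2 /= xS ltry lee_fin ler_wsqrtr // SK.
Qed.

Lemma bounded_opP (T : (nat -> R[i]) -> (nat -> R[i])) (C : R) : 0 <= C ->
  (forall (c : R[i]) x y, l2 x -> l2 y ->
     T (fun k => c * x k + y k) = (fun k => c * T x k + T y k)) ->
  (forall x L, sqbdd x L -> sqbdd (T x) (C * L)) -> bounded_op T.
Proof.
move=> C0 lin bd; split => //; exists (Num.sqrt C) => x /l2_sqbdd[S [S0 -> xS]].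
have [_] := sqbdd_l2 (bd x S xS).
by rewrite sqrtrM // EFinM.
Qed.

Lemma sqbddD c x y K L : sqbdd x K -> sqbdd y L ->
  sqbdd (fun k => c * x k + y k) (2 * (sqn c * K) + 2 * L).
Proof.
move=> xK yL n; apply: le_trans (sqsumD_le _ _ _) _; rewrite sqsumZ.
by apply: lerD; apply: ler_wpM2l => //; apply: ler_wpM2l; [exact: sqn_ge0|exact: xK].
Qed.

Definition unit_seq (k : nat) : nat -> R[i] := fun i => (i == k)%:R.

Lemma unit_seq_sqbdd k : sqbdd (unit_seq k) 1.
Proof.
move=> n; rewrite /sqsum /unit_seq.
have [kn|nk] := ltnP k n.
  rewrite big_mkord (bigD1 (Ordinal kn)) //= eqxx sqn1 big1 ?addr0 // => i ik.
  by rewrite -val_eqE /= in ik; rewrite (negbTE ik) sqn0.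
rewrite big_nat_eq0 // => i _ lin; rewrite (_ : i == k = false) ?sqn0 //; lia.
Qed.

End L2Norm.

Section ToeplitzInverse.
Context (R : realType) (t : int -> R[i]) (M K : R) (N : nat).
Context (tM : section_bounded t M) (K0 : 0 <= K).
Context (tK : forall n, (N <= n)%N -> section_stable t K n).
Implicit Types (x y : nat -> R[i]).

Lemma tfullD c x y L L' : sqbdd x L -> sqbdd y L' ->
  tfull t (fun k => c * x k + y k) = (fun j => c * tfull t x j + tfull t y j).
Proof.
move=> xL yL; apply/funext => j.
have xy := sqbddD c xL yL.
have h1 := tsec_cvg tM (j := j) xy.
have h2 : (fun n => tsec t n (fun k => c * x k + y k) j : R[i]^o) @ \oo -->
    (c * tfull t x j + tfull t y j : R[i]^o).
  under eq_fun do rewrite tsecD tsecZ.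
  by apply: cvgD; [apply: (@cvgMl_tmp R[i]^o); exact: tsec_cvg xL|exact: tsec_cvg yL].
exact: cvgC_uniq h1 h2.
Qed.

Lemma tfull_bounded_op : bounded_op (tfull t).
Proof.
apply: (@bounded_opP _ _ M); first exact: section_bound_ge0 tM.
  by move=> c x y /l2_sqbdd[S [_ _ xS]] /l2_sqbdd[S' [_ _ yS]]; exact: tfullD xS yS.
by move=> x L; exact: tfull_sqbdd.
Qed.

Lemma tfull_eq x y L L' : sqbdd x L -> sqbdd y L' -> tfull t x = tfull t y -> x = y.
Proof.
move=> xL yL e; apply/funext => k; apply/eqP; rewrite -subr_eq0; apply/eqP.
have b := sqbddD (-1) yL xL.
have /(_ k) <- : forall k, -1 * y k + x k = 0.
  apply: (tfull_inj tM K0 tK b) => j.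
  by rewrite (tfullD _ yL xL) e mulN1r addNr.
by rewrite mulN1r addrC.
Qed.

(** Solutions are unique, so the one obtained for a single bound [L] of [y] obeys the estimate for
    every bound. Uniqueness also makes the solution operator linear. *)
Lemma tfull_inverse : exists B, inverse_op (tfull t) B.
Proof.
have ex y : exists x, forall L, sqbdd y L -> sqbdd x (K * L) /\ tfull t x = y.
  have [[L yL]|nL] := pselect (exists L, sqbdd y L); last first.
    by exists (fun=> 0) => L yL; case: nL; exists L.
  have [x [xL xy]] := tfull_surj tM K0 tK yL.
  have xy' : tfull t x = y by apply/funext.
  exists x => L' yL'; split=> //.
  have [x' [xL' xy2]] := tfull_surj tM K0 tK yL'.
  have -> // : x = x'.
  by apply: (tfull_eq xL xL'); rewrite xy'; apply/esym/funext.
pose B y := projT1 (cid (ex y)).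
have BP y L : sqbdd y L -> sqbdd (B y) (K * L) /\ tfull t (B y) = y.
  by rewrite /B; case: cid => /= x h; exact: h.
exists B; split; first exact: tfull_bounded_op.
  apply: (@bounded_opP _ _ K) => //; last by move=> x L /BP[].
  move=> c x y /l2_sqbdd[S [_ _ xS]] /l2_sqbdd[S' [_ _ yS]].
  have [Bx Tx] := BP x S xS; have [By Ty] := BP y S' yS.
  have [Bxy Txy] := BP _ _ (sqbddD c xS yS).
  by apply: (tfull_eq Bxy (sqbddD c Bx By)); rewrite Txy (tfullD _ Bx By) Tx Ty.
move=> x /l2_sqbdd[S [_ _ xS]]; have [Bx Tx] := BP x S xS; split=> //.
have Txb := tfull_sqbdd tM xS; have [BT TB] := BP _ _ Txb.
exact: (tfull_eq BT xS TB).
Qed.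

(** What is used of the inverse operator: column [k] of its matrix is the square summable solution
    for the [k]-th unit vector. *)
Lemma inv_op_unit k : let x := inv_op (tfull t) (unit_seq R k) in
  (exists L, sqbdd x L) /\ tfull t x = unit_seq R k.
Proof.
move=> x.
have : inverse_op (tfull t) (inv_op (tfull t)).
  have [B hB] := tfull_inverse.
  exact: (@xgetPex _ _ [set B | inverse_op (tfull t) B] (ex_intro _ B hB)).
case=> _ [_ [C hC]] hx.
have [l2e _] := sqbdd_l2 (unit_seq_sqbdd R k).
split; last by case: (hx _ l2e).
have h := hC _ l2e.
have [S [_ eS _]] := l2_sqbdd l2e.
have l2x : l2 x by rewrite /l2 /=; apply: le_lt_trans h _; rewrite eS -EFinM ltry.
by have [L [_ _ xL]] := l2_sqbdd l2x; exists L.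
Qed.

End ToeplitzInverse.

(** * Entries of the inverse finite sections *)

Section InverseEntries.
Context (R : realType).
Implicit Types (t : int -> R[i]).

Definition inv_entry t n (i k : nat) : R[i] :=
  cfun (invmx (tmx t n) *m \col_(j < n) unit_seq R k j) i.

Lemma inv_entryE t n (i k : 'I_n) : inv_entry t n i k = invmx (tmx t n) i k.
Proof.
rewrite /inv_entry cfunE mxE (bigD1 k) //= mxE /unit_seq eqxx mulr1 big1 ?addr0 // => j jk.
by rewrite mxE /unit_seq val_eqE (negbTE jk) mulr0.
Qed.

Lemma tmx_opp t n : tmx (t \o -%R) n = (tmx t n)^T.
Proof. by apply/matrixP => i j; rewrite !mxE [in LHS]/= opprB. Qed.

Lemma inv_entry_opp t n i k : (i < n)%N -> (k < n)%N ->
  inv_entry (t \o -%R) n i k = inv_entry t n k i.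
Proof.
move=> lti ltk.
have := inv_entryE (t \o -%R) (Ordinal lti) (Ordinal ltk).
by rewrite tmx_opp -trmx_inv mxE -inv_entryE.
Qed.

(** Inverses of Toeplitz matrices are persymmetric: the reversal conjugates [T] to its transpose,
    hence also the inverse of [T]. *)
Lemma invmx_tmx_rev t n (i k : 'I_n) : tmx t n \in unitmx ->
  invmx (tmx t n) (rev_ord i) (rev_ord k) = invmx (tmx t n) k i.
Proof.
set T := tmx t n; set V := invmx T => tu.
suff : \matrix_(i, j) V (rev_ord i) (rev_ord j) = V^T.
  by move/matrixP/(_ i k); rewrite !mxE.
have Trev a b : T (rev_ord a) (rev_ord b) = T b a.
  rewrite !mxE /=; congr (t _).
  by have := ltn_ord a; have := ltn_ord b; lia.
have tu' : T^T \in unitmx by rewrite unitmx_tr.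
apply: (can_inj (mulmxK tu')).
rewrite -trmx_mul (mulmxV tu) trmx1; apply/matrixP => a b; rewrite mxE.
transitivity ((V *m T) (rev_ord a) (rev_ord b)).
  rewrite mxE [RHS](reindex_inj rev_ord_inj) /=; apply: eq_bigr => c _.
  by rewrite Trev mxE [T^T _ _]mxE.
by rewrite (mulVmx tu) !mxE (inj_eq rev_ord_inj).
Qed.

Lemma inv_entry_rev t n i k : tmx t n \in unitmx -> (i < n)%N -> (k < n)%N ->
  inv_entry t n (n - i.+1) (n - k.+1) = inv_entry t n k i.
Proof.
move=> tu lti ltk; have := invmx_tmx_rev (Ordinal lti) (Ordinal ltk) tu.
by rewrite -!inv_entryE.
Qed.

Section Limits.
Context (t : int -> R[i]) (M K : R) (N : nat).
Context (tM : section_bounded t M) (K0 : 0 <= K).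
Context (tK : forall n, (N <= n)%N -> section_stable t K n).

Let x k := inv_op (tfull t) (unit_seq R k).

Let err0 k : (fun n => K * (M * tail (x k) n)) @ \oo --> (0 : R).
Proof.
have [[L xL] _] := inv_op_unit tM K0 tK k.
rewrite -(mulr0 K) -(mulr0 M); apply: cvgMl_tmp; apply: cvgMl_tmp.
exact: tail_cvg0 xL.
Qed.

(** Column [k] of the inverse section and column [k] of the inverse operator solve the same first
    [n] equations, so [section_approx] compares them in norm. *)
Let err k n : (N <= n)%N ->
  sqsum n (fun i => inv_entry t n i k - x k i) <= K * (M * tail (x k) n).
Proof.
move=> Nn; have [[L xL] Tx] := inv_op_unit tM K0 tK k.
apply: (section_approx tM K0 (tK Nn) xL) => j jn.
have [h _] := tsec_solve (unit_seq R k) (tK Nn).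
by rewrite /x Tx; exact: h.
Qed.

Lemma inv_entry_cvg i k :
  (fun n => inv_entry t n i k : R[i]^o) @ \oo --> (x k i : R[i]^o).
Proof.
apply/cvgC_sqn; apply: (squeeze_cvgr _ (cvg_cst (0 : R)) (@err0 k)).
near=> n; rewrite sqn_ge0 /=.
have Nn : (N <= n)%N by near: n; exact: nbhs_infty_ge.
have ltin : (i < n)%N by near: n; exact: nbhs_infty_ge.
apply: le_trans (err k Nn).
exact: (sqn_le_sqsum (fun i => inv_entry t n i k - x k i) ltin).
Unshelve. all: by end_near. Qed.

(** Norm convergence of the columns is essential here: the entry moves with [n], and is bounded by
    the error in norm together with the tail of the limit. *)
Lemma inv_entry_corner_cvg0 i k :
  (fun n => inv_entry t n (n - i.+1) k : R[i]^o) @ \oo --> (0 : R[i]^o).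
Proof.
have [[L xL] _] := inv_op_unit tM K0 tK k.
have t0 : (fun n => 2 * (K * (M * tail (x k) n)) + 2 * tail (x k) (n - i.+1)%N) @ \oo --> (0 : R).
  rewrite -[X in _ --> X]addr0 -{1}(mulr0 2) -[X in _ --> _ + X](mulr0 2).
  apply: cvgD; apply: cvgMl_tmp; first exact: (@err0 k).
  apply: (cvg_comp (fun n => n - i.+1)%N (tail (x k)) _ (tail_cvg0 xL)).
  by move=> A [m _ hA]; exists (m + i.+1)%N => // p /= mp; apply: hA => /=; lia.
apply/cvgC_sqn; apply: (squeeze_cvgr _ (cvg_cst (0 : R)) t0).
near=> n; rewrite subr0 sqn_ge0 /=.
have Nn : (N <= n)%N by near: n; exact: nbhs_infty_ge.
have ltin : (i < n)%N by near: n; exact: nbhs_infty_ge.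
have lt2 : (n - i.+1 < n)%N by lia.
have -> : inv_entry t n (n - i.+1) k =
   (inv_entry t n (n - i.+1) k - x k (n - i.+1)%N) + x k (n - i.+1)%N by rewrite subrK.
apply: le_trans (sqnD_le _ _) _; apply: lerD; apply: ler_wpM2l => //.
  apply: le_trans (err k Nn).
  exact: (sqn_le_sqsum (fun i => inv_entry t n i k - x k i) lt2).
apply: le_trans (tail_ge xL (leqnSn _)).
by rewrite big_nat1.
Unshelve. all: by end_near. Qed.

End Limits.

End InverseEntries.

(** * Determinants of corner perturbations *)

Section Determinants.

(** Both sides are the determinant of [block_mx 1%:M A (- B) 1%:M], factored in two ways into block
    triangular matrices. *)
Lemma sylvester_det (F : comPzRingType) m n (A : 'M[F]_(m, n)) (B : 'M[F]_(n, m)) :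
  \det (1%:M + A *m B) = \det (1%:M + B *m A).
Proof.
have e1 : block_mx (1%:M + A *m B) A 0 1%:M *m block_mx 1%:M 0 (- B) 1%:M =
    block_mx 1%:M A (- B) 1%:M.
  rewrite mulmx_block !mulmx1 !mul1mx !mul0mx !mulmx0 !mulmxN.
  by rewrite addrK !add0r.
have e2 : block_mx 1%:M 0 (- B) 1%:M *m block_mx 1%:M A 0 (1%:M + B *m A) =
    block_mx 1%:M A (- B) 1%:M.
  rewrite mulmx_block !mulmx1 !mul1mx !mul0mx !mulNmx.
  by rewrite !addr0 addrC addrK.
have := congr1 determinant e1; rewrite -e2 !det_mulmx !det_ublock !det_lblock !det1.
by rewrite !mulr1 !mul1r.
Qed.

Context (R : realType).

(** Its columns are the first [m] and the last [m] unit vectors, so that [E_n] factors through size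
    [2 m]. *)
Definition corner_sel m p : 'M[R[i]]_(m + (p + m), m + m) :=
  col_mx (row_mx 1%:M 0) (col_mx 0 (row_mx 0 1%:M)).

Lemma corner_sel_tr m p :
  (corner_sel m p)^T = row_mx (col_mx 1%:M 0) (row_mx 0 (col_mx 0 1%:M)).
Proof. by rewrite !tr_col_mx !tr_row_mx !trmx1 !trmx0. Qed.

Lemma corner_mxE m p (E11 E12 E21 E22 : 'M[R[i]]_m) :
  corner_mx E11 E12 E21 E22 (m + (p + m)) =
  corner_sel m p *m block_mx E11 E12 E21 E22 *m (corner_sel m p)^T.
Proof.
rewrite /corner_mx.
(* The truncated difference occurs in types; it is generalized before being identified with [p]. *)
have : (m + (p + m) - 2 * m)%N = p by lia.
move: (_ - _)%N => p' ->; rewrite conform_mx_id.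
have -> : corner_sel m p *m block_mx E11 E12 E21 E22 =
    col_mx (row_mx E11 E12) (col_mx 0 (row_mx E21 E22)).
  rewrite mul_col_mx mul_row_block mul_col_mx mul_row_block.
  by rewrite !mul1mx !mul0mx !addr0 !add0r.
rewrite corner_sel_tr mul_col_mx !mul_mx_row mul_col_mx mul_row_col.
rewrite mul_col_mx mul_row_col.
rewrite !mul0mx !mulmx1 !mulmx0 !addr0 !add0r mul_col_mx !mul_row_col.
by rewrite !mul0mx !mulmx1 !mulmx0 !addr0 !add0r -block_mxEh.
Qed.

Definition corner_ix m p (c : 'I_(m + m)) : 'I_(m + (p + m)) :=
  match fintype.split c with inl i => lshift _ i | inr k => rshift m (rshift p k) end.

Lemma corner_selE m p i c : corner_sel m p i c = (i == corner_ix p c)%:R.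
Proof.
rewrite /corner_sel /corner_ix; case: (split_ordP c) => k ->; case: (split_ordP i) => j ->.
- by rewrite col_mxEu row_mxEl mxE eq_shift.
- rewrite col_mxEd eq_shift; case: (split_ordP j) => l ->.
    by rewrite col_mxEu mxE.
  by rewrite col_mxEd row_mxEl mxE.
- by rewrite col_mxEu row_mxEr mxE eq_shift.
- rewrite col_mxEd eq_shift; case: (split_ordP j) => l ->.
    by rewrite col_mxEu mxE eq_shift.
  by rewrite col_mxEd row_mxEr mxE eq_shift.
Qed.

Lemma corner_sel_conj m p (V : 'M[R[i]]_(m + (p + m))) :
  (corner_sel m p)^T *m V *m corner_sel m p =
  \matrix_(c, c') V (corner_ix p c) (corner_ix p c').
Proof.
apply/matrixP => c c'; rewrite !mxE (bigD1 (corner_ix p c')) //= big1 ?addr0 => [|j jc].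
  rewrite corner_selE eqxx mulr1 mxE (bigD1 (corner_ix p c)) //= big1 ?addr0 => [|i ic].
    by rewrite mxE corner_selE eqxx mul1r.
  by rewrite mxE corner_selE (negbTE ic) mul0r.
by rewrite corner_selE (negbTE jc) mulr0.
Qed.

(** Factor out [A]; Sylvester's identity then moves the determinant to size [2 m], where only the
    corners of the inverse of [A] remain. *)
Lemma corner_det m p (A : 'M[R[i]]_(m + (p + m))) (E11 E12 E21 E22 : 'M[R[i]]_m) :
  A \in unitmx ->
  \det (A + corner_mx E11 E12 E21 E22 _) / \det A =
  \det (1%:M + \matrix_(c, c') invmx A (corner_ix p c) (corner_ix p c')
            *m block_mx E11 E12 E21 E22).
Proof.
move=> Au; set F := block_mx _ _ _ _.
have -> : A + corner_mx E11 E12 E21 E22 (m + (p + m)) =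
    A *m (1%:M + (invmx A *m corner_sel m p *m F) *m (corner_sel m p)^T).
  by rewrite mulmxDr mulmx1 !mulmxA mulmxV // mul1mx corner_mxE.
rewrite det_mulmx mulrAC divff ?mul1r; last by rewrite -unitfE -unitmxE.
by rewrite sylvester_det !mulmxA corner_sel_conj.
Qed.

Lemma cvg_det {T : Type} {F : set_system T} {FF : Filter F} n
    (A : T -> 'M[R[i]]_n) (B : 'M[R[i]]_n) :
  (forall i j, (fun s => A s i j : R[i]^o) @ F --> (B i j : R[i]^o)) ->
  (fun s => \det (A s) : R[i]^o) @ F --> (\det B : R[i]^o).
Proof.
move=> AB; apply: cvgC_sum => s; apply: (@cvgMl_tmp R[i]^o).
elim: (index_enum _) => [|i l IH].
  by rewrite big_nil; under eq_fun do rewrite big_nil; exact: cvg_cst.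
rewrite big_cons; under eq_fun do rewrite big_cons.
by apply: cvgC_mul; [exact: AB|exact: IH].
Qed.

End Determinants.

(** * Corners and determinants *)

Section CornerLimit.
Context (R : realType).

Lemma flip_mxE m (B : 'M[R[i]]_m) i j : flip_mx B i j = B (rev_ord i) (rev_ord j).
Proof.
rewrite /flip_mx mxE (bigD1 (rev_ord j)) //= big1 ?addr0 => [|k kj]; last first.
  rewrite [counter_id _ _ k j]mxE (_ : j == rev_ord k = false) ?mulr0 //.
  by apply: contraNF kj => /eqP ->; rewrite rev_ordK.
rewrite [counter_id _ _ (rev_ord j) j]mxE rev_ordK eqxx mulr1 mxE.
rewrite (bigD1 (rev_ord i)) //= big1 ?addr0 => [|k ki].
  by rewrite mxE eqxx mul1r.
by rewrite mxE (negbTE ki) mul0r.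
Qed.

Context (a : circle R -> R[i]) (M K : R) (N : nat).
Context (aM : section_bounded (fourier a) M) (K0 : 0 <= K).
Context (aK : forall n, (N <= n)%N -> section_stable (fourier a) K n).

(** Positions are natural numbers, not ordinals below [n], so that the corners form a matrix of
    fixed size whose entries have limits in [n]. *)
Definition corner_pos m n (c : 'I_(m + m)) : nat :=
  if (c < m)%N then c : nat else (n - 2 * m + c)%N.

Definition inv_corners m n : 'M[R[i]]_(m + m) :=
  \matrix_(c, c') inv_entry (fourier a) n (corner_pos n c) (corner_pos n c').

Let pos_l m n (i : 'I_m) : corner_pos n (lshift m i) = i.
Proof. by rewrite /corner_pos /= ltn_ord. Qed.

Let pos_r m n (i : 'I_m) : (2 * m <= n)%N ->
  corner_pos n (rshift m i) = (n - (rev_ord i).+1)%N.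
Proof.
by move=> mn; rewrite /corner_pos /= ltnNge leq_addr /=; have := ltn_ord i; lia.
Qed.

(** The upper left block follows from the convergence of columns, and the lower left one tends to 0
    because columns converge in norm. The upper right block is the lower left one of the transposed
    sections. The lower right block is, by persymmetry, the upper left one at reversed positions and
    transposed, whence the transpose of [flip_mx]. *)
Lemma inv_corners_cvg m c c' :
  (fun n => inv_corners m n c c' : R[i]^o) @ \oo -->
  (block_mx (S11 a m) 0 0 (flip_mx (S11 a m))^T c c' : R[i]^o).
Proof.
have eqcvg (u v : nat -> R[i]) (z : R[i]) : (\forall n \near \oo, v n = u n) ->
    (fun n => v n : R[i]^o) @ \oo --> (z : R[i]^o) ->
    (fun n => u n : R[i]^o) @ \oo --> (z : R[i]^o).
  by move=> uv vz; apply: cvg_trans vz; exact: near_eq_cvg.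
have oM := section_bounded_opp aM.
have oK n : (N <= n)%N -> section_stable (fourier a \o -%R) K n.
  by move=> Nn; exact: section_stable_opp (aK Nn).
case: (split_ordP c) => i ->; case: (split_ordP c') => k ->.
- rewrite block_mxEul mxE; under eq_fun do rewrite mxE !pos_l.
  exact: (inv_entry_cvg aM K0 aK).
- rewrite block_mxEur mxE.
  apply: eqcvg (inv_entry_corner_cvg0 oM K0 oK (rev_ord k) i).
  near=> n; have mn : (2 * m <= n)%N by near: n; exact: nbhs_infty_ge.
  have := ltn_ord i; have := ltn_ord k => km im.
  by rewrite mxE pos_l pos_r // inv_entry_opp //=; lia.
- rewrite block_mxEdl mxE.
  apply: eqcvg (inv_entry_corner_cvg0 aM K0 aK (rev_ord i) k).
  near=> n; have mn : (2 * m <= n)%N by near: n; exact: nbhs_infty_ge.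
  by rewrite mxE pos_l pos_r.
- rewrite block_mxEdr mxE flip_mxE mxE.
  have h : (fun n => inv_entry (fourier a) n (rev_ord k) (rev_ord i) : R[i]^o) @ \oo -->
      (matrix_of_op (inv_op (toeplitz_op a)) (rev_ord k) (rev_ord i) : R[i]^o).
    exact: (inv_entry_cvg aM K0 aK).
  apply: eqcvg h.
  near=> n; have mn : (2 * m <= n)%N by near: n; exact: nbhs_infty_ge.
  have Nn : (N <= n)%N by near: n; exact: nbhs_infty_ge.
  have := ltn_ord i; have := ltn_ord k => km im.
  rewrite mxE !pos_r // inv_entry_rev //=; first exact: tmx_unit (aK Nn).
  all: lia.
Unshelve. all: by end_near. Qed.

Lemma toeplitz_corner_det m n (E11 E12 E21 E22 : 'M[R[i]]_m) :
  (N <= n)%N -> (2 * m <= n)%N ->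
  \det (toeplitz_mx a n + corner_mx E11 E12 E21 E22 n) / \det (toeplitz_mx a n) =
  \det (1%:M + inv_corners m n *m block_mx E11 E12 E21 E22).
Proof.
move=> Nn mn; have [p np] : exists p, n = (m + (p + m))%N by exists (n - 2 * m)%N; lia.
move: Nn mn; rewrite np => Nn mn.
have tu : toeplitz_mx a (m + (p + m)) \in unitmx := tmx_unit (aK Nn).
have ix (d : 'I_(m + m)) : corner_pos (m + (p + m)) d = corner_ix p d :> nat.
  rewrite /corner_ix; case: (split_ordP d) => k ->; first by rewrite pos_l.
  by rewrite pos_r //=; have := ltn_ord k; lia.
have -> : inv_corners m (m + (p + m)) =
    \matrix_(c, c') invmx (toeplitz_mx a (m + (p + m))) (corner_ix p c) (corner_ix p c').
  by apply/matrixP => c c'; rewrite !mxE !ix inv_entryE.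
exact: corner_det.
Qed.

End CornerLimit.

Theorem theorem3p1 (R : realType) (a : circle R -> R[i])
    (a_pc : piecewise_continuous a)
    (a_nz : ~ sharp a 0)
    (a_wind : sharp_winding_number a 0 0)
    (m0 : nat) (m0_gt0 : (0 < m0)%N)
    (E11 E12 E21 E22 : 'M[R[i]]_m0) :
  (\det (toeplitz_mx a n + corner_mx E11 E12 E21 E22 n)
     / \det (toeplitz_mx a n) : R[i]^o) @[n --> \oo] -->
  (\det (block_mx 1%:M 0 0 1%:M
         + block_mx (S11 a m0) 0 0 (flip_mx (S11 a m0))^T
           *m block_mx E11 E12 E21 E22) : R[i]^o).
Proof.
have [M [K [N [aM K0 aK]]]] := toeplitz_stable a_pc a_nz a_wind.
have e : \forall n \near \oo,
    \det (1%:M + inv_corners a m0 n *m block_mx E11 E12 E21 E22) =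
    \det (toeplitz_mx a n + corner_mx E11 E12 E21 E22 n) / \det (toeplitz_mx a n).
  near=> n; rewrite (toeplitz_corner_det K0 aK) //.
    by near: n; exact: nbhs_infty_ge.
  by near: n; exact: nbhs_infty_ge.
apply: cvg_trans (near_eq_cvg e) _.
rewrite -scalar_mx_block; apply: cvg_det => i j.
rewrite !mxE; under eq_fun do rewrite !mxE.
apply: cvgD; first exact: cvg_cst.
apply: cvgC_sum => k; apply: cvgC_mul; last exact: cvg_cst.
exact: (inv_corners_cvg aM K0 aK).
Unshelve. all: by end_near. Qed.
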